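(* Let $n\ge1$ be an integer, $q>0$, and let $W_{\mathrm{rad}}:[0,q]\to[0,\infty)$ be a nondecreasing, lower semicontinuous (hence bounded) function with $W_{\mathrm{rad}}(0)=0$. Let $W:[-q,q]\to[0,\infty)$ be given by $W(u)=W_{\mathrm{rad}}(|u|)$, and assume that $$\int_0^q\frac{ds}{\sqrt{W(s)}}=\infty\quad\text{or}\quad W\equiv0\text{ in a neighbourhood of }0.$$ Let $\Omega\subset\mathbb{R}^n$ be open, and let $\omega$ be a bounded open set with Lipschitz boundary such that $\overline\omega\subset\Omega$. Let $u\in W^{1,2}_{\mathrm{loc}}(\Omega;\mathbb{R})$ be such that $\|u\|_{L^\infty(\Omega)}\le q$ and $u$ is a local minimizer of $E$ for perturbations bounded by $q$ (see context). If $u>0$ on $\partial\omega$, then $u(x)>0$ for all $x\in\omega$.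
   Context: For open $\omega'\subset\mathbb{R}^n$ and $v\in W^{1,2}(\omega';\mathbb{R})$ with $|v|\le q$ a.e., $E_{\omega'}(v):=\int_{\omega'}\big[\frac12|\nabla v|^2+W(v)\big]\,dx$. Local minimizer for perturbations bounded by $q$: for every bounded open set $\omega'$ with Lipschitz boundary such that $\overline{\omega'}\subset\Omega$, and every $v=u+\xi$ with $\xi\in W^{1,2}_0(\omega';\mathbb{R})$ and $\|v\|_{L^\infty(\omega')}\le q$, one has $E_{\omega'}(u)\le E_{\omega'}(v)$. Such a $u$ has a continuous representative in $\Omega$, with which it is identified (so $u>0$ on $\partial\omega$ is meant pointwise). *)

(* Defs.v *)
From HB Require Import structures.
From mathcomp Require Import all_boot all_order all_algebra.
From mathcomp Require Import all_classical all_reals all_analysis.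

Set Implicit Arguments.
Unset Strict Implicit.
Unset Printing Implicit Defensive.
Import Order.TTheory GRing.Theory Num.Theory.
Import numFieldNormedType.Exports.

Local Open Scope classical_set_scope.
Local Open Scope ring_scope.

(* R^n is 'rV[R]_n, with the library's topology and maximum norm. Its Borel
   sigma-algebra is presented as the product sigma-algebra. *)

Definition measure_rV_display : measure_display -> measure_display.
Proof. exact. Qed.

Section measurable_rV.
Context {R : realType} (n : nat).

Let coors : 'I_n -> 'rV[R]_n -> measurableTypeR R := fun i x => x ord0 i.

Let rV_set0 : g_sigma_preimage coors set0.
Proof. exact: sigma_algebra0. Qed.

Let rV_setC A : g_sigma_preimage coors A -> g_sigma_preimage coors (~` A).
Proof. exact: sigma_algebraC. Qed.

Let rV_bigcup (F : _^nat) : (forall i, g_sigma_preimage coors (F i)) ->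
  g_sigma_preimage coors (\bigcup_i (F i)).
Proof. exact: sigma_algebra_bigcup. Qed.

HB.instance Definition _ := @isMeasurable.Build
  (measure_rV_display default_measure_display)
  'rV[R]_n (g_sigma_preimage coors) rV_set0 rV_setC rV_bigcup.

End measurable_rV.

Section lebesgue_rV.
Context {R : realType}.

Lemma measurable_rV_coor n (i : 'I_n) :
  measurable_fun [set: 'rV[R]_n] (fun x => x ord0 i).
Proof.
move=> _ Y mY; rewrite setTI; apply: sub_sigma_algebra => /=.
rewrite -bigcup_seq/=; exists i => /=; first by rewrite mem_index_enum.
by exists Y => //; rewrite setTI.
Qed.

Lemma measurable_fun_rV d (T : measurableType d) n (f : T -> 'rV[R]_n) :
  (forall i, measurable_fun [set: T] (fun x => f x ord0 i)) ->
  measurable_fun [set: T] f.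
Proof.
move=> mf _ A; rewrite setTI; move: A.
suff: @measurable _ 'rV[R]_n `<=` [set A | measurable (f @^-1` A)] by [].
apply: smallest_sub.
  split => /=.
  - by rewrite preimage_set0.
  - by move=> A mA; rewrite setTD preimage_setC; exact: measurableC.
  - by move=> F mF; rewrite preimage_bigcup; exact: bigcup_measurable.
move=> A; rewrite -bigcup_seq => -[i _] [B mB <-] /=.
by rewrite setTI; have := mf i measurableT _ mB; rewrite setTI.
Qed.

Definition cons_rV n (p : R * 'rV[R]_n) : 'rV[R]_n.+1 := row_mx p.1%:M p.2.

Definition uncons_rV n (x : 'rV[R]_n.+1) : R * 'rV[R]_n :=
  (x ord0 ord0, \row_i x ord0 (lift ord0 i)).

Lemma uncons_rVK n : cancel (@uncons_rV n) (@cons_rV n).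
Proof.
move=> x; apply/rowP => i; rewrite /cons_rV mxE; case: splitP => j /= ij.
  rewrite !mxE !ord1 eqxx mulr1n; congr (x _ _); apply/val_inj => /=.
    by rewrite ij ord1.
by rewrite !mxE; congr (x _ _); apply/val_inj; rewrite /= ij.
Qed.

Lemma cons_rVK n : cancel (@cons_rV n) (@uncons_rV n).
Proof.
move=> [x y]; rewrite /uncons_rV; congr (_, _).
  rewrite mxE; case: splitP => // j _.
  by rewrite mxE !ord1 eqxx mulr1n.
apply/rowP => i; rewrite !mxE; case: splitP => [j /= ij|j /= [ij]].
  by have := ltn_ord j; rewrite -ij.
by congr (y _ _); apply/val_inj.
Qed.

Lemma measurable_cons_rV n : measurable_fun setT (@cons_rV n).
Proof.
apply: measurable_fun_rV => i; rewrite /cons_rV.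
have [->|[j ->]] : i = @lshift 1 n ord0 \/ exists j, i = @rshift 1 n j.
- by case: (@splitP 1 n i) => j ij;
    [left|right; exists j]; apply/val_inj; rewrite /= ij ?ord1.
- rewrite (_ : (fun _ => _) = fst) ; first exact: measurable_fst.
  apply/funext => p; apply: etrans (row_mxEl _ _ _ _) _.
  by rewrite mxE eqxx mulr1n.
- rewrite (_ : (fun _ => _) = (fun x : 'rV[R]_n => x ord0 j) \o snd).
    exact: measurableT_comp (measurable_rV_coor j) measurable_snd.
  by apply/funext => p; exact: row_mxEr.
Qed.

Lemma measurable_uncons_rV n : measurable_fun setT (@uncons_rV n).
Proof.
apply: measurable_fun_pair => /=; first exact: measurable_rV_coor.
apply: measurable_fun_rV => i; under eq_fun do rewrite mxE.
exact: measurable_rV_coor.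
Qed.

Section lebesgue_step.
Context n (mu : {sigma_finite_measure set 'rV[R]_n -> \bar R}).

Definition lebesgue_step : set 'rV[R]_n.+1 -> \bar R :=
  pushforward (@lebesgue_measure R \x mu)%E (@cons_rV n).

Let lebesgue_step0 : lebesgue_step set0 = 0%E.
Proof. by rewrite /lebesgue_step /pushforward preimage_set0 measure0. Qed.

Let lebesgue_step_ge0 A : (0 <= lebesgue_step A)%E.
Proof. by rewrite /lebesgue_step /pushforward measure_ge0. Qed.

Let lebesgue_step_sigma_additive : semi_sigma_additive lebesgue_step.
Proof.
rewrite /lebesgue_step => F mF tF mUF; rewrite /pushforward preimage_bigcup.
have mc := @measurable_cons_rV n; apply: measure_semi_sigma_additive.
- by move=> k; rewrite -[X in measurable X]setTI; exact: mc.
- apply/trivIsetP => /= i j _ _ ij; rewrite -preimage_setI.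
  by move/trivIsetP : tF => /(_ _ _ _ _ ij) ->//; rewrite preimage_set0.
- by rewrite -preimage_bigcup -[X in measurable X]setTI; exact: mc.
Qed.

HB.instance Definition _ := isMeasure.Build _ _ _ lebesgue_step
  lebesgue_step0 lebesgue_step_ge0 lebesgue_step_sigma_additive.

Let lebesgue_step_sigma_finite : sigma_finite setT lebesgue_step.
Proof.
have /sigma_finiteP[F [TF ndF Foo]] := sigma_finiteT (@lebesgue_measure R).
have /sigma_finiteP[G [TG ndG Goo]] := sigma_finiteT mu.
exists (fun k => @uncons_rV n @^-1` (F k `*` G k)).
  rewrite -preimage_bigcup -(@preimage_setT _ _ (@uncons_rV n)).
  congr (_ @^-1` _); rewrite -setXTT TF TG predeqE => -[x y]; split.
    move=> [/= [k _ Fkx] [l _ Gly]]; exists (maxn k l) => //; split.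
    - by move: x Fkx; exact/subsetPset/ndF/leq_maxl.
    - by move: y Gly; exact/subsetPset/ndG/leq_maxr.
  by move=> [k _ []/= ? ?]; split; exists k.
move=> k; have [mF Fk] := Foo k; have [mG Gk] := Goo k; split.
  rewrite -[X in measurable X]setTI; apply: measurable_uncons_rV => //.
  exact: measurableX.
rewrite /lebesgue_step /pushforward -comp_preimage.
rewrite (_ : _ \o _ = id) ?preimage_id; last by apply/funext; exact: cons_rVK.
by rewrite product_measure1E// lte_mul_pinfty// ge0_fin_numE.
Qed.

HB.instance Definition _ := Measure_isSigmaFinite.Build _ _ _ lebesgue_step
  lebesgue_step_sigma_finite.

End lebesgue_step.

Fixpoint lebesgue_rV n : {sigma_finite_measure set 'rV[R]_n -> \bar R} :=
  if n is m.+1 then lebesgue_step (lebesgue_rV m) else \d_(0 : 'rV[R]_0).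

End lebesgue_rV.

Section sobolev.
Context {R : realType} {n : nat}.
Local Notation Rn := 'rV[R]_n.
Local Notation mu := (@lebesgue_rV R n).
Implicit Types (U Omega : set Rn) (f g u v xi phi : Rn -> R) (i : 'I_n).

Definition partial i f : Rn -> R := 'D_('e_i) f.

Definition partials (s : seq 'I_n) f : Rn -> R := foldr partial f s.

Definition smooth phi := forall s : seq 'I_n,
  continuous (partials s phi) /\
  forall (x : Rn) i, derivable (partials s phi) x 'e_i.

(* C_c^oo(U), extended by 0 to R^n *)
Definition test_function U : set (Rn -> R) := [set phi |
  smooth phi /\ compact (closure [set x | phi x != 0]) /\
  closure [set x | phi x != 0] `<=` U].

Definition locally_integrable_on U f := measurable_fun U f /\
  forall K : set Rn, compact K -> K `<=` U -> mu.-integrable K (EFin \o f).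

Definition is_weak_partial U i v g := locally_integrable_on U g /\
  forall phi, test_function U phi ->
    \int[mu]_(x in U) (v x * partial i phi x) =
    - \int[mu]_(x in U) (g x * phi x).

(* Determined only up to a null subset of U; the null function if there is no
   weak derivative. *)
Definition weak_partial U i v : Rn -> R :=
  xget (cst 0) [set g | is_weak_partial U i v g].

Definition normsq_grad U v (x : Rn) : R :=
  \sum_(i < n) weak_partial U i v x ^+ 2.

Definition square_integrable U f := measurable_fun U f /\
  (\int[mu]_(x in U) (f x ^+ 2)%:E < +oo)%E.

Definition W12 U : set (Rn -> R) := [set v |
  square_integrable U v /\
  forall i, exists2 g, is_weak_partial U i v g & square_integrable U g].

Definition W12_loc Omega : set (Rn -> R) := [set v |
  forall U, open U -> compact (closure U) -> closure U `<=` Omega -> W12 U v].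

Definition W12_normsq U v : \bar R :=
  (\int[mu]_(x in U) (v x ^+ 2 + normsq_grad U v x)%:E)%E.

Definition W12_0 U : set (Rn -> R) := [set xi | W12 U xi /\
  forall e : R, 0 < e ->
    exists2 phi, test_function U phi & (W12_normsq U (xi \- phi)%R < e%:E)%E].

Definition Linfty_norm U v : \bar R :=
  ('N[mu]_+oo[(EFin \o v) \_ U])%E.

(* Near each boundary point, in suitable orthonormal coordinates y *m Q, the
   set U is the strict epigraph of a Lipschitz function of the coordinates
   other than the i-th. *)
Definition lipschitz_boundary U :=
  forall x : Rn, (closure U `\` interior U) x ->
  exists r : R, 0 < r /\
  exists Q : 'M[R]_n, Q *m Q^T = 1%:M /\
  exists (i : 'I_n) (k : R) (gamma : 'rV[R]_n.-1 -> R), k.-lipschitz gamma /\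
  forall y : Rn, ball x r y ->
    (U y <-> gamma (col' i (y *m Q)) < (y *m Q) ord0 i).

Definition energy (W : R -> R) U v : \bar R :=
  (\int[mu]_(x in U) (2^-1 * normsq_grad U v x + W (v x))%:E)%E.

Definition local_minimizer (q : R) (W : R -> R) Omega u :=
  forall U, open U -> bounded_set U -> lipschitz_boundary U ->
  closure U `<=` Omega ->
  forall xi, W12_0 U xi -> (Linfty_norm U (u \+ xi)%R <= q%:E)%E ->
  (energy W U u <= energy W U (u \+ xi)%R)%E.

End sobolev.

(* Main.v *)
(* Extend the potential to [Wb] on the line by 0 on the negative half-line and
   put [sigma = sqrt (2 Wb + c)], with [c > 0]. Let [tau' = sigma (tau)],
   [tau 0 = 0], and let [theta = Lam * exp (- (x_0 - a)^2)], where [a] and [Lam]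
   are such that the first two derivatives of [theta] in [x_0] are at least 1 on
   [omega]. The integral condition on [W] says that the flow needs an arbitrarily
   long time to leave 0 when [c] is small, so [c] can be chosen with
   [p = tau (theta)] positive and smaller than [u] on the boundary of [omega].
   Compare [u] with [max u p]. Because of the calibration
   [(d u)^2 >= 2 theta' sigma(u) d u - theta'^2 sigma(u)^2] (an equality for [p]),
   an integration by parts against [theta'] and [theta'' >= 1], minimality implies
   that the integral of [sqrt c * (p - u)^+] is at most 0, the potential terms
   cancelling out. Hence [u >= p > 0] on [omega].
   In order to have smooth competitors and since [sigma] may jump, the comparison is
   done for a mollification of [u] and for the flow of a Lipschitz regularization
   of [sigma], and one passes to the limit. *)
Require Import Defs.
From mathcomp Require Import all_boot all_order all_algebra.
From mathcomp Require Import all_classical all_reals all_analysis.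
From mathcomp Require Import measurable_realfun ring lra.

Set Implicit Arguments.
Unset Strict Implicit.
Unset Printing Implicit Defensive.
Import Order.TTheory GRing.Theory Num.Theory.
Import numFieldNormedType.Exports.

Local Open Scope classical_set_scope.
Local Open Scope ring_scope.

(** * Borel sets and Fubini on R^n *)

Section rV_measure.
Context {R : realType}.
Local Notation mu n := (@lebesgue_rV R n).

(** If [Wb] were smooth, [sigma * sigma' = Wb'] would give [p = tau (theta)] the Laplacian
    [Wb' (p) * theta'^2 + sigma (p) * theta''], which is at least [Wb' (p) + sqrt c] because
    [Wb' >= 0] and [theta', theta'' >= 1]. So [p] is formally a strict subsolution of the
    Euler-Lagrange equation, and the excess [sqrt c] is what forces [u >= p]. With jumps there is no
    such equation; the calibration replaces it, since it involves values of [sigma] and no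
    derivative of it. Mollification confines positive parts, chain rules and integrations by parts
    to continuously differentiable functions: the perturbation is itself a test function, hence in
    [W12_0], and the only Sobolev function left is [u], seen through the definition of its weak
    gradient. The cost is an error [e] that could cross a jump of [Wb]. Monotonicity makes such
    errors one-sided: the field is delayed by between [e] and [2 * e], and the barrier is lowered by
    [3 * e], so every inequality errs in the useful direction. Lower semicontinuity, which for a
    monotone function is left continuity, closes the gap as [e] tends to 0. *)

Lemma ge0_integral_rVS n (F : 'rV[R]_n.+1 -> \bar R) :
  measurable_fun [set: 'rV[R]_n.+1] F -> (forall x, 0 <= F x)%E ->
  (\int[mu n.+1]_x F x = \int[lebesgue_measure]_a \int[mu n]_y F (cons_rV (a, y)))%E.
Proof.
move=> mF F0; rewrite /= /lebesgue_step ge0_integral_pushforward//; last first.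
  exact: measurable_cons_rV.
rewrite preimage_setT fubini_tonelli1//; last by move=> x; exact: F0.
apply: measurableT_comp => //; exact: measurable_cons_rV.
Qed.

(** Written by coordinates, so that [cons_rV] splits a cube into an interval and a cube of one
    dimension less; finiteness of the measure then follows by induction. *)
Definition cube n (M : R) : set 'rV[R]_n := [set x | forall i, `|x ord0 i| <= M].

Lemma measurable_cube n M : measurable (@cube n M).
Proof.
have -> : @cube n M = \big[setI/setT]_(i <- index_enum 'I_n) ((fun x : 'rV[R]_n => x ord0 i) @^-1` `[-M, M]).
  rewrite -bigcap_seq; apply/seteqP; split=> [x Mx i _|x /= + i].
    by rewrite /= in_itv/= -ler_norml; exact: Mx.
  by move=> /(_ i); rewrite /= in_itv/= -ler_norml; apply; rewrite mem_index_enum.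
apply: bigsetI_measurable => i _; rewrite -[X in measurable X]setTI.
exact: measurable_rV_coor.
Qed.

Lemma cons_rV0 n (p : R * 'rV[R]_n) : cons_rV p ord0 ord0 = p.1.
Proof. exact: (congr1 fst (cons_rVK p)). Qed.

Lemma cons_rVS n (p : R * 'rV[R]_n) i : cons_rV p ord0 (lift ord0 i) = p.2 ord0 i.
Proof. by have /rowP/(_ i) := congr1 snd (cons_rVK p); rewrite mxE. Qed.

Lemma cube_cons n M a (y : 'rV[R]_n) :
  cube M (cons_rV (a, y)) <-> `|a| <= M /\ cube M y.
Proof.
split=> [H|[aM yM] i].
  split=> [|i]; first by have := H ord0; rewrite cons_rV0.
  by have := H (lift ord0 i); rewrite cons_rVS.
by case: (unliftP ord0 i) => [j ->|->]; rewrite ?cons_rVS ?cons_rV0.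
Qed.

Lemma cube_fin n M : (mu n (cube M) < +oo)%E.
Proof.
elim: n => [|n IH]; first by rewrite /= diracE; case: (_ \in _); exact: ltry.
rewrite /= /lebesgue_step /pushforward.
have -> : @cons_rV R n @^-1` cube M = `[-M, M]%classic `*` cube M.
  apply/seteqP; split=> [[a y] /= /cube_cons|[a y] [/= aM yM]].
    by rewrite in_itv/= -ler_norml.
  by apply/cube_cons; move: aM; rewrite in_itv/= -ler_norml.
rewrite product_measure1E//; last exact: measurable_cube.
rewrite lte_mul_pinfty//.
have LM : (@lebesgue_measure R `[(- M)%R, M]%classic < +oo)%E.
  by rewrite lebesgue_measure_itv; case: ifP => // _; rewrite -EFinD ltry.
by rewrite ge0_fin_numE//; exact: LM.
Qed.

Lemma ball_rV n (x y : 'rV[R]_n) e : 0 < e ->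
  ball x e y <-> forall i, `|x ord0 i - y ord0 i| < e.
Proof.
move=> e0; split=> [[_ H] i|H]; first exact: H.
by split=> // i j; rewrite ord1; exact: H.
Qed.

(** Boxes with rational centre and radius the inverse of a positive integer are countably many.
    Those that do not fit in [U] receive radius 0 and are discarded by the condition [0 < r k]. This
    countable cover links the topology to the product sigma-algebra. *)
Lemma open_boxes n (U : set 'rV[R]_n) : open U ->
  exists (c : nat -> 'rV[R]_n) (r : nat -> R),
    (forall k (x : 'rV[R]_n), 0 < r k -> (forall i, `|x ord0 i - c k ord0 i| <= r k) -> U x) /\
    (forall x, U x -> exists2 k, 0 < r k & forall i, `|x ord0 i - c k ord0 i| < r k).
Proof.
move=> oU.
pose c (pk : 'rV[rat]_n * nat) : 'rV[R]_n := \row_i ratr (pk.1 ord0 i).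
pose B pk := forall x : 'rV[R]_n, (forall i, `|x ord0 i - c pk ord0 i| <= pk.2.+1%:R^-1) -> U x.
exists (fun m => if unpickle m is Some pk then c pk else 0).
exists (fun m => if unpickle m is Some pk then if `[< B pk >] then pk.2.+1%:R^-1 else 0 else 0).
split=> [m x|x Ux].
  case: (unpickle m) => [pk|]; last by rewrite ltxx.
  by case: asboolP => [H _|_]; [exact: H|rewrite ltxx].
have /nbhs_ballP[e /= e0 xeU] : nbhs x U by exact: open_nbhs_nbhs.
(* With radius below [e / 2], a closed box whose centre is that close to [x] stays in the ball of
   radius [e] around [x]. *)
have [k ke] := @ltr_add_invr R 0 (e / 2) (divr_gt0 e0 (ltr0n _ 2)); rewrite add0r in ke.
have k0 : 0 < k.+1%:R^-1 :> R by rewrite invr_gt0.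
have /choice[p Hp] : forall i : 'I_n, exists r : rat, `|x ord0 i - ratr r| < k.+1%:R^-1.
  move=> i; have := @rat_in_itvoo R (x ord0 i - k.+1%:R^-1) (x ord0 i + k.+1%:R^-1).
  case; first by rewrite ltrD2l gtrN.
  by move=> r; rewrite in_itv/= -ltr_distl distrC; exists r.
have Bp : B (\row_i p i, k).
  move=> y Hy; apply: xeU; apply/ball_rV => // i.
  have := Hy i; rewrite !mxE/= => Hyi.
  rewrite (le_lt_trans (ler_distD (ratr (p i)) _ _))//.
  rewrite [ltRHS]splitr ltrD//; first exact: lt_trans (Hp i) ke.
  by rewrite distrC; exact: le_lt_trans Hyi ke.
exists (pickle (\row_i p i, k)); rewrite pickleK asboolT// => i.
by rewrite !mxE; exact: Hp.
Qed.

Lemma measurable_box n (c : 'rV[R]_n) (r : R) :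
  measurable [set x : 'rV[R]_n | forall i, `|x ord0 i - c ord0 i| < r].
Proof.
have -> : [set x : 'rV[R]_n | forall i, `|x ord0 i - c ord0 i| < r] =
  \big[setI/setT]_(i <- index_enum 'I_n)
    ((fun x : 'rV[R]_n => x ord0 i) @^-1` `](c ord0 i - r), (c ord0 i + r)[).
  rewrite -bigcap_seq; apply/seteqP; split=> [x Mx i _|x /= + i].
    by rewrite /= in_itv/= -ltr_distl; exact: Mx.
  by move=> /(_ i); rewrite /= in_itv/= -ltr_distl; apply; rewrite mem_index_enum.
apply: bigsetI_measurable => i _; rewrite -[X in measurable X]setTI.
exact: measurable_rV_coor.
Qed.

Lemma open_measurable_rV n (U : set 'rV[R]_n) : open U -> measurable U.
Proof.
move=> /open_boxes[c [r [cU Uc]]].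
have -> : U = \bigcup_k (if 0 < r k then [set x | forall i, `|x ord0 i - c k ord0 i| < r k] else set0).
  apply/seteqP; split=> [x /Uc[k k0 xk]|x [k _]].
    by exists k => //; rewrite k0.
  case: ifPn => // k0 /= H; apply: (cU k) => // i; exact: ltW.
apply: bigcupT_measurable => k; case: ifPn => _; last exact: measurable0.
exact: measurable_box.
Qed.

Lemma continuous_within_measurable n (D : set 'rV[R]_n) (f : 'rV[R]_n -> R) :
  open D -> {within D, continuous f} -> measurable_fun D f.
Proof.
move=> oD /continuousP cf; apply: (measurability _ (RGenOpens.measurableE R)).
move=> _ [_ [a [b ->] <-]]; apply: open_measurable_rV.
have oab : open `]a, b[%classic by exact: interval_open.
have /open_subspaceP[V oV VE] := cf _ oab.
by rewrite setIC -VE; exact: openI.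
Qed.

Lemma continuous_measurable_rV n (f : 'rV[R]_n -> R) :
  continuous f -> measurable_fun [set: 'rV[R]_n] f.
Proof.
move=> cf; apply: continuous_within_measurable; first exact: openT.
exact: continuous_subspaceT.
Qed.

(* bounded, measurable, with bounded support *)
Definition bms n (f : 'rV[R]_n -> R) := measurable_fun [set: 'rV[R]_n] f /\
  exists2 M : R, (forall x, `|f x| <= M) & (forall x, f x != 0 -> cube M x).

Lemma bms_integrable n (f : 'rV[R]_n -> R) : bms f ->
  (mu n).-integrable setT (EFin \o f).
Proof.
move=> [mf [M fM fc]].
have -> : EFin \o f = (EFin \o f) \_ (cube M).
  apply/funext => x; rewrite patchE; case: ifPn => //= /negP xM.
  by congr EFin; apply/eqP/negPn/negP => /fc; rewrite -inE.
apply/(integrable_mkcond _ (@measurable_cube n M)).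
apply: measurable_bounded_integrable => //.
- exact: measurable_cube.
- exact: cube_fin.
- exact: measurable_funTS.
- exists M; split; first exact: num_real.
  by move=> N MN x _; apply: (le_trans (fM x)); exact: ltW.
Qed.

End rV_measure.

(** * Directional derivatives as one-variable derivatives *)

Section line_derivatives.
Context {R : realType} {V : normedModType R}.

(** Restricting to a line makes the one-variable chain rule available for functions known only to
    have a derivative in one direction. *)
Lemma is_derive_line (f : V -> R) (x v : V) (t d : R) :
  is_derive (x + t *: v) v f d <-> is_derive t 1 (fun s => f (x + s *: v)) d.
Proof.
have E : (fun h : R => h^-1 *: ((f \o shift (x + t *: v)) (h *: v) - f (x + t *: v)))
   = (fun h : R => h^-1 *: (((fun s => f (x + s *: v)) \o shift t) (h *: (1 : R)) - f (x + t *: v))).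
  apply/funext => h /=; congr (_ *: (f _ - _)).
  by rewrite -[h *: 1]/(h * 1) mulr1 scalerDl addrCA addrC.
split=> -[df dE]; split.
- by rewrite /derivable -E.
- by rewrite /derive -E.
- by rewrite /derivable E.
- by rewrite /derive E.
Qed.

Lemma is_derive_line0 (f : V -> R) (x v : V) (d : R) :
  is_derive x v f d <-> is_derive (0 : R) 1 (fun s => f (x + s *: v)) d.
Proof. by rewrite -is_derive_line scale0r addr0. Qed.

Lemma is_derive_scalar_comp (f : V -> R) (g : R -> R) (x v : V) (d e : R) :
  is_derive x v f d -> is_derive (f x) 1 g e -> is_derive x v (g \o f) (e * d).
Proof.
move=> /is_derive_line0 df dg; apply/is_derive_line0.
apply: (@is_derive1_comp _ g (fun s => f (x + s *: v))) df.
by rewrite scale0r addr0.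
Qed.
End line_derivatives.

(** * Iterated integrals and the integral of a partial derivative *)

Section integration.
Context {R : realType}.
Local Notation mu n := (@lebesgue_rV R n).

Lemma integrable_rVS n (F : 'rV[R]_n.+1 -> \bar R) :
  (mu n.+1).-integrable setT F ->
  ((@lebesgue_measure R) \x (mu n))%E.-integrable setT (F \o @cons_rV R n).
Proof.
move=> /integrableP[mF iF]; apply/integrableP; split.
  by apply: measurableT_comp => //; exact: measurable_cons_rV.
move: iF; rewrite /= /lebesgue_step ge0_integral_pushforward//.
- exact: measurable_cons_rV.
- exact: measurableT_comp.
Qed.

Lemma integral_rVS n (F : 'rV[R]_n.+1 -> \bar R) : (mu n.+1).-integrable setT F ->
  (\int[mu n.+1]_x F x = \int[lebesgue_measure]_a \int[mu n]_y F (cons_rV (a, y)))%E.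
Proof.
move=> iF; have iF' := integrable_rVS iF.
rewrite /= /lebesgue_step integral_pushforward//.
- by rewrite preimage_setT -integral12_prod_meas1.
- exact: measurable_cons_rV.
- by case/integrableP : iF.
Qed.

Lemma integral_rVS_swap n (F : 'rV[R]_n.+1 -> \bar R) : (mu n.+1).-integrable setT F ->
  (\int[mu n.+1]_x F x = \int[mu n]_y \int[lebesgue_measure]_a F (cons_rV (a, y)))%E.
Proof.
move=> iF; rewrite integral_rVS//.
exact: (Fubini (integrable_rVS iF)).
Qed.

Lemma cons_rV_line0 n a (y : 'rV[R]_n) t :
  cons_rV (a, y) + t *: 'e_ord0 = cons_rV (a + t, y).
Proof.
apply/rowP => j; rewrite [LHS]mxE [X in _ + X]mxE [X in t * X]mxE.
case: (unliftP ord0 j) => [k ->|->]; rewrite ?cons_rVS ?cons_rV0 /=.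
  by rewrite mulr0 addr0.
by rewrite mulr1.
Qed.

Lemma cons_rV_lineS n a (y : 'rV[R]_n) t i :
  cons_rV (a, y) + t *: 'e_(lift ord0 i) = cons_rV (a, y + t *: 'e_i).
Proof.
apply/rowP => j; rewrite [LHS]mxE [X in _ + X]mxE [X in t * X]mxE.
case: (unliftP ord0 j) => [k ->|->]; rewrite ?cons_rVS ?cons_rV0 /=.
  by rewrite !mxE (inj_eq lift_inj).
by rewrite mulr0 addr0.
Qed.

Lemma integral_derive_bounded_support (f f' : R -> R) (M : R) :
  (forall t : R, is_derive t 1 f (f' t)) -> continuous f' ->
  (forall t, f t != 0 -> `|t| <= M) -> (forall t, f' t != 0 -> `|t| <= M) ->
  (\int[lebesgue_measure]_t (f' t)%:E = 0)%E.
Proof.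
(* [N] is strictly larger than [M], so that [f] vanishes at both ends, and positive even if [M] is
   negative, so that the interval is nondegenerate. *)
move=> df cf' sf sf'; pose N : R := `|M| + 1.
have MN : M < N by rewrite /N (le_lt_trans (ler_norm M))// ltrDl.
have N0 : 0 < N by rewrite /N ltr_wpDl.
have f0 t : N <= `|t| -> f t = 0.
  by move=> tN; apply/eqP/negPn/negP => /sf tM; move: (le_lt_trans (le_trans tN tM) MN); rewrite ltxx.
have <- : (\int[lebesgue_measure]_(t in `[(- N)%R, N]) (f' t)%:E = \int[lebesgue_measure]_t (f' t)%:E)%E.
  rewrite integral_mkcond; apply: eq_integral => t _.
  rewrite patchE; case: ifPn => // /negP tN; congr EFin.
  apply/esym/eqP/negPn/negP => /sf' tM; apply: tN.
  by rewrite inE/= in_itv/= -ler_norml (le_trans tM)// ltW.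
have cf : continuous f.
  by move=> t; apply/differentiable_continuous/derivable1_diffP; case: (df t).
rewrite (@continuous_FTC2 _ f' f)//.
- by rewrite !f0 ?sube0 ?normrN ?ger0_norm// ?ltW.
- by rewrite gt0_cp// ltrN.
- exact: continuous_subspaceT.
- split.
  + by move=> t _; case: (df t).
  + by apply: cvg_at_right_filter; exact: cf.
  + by apply: cvg_at_left_filter; exact: cf.
- by move=> t _; rewrite derive1E; case: (df t).
Qed.

(** Fubini peels off the first coordinate. If it is not the [i]-th, each slice vanishes by
    induction; if it is, it is integrated first and the fundamental theorem of calculus concludes.
    Continuity of [F'] is therefore asked only along lines of direction ['e_i]. *)
Lemma integral_partial n (i : 'I_n) (F F' : 'rV[R]_n -> R) (M : R) :
  bms F' -> (forall x, F x != 0 -> cube M x) ->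
  (forall x, is_derive x 'e_i F (F' x)) ->
  (forall x, continuous (fun t : R => F' (x + t *: 'e_i))) ->
  (\int[mu n]_x (F' x)%:E = 0)%E.
Proof.
elim: n i F F' => [|n IH] i F F' bF' sF dF cF'; first by case: i {dF cF'}.
have iF' := bms_integrable bF'.
have [mF' [N F'N sF']] := bF'.
case: (unliftP ord0 i) => [j ij|i0]; subst i.
- rewrite integral_rVS//= integral0_eq// => a _.
  apply: (IH j (fun y => F (cons_rV (a, y)))) => //=.
  + split.
      apply: measurableT_comp => //.
      apply: (measurableT_comp (@measurable_cons_rV R n)).
      exact: measurable_pair1.
    exists N => // y /sF'; by move/cube_cons => [].
  + by move=> y /sF /cube_cons[].
  + move=> y; have /is_derive_line0 := dF (cons_rV (a, y)); move=> H.
    apply/is_derive_line0.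
    by under eq_fun do rewrite -cons_rV_lineS.
  + move=> y; have := cF' (cons_rV (a, y)).
    by under eq_fun do rewrite cons_rV_lineS.
- rewrite integral_rVS_swap//= integral0_eq// => y _.
  apply: (@integral_derive_bounded_support (fun a => F (cons_rV (a, y))) _ (Num.max M N)).
  + move=> t; have -> : (fun a => F (cons_rV (a, y))) = (fun a => F (cons_rV (0, y) + a *: 'e_ord0)).
      by apply/funext => a; rewrite cons_rV_line0 add0r.
    have H := (is_derive_line F (cons_rV (0, y)) 'e_ord0 t _).1 (dF _).
    by move: H; rewrite cons_rV_line0 add0r.
  + have := cF' (cons_rV (0, y)); under eq_fun do rewrite cons_rV_line0 add0r; exact.
  + by move=> t /sF /cube_cons[+ _]; rewrite le_max => ->.
  + by move=> t /sF' /cube_cons[+ _]; rewrite le_max => ->; rewrite orbT.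
Qed.
End integration.

(** * Smooth functions with bounded support *)

Section bump.
Context {R : realType}.
Implicit Types (p : {poly R}) (f g h : R -> R).

(** The classical [exp (- 1 / t)] extended by 0, multiplied by a polynomial in [1 / t] so that the
    family is stable under differentiation. *)
Definition flat p (t : R) : R := if 0 < t then p.[t^-1] * expR (- t^-1) else 0.

Lemma horner_expRN_bounded p : exists2 C, 0 <= C & forall s, 0 <= s -> `|p.[s]| * expR (- s) <= C.
Proof.
exists (\sum_(i < size p) `|p`_i| * (i`!)%:R).
  by apply: sumr_ge0 => i _; rewrite mulr_ge0.
move=> s s0; rewrite expRN ler_pdivrMr ?expR_gt0// mulr_suml horner_coef.
rewrite (le_trans (ler_norm_sum _ _ _))// ler_sum// => i _.
rewrite normrM -mulrA ler_wpM2l// normrX ger0_norm//.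
rewrite mulrC -ler_pdivrMr ?ltr0n ?fact_gt0//.
case: (nat_of_ord i) => [|m]; first by rewrite expr0 divr1 -expR0 ler_expR.
by apply: le_trans (expR_ge1Dxn m s0); rewrite lerDr.
Qed.

(** The boundedness of ['X^2 * p] against the exponential, read at [1 / t]. Quadratic decay is what
    gives the derivative 0 at the origin. *)
Lemma flat_quadratic p : exists2 C, 0 <= C & forall t, `|flat p t| <= C * t ^+ 2.
Proof.
have [C C0 HC] := horner_expRN_bounded ('X^2 * p).
exists C => // t; rewrite /flat; case: ifPn => t0; last by rewrite normr0 mulr_ge0// sqr_ge0.
have := HC t^-1; rewrite invr_ge0 ltW// => /(_ isT).
rewrite hornerM hornerXn normrM (ger0_norm (_ : 0 <= t^-1 ^+ 2)) ?sqr_ge0// exprVn.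
rewrite -mulrA mulrC ler_pdivrMr ?exprn_gt0// normrM.
by rewrite (ger0_norm (expR_ge0 _)).
Qed.

Lemma is_derive0_quadratic f (C : R) : (forall t, `|f t| <= C * t ^+ 2) ->
  is_derive (0 : R) 1 f 0.
Proof.
move=> fC; have f0 : f 0 = 0.
  by apply/eqP; rewrite -normr_le0 (le_trans (fC 0))// expr0n/= mulr0.
have C0 : 0 <= C.
  by have := fC 1; rewrite expr1n mulr1; exact: le_trans.
have H : h^-1 *: ((f \o shift 0) (h *: (1 : R)) - f 0) @[h --> 0^'] --> 0.
  apply/cvgrPdist_le => /= e e0; near=> h.
  have hn0 : h != 0 by near: h; exact: nbhs_dnbhs_neq.
  rewrite sub0r normrN f0 subr0 addr0 [h *: 1]mulr1 normrM normfV.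
  rewrite ler_pdivrMl ?normr_gt0// (le_trans (fC h))//.
  rewrite -real_normK ?num_real// expr2 mulrCA ler_wpM2l//.
  rewrite (@le_trans _ _ ((C + 1) * `|h|))//.
    by rewrite ler_wpM2r// lerDl.
  rewrite -ler_pdivlMl ?ltr_wpDl//.
  near: h; apply: dnbhs0_le.
  by rewrite mulr_gt0// invr_gt0 ltr_wpDl.
apply: DeriveDef; first by apply/cvg_ex; exists 0.
exact/cvg_lim.
Unshelve. all: by end_near. Qed.

(** For [t > 0], differentiating [p (1 / t) * exp (- 1 / t)] brings out [t^-2] times
    [(p - p') (1 / t)], whence the new polynomial; at 0 the quadratic bound applies. *)
Lemma is_derive_flat p (t : R) : is_derive t 1 (flat p) (flat ('X^2 * (p - p^`())) t).
Proof.
have [t0|t0|->] := ltgtP t 0.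
- rewrite {2}/flat ltNge ltW//=.
  have E : \forall s \near t, cst 0 s = flat p s.
    near=> s; rewrite /flat ifF//; apply/negbTE; rewrite -leNgt ltW//.
    by near: s; exact: lt_nbhsl.
  apply: (@near_eq_is_derive _ _ _ (cst 0) (flat p)) => //.
  - rewrite {2}/flat t0.
  have E : \forall s \near t, p.[s^-1] * expR (- s^-1) = flat p s.
    near=> s; rewrite /flat ifT//.
    by near: s; exact: lt_nbhsr.
  apply: near_eq_is_derive E _.
  have tn0 : t != 0 by rewrite gt_eqF.
  apply: is_derive_eq.
    apply: is_deriveM.
      apply: (@is_derive1_comp _ (horner p) (fun s => s^-1)).
      exact: (@is_deriveV _ id).
    apply: (@is_derive1_comp _ expR (fun s => - s^-1)).
    apply: is_deriveN; exact: (@is_deriveV _ id).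
  by rewrite /= /GRing.scale/= hornerM hornerXn hornerD hornerN -exprVn; ring.
- rewrite {2}/flat ltxx.
  have [C C0 HC] := flat_quadratic p.
  exact: (is_derive0_quadratic HC).
Unshelve. all: by end_near. Qed.


(** Existence of [k] successive derivatives, without continuity of the last one; quantifying over
    all [k] in [smooth1] restores it. The recursive form suits inductions for sums and products. *)
Fixpoint Cn (k : nat) f : Prop :=
  if k is k'.+1 then exists2 f', (forall t : R, is_derive t 1 f (f' t)) & Cn k' f'
  else True.

Definition smooth1 f := forall k, Cn k f.

Lemma CnW k f : Cn k.+1 f -> Cn k f.
Proof. by elim: k f => // k IH f [f' df /IH]; exists f'. Qed.

Lemma CnD k f g : Cn k f -> Cn k g -> Cn k (fun t => f t + g t).
Proof.
elim: k f g => // k IH f g [f' df sf'] [g' dg sg'].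
exists (fun t => f' t + g' t); last exact: IH.
by move=> t; apply: is_deriveD.
Qed.

Lemma CnM k f g : Cn k f -> Cn k g -> Cn k (fun t => f t * g t).
Proof.
elim: k f g => // k IH f g sf sg.
have [f' df sf'] := sf; have [g' dg sg'] := sg.
exists (fun t => f t * g' t + g t * f' t); last first.
  by apply: CnD; apply: IH => //; exact: CnW.
by move=> t; apply: is_deriveM.
Qed.

Lemma Cn_flat k p : Cn k (flat p).
Proof.
elim: k p => // k IH p; exists (flat ('X^2 * (p - p^`()))) => //.
exact: is_derive_flat.
Qed.

Lemma CnC k (c : R) : Cn k (fun=> c).
Proof. by elim: k c => // k IH c; exists (fun=> 0) => [t|]; [exact: is_derive_cst|exact: IH]. Qed.

Lemma Cn_affine k f (a b : R) : Cn k f -> Cn k (fun t => f (a * t + b)).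
Proof.
elim: k f => // k IH f [f' df sf'].
exists (fun t => a * f' (a * t + b)).
  move=> t; rewrite mulrC; apply: (@is_derive1_comp _ f (fun t => a * t + b)) => //.
  apply: is_derive_eq; rewrite addr0/= /GRing.scale/=; ring.
apply: CnM; last exact: IH.
exact: CnC.
Qed.

Lemma smooth1M f g : smooth1 f -> smooth1 g -> smooth1 (fun t => f t * g t).
Proof. by move=> sf sg k; exact: CnM. Qed.

Lemma smooth1_deriv f : smooth1 f ->
  (forall t : R, is_derive t 1 f (f^`()%classic t)) /\ smooth1 f^`()%classic.
Proof.
move=> sf.
have df (t : R) : is_derive t 1 f (f^`()%classic t).
  have [f' df _] := sf 1%N; rewrite derive1E; by split => //; case: (df t).
split=> // k; have [f' df' sf'] := sf k.+1.
suff -> : f^`()%classic = f' by [].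
by apply/funext => t; rewrite derive1E; case: (df' t).
Qed.

Lemma smooth1_cont f : smooth1 f -> continuous f.
Proof.
move=> /smooth1_deriv[df _] t.
by apply/differentiable_continuous/derivable1_diffP; case: (df t).
Qed.

(** Two uses: for [k = 1] it is the profile of the mollifier, and as [k] grows it tends to the
    indicator of []a, b[]. *)
Definition bump (a b k t : R) := flat 1 (k * (t - a)) * flat 1 (k * (b - t)).

Lemma smooth1_bump a b k : smooth1 (bump a b k).
Proof.
apply: smooth1M => j.
  have -> : (fun t => flat 1 (k * (t - a))) = (fun t => flat 1 (k * t + - (k * a))).
    by apply/funext => t; rewrite mulrBr.
  by apply: Cn_affine; exact: Cn_flat.
have -> : (fun t => flat 1 (k * (b - t))) = (fun t => flat 1 (- k * t + (k * b))).
  by apply/funext => t; congr flat; ring.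
by apply: Cn_affine; exact: Cn_flat.
Qed.

Lemma flat1_ge0 t : 0 <= flat 1 t.
Proof. by rewrite /flat; case: ifP => // _; rewrite hornerC mul1r expR_ge0. Qed.

Lemma flat1_le1 t : flat 1 t <= 1.
Proof.
rewrite /flat; case: ifP => // t0; rewrite hornerC mul1r -expR0 ler_expR.
by rewrite oppr_le0 invr_ge0 ltW.
Qed.

Lemma flat1_gt0 t : (0 < flat 1 t) = (0 < t).
Proof. by rewrite /flat; case: ifP; rewrite ?ltxx// hornerC mul1r expR_gt0. Qed.

Lemma bump_neq0 a b (k : nat) t : bump a b k%:R t != 0 -> a < t < b.
Proof.
have H s : flat 1 (k%:R * s) != 0 -> 0 < s.
  have := flat1_ge0 (k%:R * s); rewrite le_eqVlt eq_sym => /orP[/eqP ->|]; first by rewrite eqxx.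
  rewrite flat1_gt0 => ks _; rewrite ltNge; apply/negP => s0.
  by move: ks; rewrite ltNge mulr_ge0_le0.
by rewrite mulf_eq0 negb_or => /andP[/H + /H]; rewrite !subr_gt0 => -> ->.
Qed.

Lemma flat1_cvg t : flat 1 (k%:R * t) @[k --> \oo] --> ((0 < t)%R%:R : R).
Proof.
have [t0|t0] := ltP 0 t; last first.
  apply: cvg_near_cst; apply: nearW => k; rewrite /flat ifF//.
  by apply/negbTE; rewrite -leNgt mulr_ge0_le0.
have -> : true%:R = expR 0 :> R by rewrite expR0.
apply: (@cvg_trans _ (expR (- (k%:R^-1 * t^-1)) @[k --> \oo])).
  apply: near_eq_cvg; near=> k; rewrite /flat ifT ?hornerC ?mul1r ?invfM//.
  by rewrite mulr_gt0// ltr0n; near: k; exact: nbhs_infty_gt.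
apply: cvg_comp; last exact: continuous_expR.
have -> : (0 : R) = - (0 * t^-1) by rewrite mul0r oppr0.
apply: cvgN; apply: cvgMl.
by apply/gtr0_cvgV0; [exact: nbhs_infty_gtr|exact: cvgr_idn].
Unshelve. all: by end_near. Qed.

Lemma bump_cvg a b t : bump a b k%:R t @[k --> \oo] --> ((a < t < b)%R%:R : R).
Proof.
have -> : (a < t < b)%R%:R = (0 < t - a)%R%:R * (0 < b - t)%R%:R :> R.
  by rewrite !subr_gt0 -natrM mulnb.
by apply: cvgM; exact: flat1_cvg.
Qed.

Lemma bump_ge0_le1 a b k t : 0 <= bump a b k t <= 1.
Proof. by rewrite mulr_ge0 ?mulr_ile1 ?flat1_ge0 ?flat1_le1. Qed.

End bump.

(** * Smooth functions of one variable with bounded support *)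

Section compactly_supported.
Context {R : realType}.
Implicit Types (h : R -> R) (M : R).

Definition ccs M h := smooth1 h /\ forall t, h t != 0 -> `|t| <= M.

Lemma ccs_deriv M h : ccs M h -> ccs M h^`()%classic.
Proof.
move=> [sh hM]; have [dh sh'] := smooth1_deriv sh; split=> // t.
apply: contraNle => tM.
have E : \forall s \near t, cst 0 s = h s.
  have : \forall s \near t, M < `|s|.
    have := @norm_continuous _ _ t; move/cvgr_gt; apply => //.
  apply: filterS => s sM; apply/esym/eqP/negPn/negP => /hM.
  by rewrite leNgt sM.
have : is_derive t 1 h 0 by apply: near_eq_is_derive E _.
by case=> _; rewrite derive1E => ->.
Qed.

Lemma ccs_bounded M h : ccs M h -> exists2 B, 0 <= B & forall t, `|h t| <= B.
Proof.
move=> [sh hM]; have ch := smooth1_cont sh.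
have N0 : - (`|M| + 1) <= `|M| + 1 by rewrite ge0_cp// addr_ge0.
have [c _ cmax] := @EVT_max _ (fun t => `|h t|) _ _ N0 (continuous_subspaceT (fun t => continuous_comp (ch t) (@norm_continuous _ _ (h t)))).
exists `|h c| => // t; have [tM|tM] := leP `|t| (`|M| + 1).
  by apply: cmax; rewrite in_itv/= -ler_norml.
suff -> : h t = 0 by rewrite normr0.
apply/eqP/negPn/negP => /hM tM'; move: tM; rewrite ltNge.
by rewrite (le_trans tM')// (le_trans (ler_norm M))// lerDl.
Qed.

Lemma derive_bounded_lipschitz h h' (L : R) : (forall t : R, is_derive t 1 h (h' t)) ->
  (forall t, `|h' t| <= L) -> forall t s, `|h t - h s| <= L * `|t - s|.
Proof.
move=> dh hL; suff H t s : s < t -> `|h t - h s| <= L * `|t - s|.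
  move=> t s; have [/H //|/H|->] := ltgtP s t; first by rewrite distrC (distrC t).
  by rewrite !subrr normr0 mulr0.
move=> st; have ch : {within `[s, t], continuous h}.
  apply: continuous_subspaceT => x.
  by apply/differentiable_continuous/derivable1_diffP; case: (dh x).
have [c _ ->] := @MVT _ h h' s t st (fun x _ => dh x) ch.
by rewrite normrM ler_wpM2r.
Qed.

Lemma ccs_lipschitz M h : ccs M h ->
  exists2 L, 0 <= L & forall t s, `|h t - h s| <= L * `|t - s|.
Proof.
move=> ch; have [L L0 HL] := ccs_bounded (ccs_deriv ch).
by exists L => //; apply: derive_bounded_lipschitz HL; case: ch => /smooth1_deriv[].
Qed.

End compactly_supported.

Lemma le_coord_norm {R : realType} m n (x : 'M[R]_(m, n)) i j : `|x i j| <= `|x|.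
Proof.
rewrite [leRHS]mx_normrE; apply/bigmax_geP; right.
by exists (i, j).
Qed.

Lemma lipschitz_continuous {R : realType} {V : normedModType R} (f : V -> R) (C : R) :
  0 <= C -> (forall x y, `|f x - f y| <= C * `|x - y|) -> continuous f.
Proof.
move=> C0 H x; have C10 : 0 < C + 1 by rewrite ltr_wpDl.
apply/cvgrPdist_le => /= e e0; near=> y.
rewrite (le_trans (H _ _))// (@le_trans _ _ ((C + 1) * `|x - y|))//.
  by rewrite ler_wpM2r// lerDl.
rewrite -ler_pdivlMl// mulrC.
near: y; apply/nbhs_ballP; exists (e / (C + 1)) => /=; first by rewrite divr_gt0//.
by move=> y; rewrite -ball_normE/=; exact: ltW.
Unshelve. all: by end_near. Qed.

(** * Tensor products of one-variable functions *)

Section tensor.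
Context {R : realType} {n : nat}.
Local Notation mu := (@lebesgue_rV R n).
Local Notation Rn := 'rV[R]_n.
Implicit Types (h : 'I_n -> R -> R).

Definition tens h (x : Rn) : R := \prod_(i < n) h i (x ord0 i).

Lemma tens_continuous h : (forall i, continuous (h i)) -> continuous (tens h).
Proof.
move=> ch; rewrite /tens; elim: (index_enum _) => [|i s IH].
  by under eq_fun do rewrite big_nil; exact: cst_continuous.
under eq_fun do rewrite big_cons.
move=> x; apply: (cvgM _ (IH x)).
exact: (continuous_comp (@coord_continuous R 1 n ord0 i x) (ch i _)).
Qed.

Definition tderiv j h : 'I_n -> R -> R := fun i => if i == j then (h i)^`()%classic else h i.

Lemma is_derive_tens h j (x : Rn) : (forall i, smooth1 (h i)) ->
  is_derive x 'e_j (tens h) (tens (tderiv j h) x).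
Proof.
move=> sh; apply/is_derive_line0; rewrite /tens.
have E : (fun s : R => \prod_(i < n) h i ((x + s *: 'e_j) ord0 i)) =
    (fun s : R => (\prod_(i < n | i != j) h i (x ord0 i)) * h j (s + x ord0 j)).
  apply/funext => s; rewrite (bigD1 j)//= mulrC; congr (_ * _).
    by apply: eq_bigr => i ij; rewrite !mxE eqxx (negbTE ij) mulr0 addr0.
  by rewrite !mxE !eqxx mulr1 addrC.
have E2 : \prod_(i < n) tderiv j h i (x ord0 i) =
    (\prod_(i < n | i != j) h i (x ord0 i)) * (h j)^`()%classic (x ord0 j).
  rewrite (bigD1 j)//= {1}/tderiv eqxx mulrC; congr (_ * _).
  by apply: eq_bigr => i ij; rewrite /tderiv (negbTE ij).
rewrite E E2.
apply: is_derive_eq.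
  apply: is_deriveM; apply: (@is_derive1_comp _ (h j) (fun s => s + x ord0 j)).
  by have [H _] := smooth1_deriv (sh j); exact: H.
by rewrite /= scaler0 addr0 add0r addr0 mulr1.
Qed.

(** This class is stable under partial derivatives, so that every derivative of a convolution is
    again a convolution with a kernel; smoothness of mollifications reduces to that. *)
Definition kernel (k : Rn -> R) :=
  exists M h, (forall i, ccs M (h i)) /\ k = tens h.

Lemma kernel_partial k i : kernel k -> kernel (partial i k) /\
  forall x, is_derive x 'e_i k (partial i k x).
Proof.
move=> [M [h [ch kE]]]; subst k.
have H x : is_derive x 'e_i (tens h) (tens (tderiv i h) x).
  by apply: is_derive_tens => j; case: (ch j).
have -> : partial i (tens h) = tens (tderiv i h).
  by apply/funext => x; rewrite /partial; case: (H x).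
split=> //; exists M, (tderiv i h); split=> // j.
by rewrite /tderiv; case: eqP => // _; exact: ccs_deriv.
Qed.

Lemma kernel_continuous k : kernel k -> continuous k.
Proof.
move=> [M [h [ch ->]]]; apply: tens_continuous => i.
by apply: smooth1_cont; case: (ch i).
Qed.

Lemma kernel_smooth k : kernel k -> smooth k.
Proof.
move=> kk s; have : kernel (partials s k).
  by elim: s => // i s IH; have [] := kernel_partial i IH.
move=> /[dup] /kernel_continuous ck kk'; split=> // x i.
by have [_ /(_ x)[]] := kernel_partial i kk'.
Qed.

Lemma kernel_bms k : kernel k -> bms k.
Proof.
move=> kk; split; first by apply: continuous_measurable_rV; exact: kernel_continuous.
have [M [h [ch ->]]] := kk.
have [B HB] : exists B, forall x, `|tens h x| <= B.
  have /choice[B HB] : forall i, exists B, forall t, `|h i t| <= B.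
    by move=> i; have [B _ HB] := ccs_bounded (ch i); exists B.
  exists (\prod_(i < n) B i) => x; rewrite normr_prod.
  by apply: ler_prod => i _; rewrite normr_ge0/=.
exists (Num.max B M).
  by move=> x; rewrite (le_trans (HB x))// le_max lexx.
move=> x /prodf_neq0 H i.
by rewrite le_max; have [_ ->] := ch i; rewrite ?orbT//; exact: H.
Qed.

Lemma kernel_lipschitz k : kernel k -> exists2 L, 0 <= L &
  forall x y, `|k x - k y| <= L * `|x - y|.
Proof.
move=> [M [h [ch ->]]]; rewrite /tens.
(* The induction over the factors carries a bound on the product as well, since the Lipschitz
   constant of a product involves the size of both factors. *)
suff : exists B L, [/\ 0 <= B, 0 <= L, (forall x : Rn, `|\prod_(i < n) h i (x ord0 i)| <= B) &
    forall x y : Rn, `|\prod_(i < n) h i (x ord0 i) - \prod_(i < n) h i (y ord0 i)| <= L * `|x - y|].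
  by case=> B [L [_ L0 _ H]]; exists L.
elim: (index_enum _) => [|i s [B [L [B0 L0 HB HL]]]].
  exists 1, 0; split => // [x|x y]; first by rewrite big_nil normr1.
  by rewrite !big_nil subrr normr0 mul0r.
have [B' B'0 HB'] := ccs_bounded (ch i).
have [L' L'0 HL'] := ccs_lipschitz (ch i).
exists (B' * B), (L' * B + B' * L); split; rewrite ?addr_ge0 ?mulr_ge0//.
  by move=> x; rewrite big_cons normrM ler_pM.
move=> x y; rewrite !big_cons.
set a := h i _; set b := h i _; set c := \prod_(_ <- _) _; set d := \prod_(_ <- _) _.
have -> : a * c - b * d = (a - b) * c + b * (c - d) by ring.
have ab : `|a - b| <= L' * `|x - y|.
  rewrite (le_trans (HL' _ _))// ler_wpM2l//.
  by have := le_coord_norm (x - y) ord0 i; rewrite !mxE.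
rewrite (le_trans (ler_normD _ _))// !normrM mulrDl lerD//.
  by rewrite mulrAC ler_pM//; exact: HB.
by rewrite -mulrA ler_pM//; [exact: HB'|exact: HL].
Qed.

End tensor.

(** * Convolution with a kernel *)

Section convolution.
Context {R : realType} {n : nat}.
Local Notation mu := (@lebesgue_rV R n).
Local Notation Rn := 'rV[R]_n.
Implicit Types (k z f : Rn -> R).

Lemma bmsM f z : measurable_fun [set: Rn] f -> (exists B, forall x, `|f x| <= B) ->
  bms z -> bms (fun x => f x * z x).
Proof.
move=> mf [B fB] [mz [M zM sz]]; split; first exact: measurable_funM.
exists (Num.max (B * M) M) => [x|x].
  by rewrite le_max normrM ler_pM.
by rewrite mulf_eq0 negb_or => /andP[_ /sz] xM i; rewrite le_max xM orbT.
Qed.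

Lemma kernel_bounded k : kernel k -> exists B, forall x, `|k x| <= B.
Proof. by move=> /kernel_bms[_ [M ? _]]; exists M. Qed.

Lemma kernel_sub_measurable k x : kernel k -> measurable_fun [set: Rn] (fun y => k (x - y)).
Proof.
move=> kk; apply: continuous_measurable_rV => y.
apply: (@continuous_comp _ _ _ (fun y : Rn => (x - y : Rn)) k); last exact: kernel_continuous.
exact: (cvgB (cvg_cst x) (@cvg_id _ (nbhs y))).
Qed.

Lemma bms_kernel_sub k z x : kernel k -> bms z -> bms (fun y => k (x - y) * z y).
Proof.
move=> kk; apply: bmsM; first exact: kernel_sub_measurable.
by have [B HB] := kernel_bounded kk; exists B.
Qed.

Definition conv k z (x : Rn) := \int[mu]_y (k (x - y) * z y).

(** Differentiation under the integral sign along the line through [x] of direction ['e_i]. The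
    domination by [B * |z|], with [B] a bound of the differentiated kernel, is uniform in the
    parameter, so the interval []-1, 1[] is an arbitrary choice. *)
Lemma is_derive_conv k z i (x : Rn) : kernel k -> bms z ->
  is_derive x 'e_i (conv k z) (conv (partial i k) z x).
Proof.
move=> kk bz; apply/is_derive_line0.
have [kk' dk] := kernel_partial i kk.
have [B HB] := kernel_bounded kk'.
have B0 : 0 <= B by exact: le_trans (HB 0).
pose f (t : R) (y : Rn) := k (x + t *: 'e_i - y) * z y.
have df (t : R) y : is_derive t 1 (f ^~ y) (partial i k (x + t *: 'e_i - y) * z y).
  have H := (is_derive_line k (x - y) 'e_i t _).1 (dk _).
  have -> : f ^~ y = (fun s => z y *: k (x - y + s *: 'e_i)).
    by apply/funext => s; rewrite /f mulrC addrAC.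
  by rewrite mulrC addrAC; apply: is_deriveZ.
have i01 : `](-1), 1[%classic (0 : R) by rewrite /= in_itv/= ltrN10 ltr01.
have bzn : bms (fun y => B * `|z y|).
  apply: (@bmsM (cst B)) => //; first by exists B => ?; rewrite ger0_norm.
  have [mz [M zM sz]] := bz; split; first exact: measurableT_comp.
  by exists M => [y|y]; rewrite ?normr_id ?normr_eq0//; exact: sz.
have int_f t : mu.-integrable setT (EFin \o f t).
  by apply: bms_integrable; exact: bms_kernel_sub.
have derf (t : R) y : derivable (f ^~ y) t 1 by case: (df t y).
have dE (t : R) y : partial1of2 f t y = partial i k (x + t *: 'e_i - y) * z y.
  by rewrite partial1of2E; case: (df t y).
have bf (t : R) y : `|partial1of2 f t y| <= B * `|z y|.
  by rewrite dE normrM ler_wpM2r.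
have G0 y : 0 <= B * `|z y| by rewrite mulr_ge0.
have D1 := @derivable_under_integral _ _ _ mu f setT measurableT 0 (-1) 1 i01
  (fun t _ => int_f t) (fun t y _ _ => derf t y) _ G0 (bms_integrable bzn) (fun t y _ _ => bf t y).
have D2 := @differentiation_under_integral _ _ _ mu f setT measurableT 0 (-1) 1 i01
  (fun t _ => int_f t) (fun t y _ _ => derf t y) _ G0 (bms_integrable bzn) (fun t y _ _ => bf t y).
apply: DeriveDef; first exact: D1.
rewrite -derive1E [LHS]D2 /conv; apply: eq_Rintegral => y _.
by rewrite dE scale0r addr0.
Qed.

Lemma partial_conv k z i : kernel k -> bms z ->
  partial i (conv k z) = conv (partial i k) z.
Proof.
move=> kk bz; apply/funext => x; rewrite /partial.
by case: (is_derive_conv i x kk bz).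
Qed.

Lemma conv_continuous k z : kernel k -> bms z -> continuous (conv k z).
Proof.
move=> kk bz; have [L L0 HL] := kernel_lipschitz kk.
have iz : mu.-integrable setT (EFin \o (fun y => `|z y|)).
  by apply: (integrable_norm (f := z)); exact: bms_integrable.
pose C := L * \int[mu]_y `|z y|.
have C0 : 0 <= C by rewrite mulr_ge0// Rintegral_ge0.
have H x x' : `|conv k z x - conv k z x'| <= C * `|x - x'|.
  have i1 := bms_integrable (bms_kernel_sub x kk bz).
  have i2 := bms_integrable (bms_kernel_sub x' kk bz).
  rewrite /conv -RintegralB//.
  have i12 : mu.-integrable setT (EFin \o (fun y => k (x - y) * z y - k (x' - y) * z y)).
    rewrite /comp; under eq_fun do rewrite EFinB; exact: integrableB.
  rewrite (le_trans (le_normr_Rintegral _ i12))//.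
  rewrite /C mulrAC -RintegralZl//; apply: le_Rintegral => //.
  - by have := integrable_norm i12; exact.
  - rewrite /comp; under eq_fun do rewrite EFinM.
    exact: integrableZl.
  move=> y _; rewrite -mulrBl normrM ler_wpM2r// (le_trans (HL _ _))//.
  by rewrite opprB addrA subrK.
exact: (lipschitz_continuous C0 H).
Qed.

Lemma conv_smooth k z : kernel k -> bms z -> smooth (conv k z).
Proof.
move=> kk bz s.
have [k' kk' ->] : exists2 k', kernel k' & partials s (conv k z) = conv k' z.
  elim: s => [|i s [k' kk' IH]]; first by exists k.
  exists (partial i k'); first by case: (kernel_partial i kk').
  by rewrite /= IH partial_conv.
split; first exact: conv_continuous.
by move=> x i; have [] := is_derive_conv i x kk' bz.
Qed.

Lemma conv_neq0 k z x : conv k z x != 0 -> exists y, k (x - y) != 0 /\ z y != 0.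
Proof.
apply: contraNP => /forallNP H; rewrite /conv /Rintegral integral0_eq// => y _.
have [->|zy] := eqVneq (z y) 0; first by rewrite mulr0.
have [->|ky] := eqVneq (k (x - y)) 0; first by rewrite mul0r.
by case: (H y).
Qed.

End convolution.

(** * Integration by parts on a positivity set *)

Section integration_by_parts.
Context {R : realType} {n : nat}.
Local Notation mu := (@lebesgue_rV R n).
Local Notation Rn := 'rV[R]_n.
Implicit Types (f p : Rn -> R).

Lemma cube_compact (M : R) : compact (@cube R n M).
Proof.
have := @rV_compact R n (fun=> `[- M, M]%classic) (fun=> @segment_compact _ _ _).
congr compact; apply/seteqP; split=> x /= H i; have := H i.
  by rewrite in_itv/= -ler_norml.
by rewrite in_itv/= -ler_norml.
Qed.

Lemma continuous_cube_bounded f (M : R) : continuous f ->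
  exists2 B, 0 <= B & forall x, cube M x -> `|f x| <= B.
Proof.
move=> cf; have c0 : @cube R n `|M| !=set0 by exists 0 => i; rewrite mxE normr0.
have cnf : continuous (fun x => `|f x|).
  by move=> x; apply: (continuous_comp (cf x) (@norm_continuous _ _ _)).
have [c _ cmax] := EVT_max_rV c0 (@cube_compact `|M|) (continuous_subspaceT cnf).
exists `|f c| => // x xM; apply: cmax; rewrite inE => i.
by rewrite (le_trans (xM i))// ler_norm.
Qed.

Lemma flatX_cvg (t : R) : flat 'X (k%:R * t) @[k --> \oo] --> (0 : R).
Proof.
have [t0|t0] := ltP 0 t; last first.
  apply: cvg_near_cst; apply: nearW => k; rewrite /flat ifF//.
  by apply/negbTE; rewrite -leNgt mulr_ge0_le0.
apply: (@squeeze_cvgr _ _ _ _ (cst 0) (fun k => k%:R^-1 * t^-1)).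
- near=> k.
  have kt : 0 < k%:R * t by rewrite mulr_gt0// ltr0n; near: k; exact: nbhs_infty_gt.
  rewrite /flat kt hornerX mulr_ge0 ?expR_ge0 ?invr_ge0 ?(ltW kt)//= -invfM ler_piMr//.
    by rewrite invr_ge0 ltW.
  by rewrite -[leRHS]expR0 ler_expR oppr_le0 invr_ge0 ltW.
- exact: cvg_cst.
- have -> : (0 : R) = 0 * t^-1 by rewrite mul0r.
  apply: cvgMl.
  by apply/gtr0_cvgV0; [exact: nbhs_infty_gtr|exact: cvgr_idn].
Unshelve. all: by end_near. Qed.

Lemma flat_continuous (p : {poly R}) : continuous (flat p).
Proof.
by move=> t; apply/differentiable_continuous/derivable1_diffP; case: (is_derive_flat p t).
Qed.

(* [t * flat 1 (k t)] is a smooth approximation of the positive part. *)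
Lemma is_derive_pos_approx (k : nat) (t : R) :
  is_derive t 1 (fun s => s * flat 1 (k%:R * s)) (flat 1 (k%:R * t) + flat 'X (k%:R * t)).
Proof.
have H : is_derive t 1 (fun s => flat 1 (k%:R * s)) (flat ('X^2 * (1 - 1^`())) (k%:R * t) * k%:R).
  apply: (@is_derive1_comp _ (flat 1) (fun s => k%:R * s)).
    exact: is_derive_flat.
  by apply: is_derive_eq; rewrite /GRing.scale/= mulr1.
apply: is_derive_eq; rewrite /GRing.scale/= mulr1 addrC; congr (_ + _).
rewrite derivC subr0 mulr1 /flat; case: ifPn => kt; last by rewrite mul0r mulr0.
rewrite hornerXn hornerX; set e := expR _.
rewrite [LHS](_ : _ = (k%:R * t)^-1 * ((k%:R * t)^-1 * (k%:R * t)) * e); last by ring.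
by rewrite mulVf ?mulr1// gt_eqF.
Qed.

Lemma bounded_cvg_integral (F : nat -> Rn -> R) (G : Rn -> R) (D M : R) :
  (forall k, measurable_fun [set: Rn] (F k)) ->
  (forall k x, `|F k x| <= D) -> (forall k x, F k x != 0 -> cube M x) ->
  (forall x, F k x @[k --> \oo] --> G x) ->
  bms G /\ \int[mu]_x F k x @[k --> \oo] --> \int[mu]_x G x.
Proof.
move=> mF FD FM FG.
have mG : measurable_fun [set: Rn] G.
  apply/measurable_EFinP.
  apply: (@emeasurable_fun_cvg _ _ _ setT (fun k => EFin \o F k)) => //.
    by move=> k; apply/measurable_EFinP.
  by move=> x _; apply: cvg_EFin; [exact: nearW|exact: FG].
have Gout x : G x != 0 -> cube M x.
  apply: contra_neqP => xM; apply: (cvg_unique _ (FG x)) => //.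
  apply: cvg_near_cst; apply: nearW => k; apply/eqP/negPn/negP => /FM; exact: xM.
have GD x : `|G x| <= D.
  have H : `|F k x| @[k --> \oo] --> `|G x| by apply: cvg_norm; exact: FG.
  rewrite -(cvg_lim _ H)//; apply: limr_le.
    by apply/cvg_ex; exists `|G x|.
  exact: nearW.
have D0 : 0 <= D by exact: le_trans (FD 0%N 0).
have bG : bms G.
  split=> //; exists (Num.max D M) => [x|x /Gout xM i]; first by rewrite le_max GD.
  by rewrite le_max xM orbT.
have bD : bms (fun x : Rn => D * \1_(cube M) x).
  split; first by apply: measurable_funM => //; apply: measurable_indic; exact: measurable_cube.
  exists (Num.max D M) => [x|x].
    by rewrite le_max indicE; case: (_ \in _); rewrite ?mulr1 ?mulr0 ger0_norm// ?lexx// D0.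
  rewrite indicE; case: (boolP (_ \in _)); rewrite ?inE ?mulr0 ?eqxx// => xM _ i.
  by rewrite le_max xM orbT.
have [] := @dominated_convergence _ _ _ mu setT measurableT (fun k x => (F k x)%:E)
  (fun x => (G x)%:E) (fun x => (D * \1_(cube M) x)%:E).
- by move=> k; apply/measurable_EFinP.
- exact/measurable_EFinP.
- by apply: aeW => x _; apply: cvg_EFin; [exact: nearW|exact: FG].
- exact: bms_integrable.
- apply: aeW => x k _; rewrite lee_fin indicE; case: (boolP (_ \in _)) => [_|].
    by rewrite mulr1.
  rewrite notin_setE mulr0 => xM.
  rewrite normr_le0; apply/negPn/negP => /FM; exact: xM.
move=> _ _ H; split => //; apply: fine_cvg.
by rewrite fineK//; apply: integrable_fin_num => //; exact: bms_integrable.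
Qed.

(** The positive part of [f] is replaced by [f * flat 1 (k * f)], for which the product with [p] has
    a continuous derivative of zero integral; then [k] tends to infinity by dominated convergence.
    The support condition concerns only points where [f] is positive, which lets [p] be a function
    without compact support. *)
Lemma integration_by_parts_pos i f f' p p' (M : R) :
  (forall x, is_derive x 'e_i f (f' x)) -> (forall x, is_derive x 'e_i p (p' x)) ->
  continuous f -> continuous f' -> continuous p -> continuous p' ->
  (forall x, 0 < f x -> (p x != 0) || (p' x != 0) -> cube M x) ->
  \int[mu]_x ((if 0 < f x then f' x else 0) * p x) =
  - \int[mu]_x (Num.max (f x) 0 * p' x).
Proof.
move=> df dp cf cf' cp cp' sfp.
have [Bf Bf0 HBf] := continuous_cube_bounded M cf.
have [Bf' Bf'0 HBf'] := continuous_cube_bounded M cf'.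
have [Bp Bp0 HBp] := continuous_cube_bounded M cp.
have [Bp' Bp'0 HBp'] := continuous_cube_bounded M cp'.
have [C C0 HC] := @horner_expRN_bounded R 'X.
have flatX t : 0 <= flat 'X t <= C.
  rewrite /flat; case: ifPn => t0; last by rewrite lexx C0.
  have tV : 0 <= t^-1 by rewrite invr_ge0 ltW.
  have := HC _ tV; rewrite hornerX ger0_norm// => ->.
  by rewrite mulr_ge0// expR_ge0.
(* The derivative of [t * flat 1 (k * t)]: it lies between 0 and [1 + C] for all [k] and tends to
   the indicator of [0 < t]. *)
pose b (k : nat) t := flat 1 (k%:R * t) + flat 'X (k%:R * t) : R.
pose F (k : nat) x := f x * flat 1 (k%:R * f x) * p x.
pose F' (k : nat) x := b k (f x) * f' x * p x + f x * flat 1 (k%:R * f x) * p' x.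
have dF k x : is_derive x 'e_i (F k) (F' k x).
  have H := is_derive_scalar_comp (df x) (is_derive_pos_approx k (f x)).
  have H2 := is_deriveM H (dp x).
  apply: is_derive_eq H2 _.
  by rewrite /= /F' /b /GRing.scale/=; ring.
have fl0 k t : t <= 0 -> flat 1 (k%:R * t) = 0 :> R /\ b k t = 0.
  move=> t0; have kt : (0 < k%:R * t) = false by apply/negbTE; rewrite -leNgt mulr_ge0_le0.
  by rewrite /b /flat kt addr0.
have cfl q k : continuous (fun x => flat q (k%:R * f x)).
  move=> x; apply: (@continuous_comp _ _ _ (fun y : Rn => k%:R * f y) (flat q)); last exact: flat_continuous.
  exact: (cvgM (cvg_cst _) (cf x)).
have cF' k : continuous (F' k).
  move=> x; exact: (cvgD (cvgM (cvgM (cvgD (cfl 1 k x) (cfl 'X k x)) (cf' x)) (cp x))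
    (cvgM (cvgM (cf x) (cfl 1 k x)) (cp' x))).
have out x : ~ cube M x -> f x <= 0 \/ (p x = 0 /\ p' x = 0).
  move=> xM; have [?|f0] := leP (f x) 0; first by left.
  right; apply: contra_notP xM => /not_andP pp; apply: sfp => //.
  by apply/orP; case: pp => /eqP; [left|right].
pose D := (1 + C) * Bf' * Bp + Bf * Bp'.
have D0 : 0 <= D by rewrite addr_ge0// ?mulr_ge0// addr_ge0.
have F'out k x : ~ cube M x -> F' k x = 0.
  move=> /out[f0|[p0 p'0]]; rewrite /F'.
    by have [-> ->] := fl0 k _ f0; rewrite !mul0r mulr0 !mul0r addr0.
  by rewrite p0 p'0 !mulr0 addr0.
have F'D k x : `|F' k x| <= D.
  have [xM|/F'out ->] := pselect (cube M x); last by rewrite normr0.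
  rewrite /F' (le_trans (ler_normD _ _))// !normrM lerD//.
    rewrite ler_pM// ?mulr_ge0// ?HBp// ler_pM// ?HBf'//.
    have /andP[x0 xC] := flatX (k%:R * f x).
    by rewrite /b ger0_norm ?addr_ge0 ?flat1_ge0// lerD// flat1_le1.
  rewrite ler_pM// ?mulr_ge0// ?HBp'//.
  by rewrite -[leRHS]mulr1 ler_pM// ?HBf// ger0_norm ?flat1_ge0 ?flat1_le1.
have bF' k : bms (F' k).
  split; first exact: continuous_measurable_rV.
  exists (Num.max D M) => [x|x]; first by rewrite le_max F'D.
  move=> F'x i0; have [xM|/(F'out k) F0] := pselect (cube M x).
    by rewrite le_max (xM i0) orbT.
  by rewrite F0 eqxx in F'x.
have intF' k : (\int[mu]_x (F' k x)%:E = 0)%E.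
  apply: (@integral_partial _ _ i (F k) _ M) => //.
    move=> x; rewrite /F mulf_eq0 negb_or => /andP[f0 p0].
    apply: sfp; last by rewrite p0.
    rewrite ltNge; apply/negP => fx.
    by rewrite (fl0 k _ fx).1 mulr0 eqxx in f0.
  move=> x t; apply: (@continuous_comp _ _ _ (fun t : R => x + t *: 'e_i) (F' k)); last exact: cF'.
  by apply: cvgD; [exact: cvg_cst|apply: cvgZl; exact: cvg_id].
pose G1 x := (if 0 < f x then f' x else 0) * p x.
pose G2 x := Num.max (f x) 0 * p' x.
have cvgF' x : F' k x @[k --> \oo] --> G1 x + G2 x.
  rewrite /G1 /G2 /F'; have [f0|f0] := ltP 0 (f x); last first.
    under eq_fun do rewrite (fl0 _ _ f0).1 (fl0 _ _ f0).2.
    rewrite !mul0r mulr0 !mul0r; exact: cvg_cst.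
  apply: cvgD; apply: cvgMl.
    rewrite -[X in _ --> X]mul1r; apply: cvgMl.
    rewrite -[X in _ --> X]addr0; apply: cvgD; last exact: flatX_cvg.
    by have := @flat1_cvg _ (f x); rewrite f0.
  rewrite -[X in _ --> X]mulr1; apply: cvgMr.
  by have := @flat1_cvg _ (f x); rewrite f0.
have F'M k x : F' k x != 0 -> cube M x.
  by apply: contra_neqP; exact: F'out.
have [_ Hlim] := bounded_cvg_integral (fun k => (bF' k).1) F'D F'M cvgF'.
have int0 : \int[mu]_x (G1 x + G2 x) = 0.
  apply: (cvg_unique _ Hlim) => //.
  by apply: cvg_near_cst; apply: nearW => k; rewrite /Rintegral intF'.
have mfpos : measurable [set x | 0 < f x].
  rewrite [X in measurable X](_ : _ = f @^-1` `]0, +oo[%classic).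
    by rewrite -[X in measurable X]setTI; apply: continuous_measurable_rV.
  by apply/seteqP; split=> x /=; rewrite in_itv/= andbT.
have bG2 : bms G2.
  split.
    apply: measurable_funM; last exact: continuous_measurable_rV.
    by apply: measurable_maxr => //; exact: continuous_measurable_rV.
  have Bfp : 0 <= Bf * Bp' by exact: mulr_ge0.
  have H x : G2 x != 0 -> cube M x.
    rewrite /G2 mulf_eq0 negb_or => /andP[fx px].
    apply: sfp; last by rewrite px orbT.
    by move: fx; rewrite maxEle; case: ifPn; rewrite ?eqxx// -ltNge.
  exists (Num.max (Bf * Bp') M) => [x|x /H xM i0]; last by rewrite le_max xM orbT.
  rewrite le_max; apply/orP; left.
  have [->|/H xM] := eqVneq (G2 x) 0; first by rewrite normr0.
  rewrite /G2 normrM ler_pM ?HBp'// (le_trans _ (HBf _ xM))//.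
  by rewrite maxEle; case: ifP => // _; rewrite normr0.
have bG1 : bms G1.
  split.
    apply: measurable_funM; last exact: continuous_measurable_rV.
    apply: measurable_fun_ifT => //; last exact: continuous_measurable_rV.
    by apply: measurable_fun_ltr => //; exact: continuous_measurable_rV.
  have Bfp : 0 <= Bf' * Bp by exact: mulr_ge0.
  have H x : G1 x != 0 -> 0 < f x /\ cube M x.
    rewrite /G1 mulf_eq0 negb_or => /andP[]; case: ifPn; rewrite ?eqxx// => f0 _ px.
    by split=> //; apply: sfp => //; rewrite px.
  exists (Num.max (Bf' * Bp) M) => [x|x /H[_ xM] i0]; last by rewrite le_max xM orbT.
  rewrite le_max; apply/orP; left.
  have [->|/H[f0 xM]] := eqVneq (G1 x) 0; first by rewrite normr0.
  by rewrite /G1 f0 normrM ler_pM ?HBp ?HBf'.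
move: int0; rewrite RintegralD//; [|exact: bms_integrable..].
by move/eqP; rewrite addr_eq0 => /eqP.
Qed.

End integration_by_parts.

(** * The fundamental lemma of the calculus of variations *)

Section fundamental_lemma.
Context {R : realType} {n : nat}.
Local Notation mu := (@lebesgue_rV R n).
Local Notation Rn := 'rV[R]_n.

(** Infinite bounds leave a coordinate free, so that the whole space and half-spaces are included;
    these sets form a pi-system generating the sigma-algebra. *)
Definition ray (b : 'I_n -> \bar R) : set Rn :=
  [set x | forall i, ((x ord0 i)%:E < b i)%E].

Lemma measurable_ray b : measurable (ray b).
Proof.
have -> : ray b = \big[setI/setT]_(i <- index_enum 'I_n)
    ((fun x : Rn => (x ord0 i)%:E) @^-1` `]-oo, b i[%classic).
  rewrite -bigcap_seq; apply/seteqP; split=> [x Mx i _|x /= + i].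
    by rewrite /= in_itv/=; exact: Mx.
  by move=> /(_ i); rewrite /= in_itv/=; apply; rewrite mem_index_enum.
apply: bigsetI_measurable => i _; rewrite -[X in measurable X]setTI.
have H : measurable_fun [set: Rn] (fun x : Rn => (x ord0 i)%:E).
  by apply/measurable_EFinP; exact: measurable_rV_coor.
by apply: H => //; exact: emeasurable_itv.
Qed.

Lemma measurable_rVE : @measurable _ Rn = <<s range ray >>.
Proof.
apply/seteqP; split.
  apply: smallest_sub; first exact: smallest_sigma_algebra.
  move=> A; rewrite -bigcup_seq => -[i _] [B mB <-]; rewrite setTI.
  have : @measurable_fun _ _ (g_sigma_algebraType (range ray)) (measurableTypeR R) setT
     (fun x => x ord0 i).
    apply: (measurability _ (RGenInftyO.measurableE R)).
    move=> _ [_ [x ->] <-]; rewrite setTI; apply: sub_sigma_algebra.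
    exists (fun j => if j == i then x%:E else +oo%E) => //.
    apply/seteqP; split=> y /=.
      by move=> /(_ i); rewrite eqxx lte_fin in_itv/=.
    by rewrite in_itv/= => yx j; case: eqP => [->|_]; rewrite ?lte_fin ?ltry.
  by move=> /(_ measurableT _ mB); rewrite setTI.
apply: smallest_sub; first exact: sigma_algebra_measurable.
by move=> _ [b _ <-]; exact: measurable_ray.
Qed.

Lemma setI_closed_ray : setI_closed (range ray).
Proof.
move=> _ _ [b _ <-] [c _ <-]; exists (fun i => Order.min (b i) (c i)) => //.
apply/seteqP; split=> x /=.
  by move=> H; split=> i; have := H i; rewrite lt_min => /andP[].
by move=> [H1 H2] i; rewrite lt_min H1 H2.
Qed.

(** The sets over which [g] has zero integral form a Dynkin system; complements are handled because
    the whole space is the ray with all bounds [+oo]. *)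
Lemma ae_eq0_ray (g : Rn -> R) : mu.-integrable setT (EFin \o g) ->
  (forall b, (\int[mu]_(x in ray b) (g x)%:E = 0)%E) ->
  {ae mu, forall x, g x = 0}.
Proof.
move=> ig g0.
have g0T A : measurable A -> (\int[mu]_(x in A) (g x)%:E = 0)%E.
  move=> mA; rewrite measurable_rVE in mA; move: A mA.
  apply: (dynkin_induction measurable_rVE setI_closed_ray).
  - rewrite -(g0 (fun=> +oo%E)); congr (integral _ _ _).
    by apply/seteqP; split=> // x _ i; rewrite ltry.
  - by move=> _ [b _ <-].
  - move=> A mA A0; rewrite -[LHS]add0e -A0 -integral_setU_EFin ?setUv//.
    + rewrite A0 -(g0 (fun=> +oo%E)); congr (integral _ _ _).
      by apply/seteqP; split=> // x _ i; rewrite ltry.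
    + exact: measurableC.
    + by apply/measurable_funTS; case/integrableP : ig => /measurable_EFinP.
    + by apply/disj_setPCl.
  - move=> F mF tF F0; rewrite integral_bigcup//.
      by rewrite eseries0.
    by apply: integrableS ig => //; exact: bigcup_measurable.
have := @integral_ae_eq _ _ _ mu setT measurableT (cst 0%E) (EFin \o g) ig.
case=> //.
  by move=> E _ mE; rewrite g0T// integral0.
move=> N [mN N0 H]; exists N; split=> // x /= gx; apply: H => /= /(_ I) [] //.
Qed.


Definition obox (a c : 'I_n -> R) : set Rn := [set x | forall i, a i < x ord0 i < c i].
Definition cbox (a c : 'I_n -> R) : set Rn := [set x | forall i, a i <= x ord0 i <= c i].

Lemma cbox_compact a c : compact (cbox a c).
Proof.
have := @rV_compact R n (fun i => `[a i, c i]%classic) (fun=> @segment_compact _ _ _).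
congr compact; apply/seteqP; split=> x /= H i; have := H i; by rewrite in_itv/=.
Qed.

Lemma cbox_closed a c : closed (cbox a c).
Proof. by apply: compact_closed; [exact: norm_hausdorff|exact: cbox_compact]. Qed.

Lemma closed_measurable_rV (A : set Rn) : closed A -> measurable A.
Proof.
move=> /closed_openC/open_measurable_rV/measurableC; by rewrite setCK.
Qed.

Lemma obox_open a c : open (obox a c).
Proof.
have -> : obox a c = ~` (\bigcup_(i in [set: 'I_n])
    ([set x : Rn | x ord0 i <= a i] `|` [set x : Rn | c i <= x ord0 i])).
  apply/seteqP; split=> [x H [i _ /= [xa|xc]]|x H i].
  - by have := H i; rewrite ltNge xa.
  - by have := H i; rewrite (ltNge _ (c i)) xc andbF.
  - apply/negPn/negP; rewrite negb_and -!leNgt => /orP xac; apply: H.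
    by exists i.
apply: closed_openC; apply: closed_bigcup => //; first exact: finite_finset.
move=> i _; apply: closedU.
  rewrite [X in closed X](_ : _ = (fun x : Rn => x ord0 i) @^-1` [set t | t <= a i]) //.
  by apply: closed_comp; [move=> x _; exact: coord_continuous|exact: closed_le].
rewrite [X in closed X](_ : _ = (fun x : Rn => x ord0 i) @^-1` [set t | c i <= t]) //.
by apply: closed_comp; [move=> x _; exact: coord_continuous|exact: closed_ge].
Qed.

Lemma kernel_bump (a c : 'I_n -> R) (k : nat) :
  kernel (tens (fun i => bump (a i) (c i) k%:R)).
Proof.
exists (\sum_i (`|a i| + `|c i|)), (fun i => bump (a i) (c i) k%:R); split=> // i.
split; first exact: smooth1_bump.
move=> t /bump_neq0/andP[at_ tc].
have le_sum : `|a i| + `|c i| <= \sum_i (`|a i| + `|c i|).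
  by rewrite (bigD1 i)//= lerDl sumr_ge0// => j _; rewrite addr_ge0.
rewrite (le_trans _ le_sum)// ler_norml; apply/andP; split.
  by rewrite lerNl; have := ler_norm (- a i); rewrite normrN; have := normr_ge0 (c i); lra.
by have := ler_norm (c i); have := normr_ge0 (a i); lra.
Qed.

Lemma bump_tens_neq0 (a c : 'I_n -> R) (k : nat) (x : Rn) :
  tens (fun i => bump (a i) (c i) k%:R) x != 0 -> obox a c x.
Proof. by move=> /prodf_neq0 H i; exact: bump_neq0 (H i isT). Qed.

Lemma bump_tens_cvg (a c : 'I_n -> R) (x : Rn) :
  tens (fun i => bump (a i) (c i) k%:R) x @[k --> \oo] --> (\1_(obox a c) x : R).
Proof.
have -> : \1_(obox a c) x = \prod_(i < n) (a i < x ord0 i < c i)%R%:R :> R.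
  rewrite indicE; have [xac|xac] := pselect (obox a c x).
    by rewrite mem_set// big1// => i _; rewrite xac.
  rewrite memNset//; have [i xi] : exists i, ~ (a i < x ord0 i < c i).
    by apply/existsNP.
  by rewrite (bigD1 i)//= (negbTE (introN idP xi)) mul0r.
rewrite /tens; elim: (index_enum _) => [|i s IH].
  by under eq_fun do rewrite big_nil; rewrite big_nil; exact: cvg_cst.
under eq_fun do rewrite big_cons; rewrite big_cons.
by apply: cvgM IH; exact: bump_cvg.
Qed.

Lemma bump_tens_le1 (a c : 'I_n -> R) k (x : Rn) :
  `|tens (fun i => bump (a i) (c i) k) x| <= 1.
Proof.
rewrite /tens normr_prod; apply: prodr_ile1 => i.
by have /andP[b0 b1] := bump_ge0_le1 (a i) (c i) k (x ord0 i); rewrite normr_ge0/= ger0_norm.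
Qed.

Lemma kernel_test_function (k : Rn -> R) (C U : set Rn) : kernel k ->
  compact C -> C `<=` U -> (forall x, k x != 0 -> C x) -> test_function U k.
Proof.
move=> kk cC CU kC; have clC : closed C by apply: compact_closed => //; exact: norm_hausdorff.
have kC' : closure [set x | k x != 0] `<=` C.
  by rewrite closureE; apply: smallest_sub.
split; first exact: kernel_smooth.
split; last exact: subset_trans CU.
by apply: (subclosed_compact _ cC) => //; exact: closed_closure.
Qed.

(** Tensor products of bumps are test functions tending to the indicator of the open box, and [|g|]
    on the compact closed box dominates. *)
Lemma integral_obox_eq0 (U : set Rn) (g : Rn -> R) (a c : 'I_n -> R) :
  locally_integrable_on U g -> cbox a c `<=` U ->
  (forall phi, test_function U phi -> \int[mu]_(x in U) (g x * phi x) = 0) ->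
  (\int[mu]_(x in obox a c) (g x)%:E = 0)%E.
Proof.
move=> [mg ig] KU g0; set K := cbox a c in KU *.
have mK : measurable K by apply: closed_measurable_rV; exact: cbox_closed.
have iK := ig K (@cbox_compact a c) KU.
have BK : obox a c `<=` K by move=> x H i; have /andP[/ltW -> /ltW ->] := H i.
pose h (k : nat) := tens (fun i => bump (a i) (c i) k%:R) : Rn -> R.
have gh0 (k : nat) : (\int[mu]_(x in K) (g x * h k x)%:E = 0)%E.
  have tk : test_function U (h k).
    apply: (@kernel_test_function _ K) => //; [exact: kernel_bump|exact: cbox_compact|].
    by move=> x /bump_tens_neq0 /BK.
  have := g0 _ tk; rewrite /Rintegral.
  have -> : (\int[mu]_(x in U) (g x * h k x)%:E = \int[mu]_(x in K) (g x * h k x)%:E)%E.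
    rewrite integral_mkcond [RHS]integral_mkcond; congr (integral _ _ _).
    apply/funext => x; rewrite !patchE.
    have [hx|/bump_tens_neq0/BK xK] := eqVneq (h k x) 0.
      by rewrite hx mulr0; do 2 case: ifP.
    by rewrite !mem_set//; exact: KU.
  have fK : (\int[mu]_(x in K) (g x * h k x)%:E)%E \is a fin_num.
    apply: integrable_fin_num => //.
    apply: (le_integrable mK _ _ iK).
      apply/measurable_EFinP; apply: measurable_funM.
        by apply/measurable_EFinP; case/integrableP : iK.
      by apply/measurable_funTS; case: (kernel_bms (kernel_bump a c k)).
    move=> x _ /=; rewrite lee_fin normrM ler_piMr//.
    exact: bump_tens_le1.
  by move=> H0; rewrite -(fineK fK) H0.
have [] := @dominated_convergence _ _ _ mu K mK (fun k x => (g x * h k x)%:E)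
  (fun x => (g x * \1_(obox a c) x)%:E) (fun x => `|(g x)%:E|%E).
- move=> k; apply/measurable_EFinP; apply: measurable_funM.
    by apply/measurable_EFinP; case/integrableP : iK.
  by apply/measurable_funTS; case: (kernel_bms (kernel_bump a c k)).
- apply/measurable_EFinP; apply: measurable_funM.
    by apply/measurable_EFinP; case/integrableP : iK.
  by apply/measurable_funTS; apply: measurable_indic; apply: open_measurable_rV; exact: obox_open.
- apply: aeW => x _; apply: cvg_EFin; first exact: nearW.
  by apply: cvgMr; exact: bump_tens_cvg.
- exact: integrable_abse.
- apply: aeW => x k _; rewrite /= lee_fin normrM ler_piMr//.
  exact: bump_tens_le1.
move=> _ _ H.
have <- : (\int[mu]_(x in K) (g x * \1_(obox a c) x)%:E = 0)%E.
  apply: (cvg_unique _ H) => //.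
  by apply: cvg_near_cst; apply: nearW => k; exact: gh0.
rewrite integral_mkcond [RHS]integral_mkcond; congr (integral _ _ _).
apply/funext => x; rewrite !patchE indicE; have [xB|xB] := pselect (obox a c x).
  by rewrite !mem_set ?mulr1//; exact: BK.
by rewrite (memNset xB) mulr0; case: ifP.
Qed.

(** Countably many boxes cover [U]. On one of them [g] is integrable, and a box cut by a ray is
    again a box, so vanishing over boxes yields vanishing over rays. *)
Lemma ae_eq0_test (U : set Rn) (g : Rn -> R) : open U ->
  locally_integrable_on U g ->
  (forall phi, test_function U phi -> \int[mu]_(x in U) (g x * phi x) = 0) ->
  {ae mu, forall x, U x -> g x = 0}.
Proof.
move=> oU lg g0; have [d [r [cU Uc]]] := open_boxes oU.
pose a k i := d k ord0 i - r k; pose c k i := d k ord0 i + r k.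
have KU k : 0 < r k -> cbox (a k) (c k) `<=` U.
  move=> k0 x H; apply: (cU k) => // i.
  by have := H i; rewrite -ler_distl.
have aeB k : 0 < r k -> {ae mu, forall x, obox (a k) (c k) x -> g x = 0}.
  move=> k0; have mB : measurable (obox (a k) (c k)) by apply: open_measurable_rV; exact: obox_open.
  have BK : obox (a k) (c k) `<=` cbox (a k) (c k).
    by move=> x H i; have /andP[/ltW -> /ltW ->] := H i.
  have iB : mu.-integrable (obox (a k) (c k)) (EFin \o g).
    apply: (integrableS (closed_measurable_rV (@cbox_closed (a k) (c k)))) => //.
    by apply: lg.2; [exact: cbox_compact|exact: KU].
  have iBT : mu.-integrable setT (EFin \o (g \_ (obox (a k) (c k)))).
    by rewrite -restrict_EFin; apply/integrable_restrict; rewrite ?setTI.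
  have H b : (\int[mu]_(x in ray b) ((g \_ (obox (a k) (c k))) x)%:E = 0)%E.
    (* For the bound [-oo] the ray is empty, and the upper end [a k i] makes the box empty too. *)
    pose c' i := match b i with EFin s => Num.min s (c k i) | +oo%E => c k i | -oo%E => a k i end.
    have c'c x : obox (a k) c' x <-> ray b x /\ obox (a k) (c k) x.
      split=> [H|[H1 H2] i].
        have H' i : ((x ord0 i)%:E < b i)%E /\ a k i < x ord0 i < c k i.
          have := H i; rewrite /c'; case: (b i) => [s| |].
          - by rewrite lte_fin lt_min => /and3P[-> -> ->].
          - by rewrite ltry => ->.
          - by move=> /andP[/lt_trans h /h]; rewrite ltxx.
        by split=> i; case: (H' i).
      have := H1 i; have /andP[-> ] := H2 i; rewrite /c'; case: (b i) => [s| |] //=.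
      by rewrite lte_fin lt_min => -> ->.
    have c'K : cbox (a k) c' `<=` U.
      apply: subset_trans (KU k k0) => x H i; have /andP[-> /= h] := H i.
      apply: le_trans h _; rewrite /c'; case: (b i) => [s| |] //.
        by rewrite ge_min lexx orbT.
      by rewrite /a /c lerD2l ge0_cp// ltW.
    rewrite -(integral_obox_eq0 lg c'K g0).
    rewrite integral_mkcond [RHS]integral_mkcond; congr (integral _ _ _).
    apply/funext => x; rewrite !patchE.
    have [xB|xB] := pselect (obox (a k) c' x).
      by have [xr xb] := (c'c x).1 xB; rewrite !mem_set.
    rewrite (memNset xB); case: ifPn => //; rewrite inE => xr.
    case: ifPn => //; rewrite inE => xb; exfalso; apply: xB; exact/c'c.
  apply: filterS (ae_eq0_ray iBT H) => x + xB.
  by rewrite patchE mem_set.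
have : mu.-negligible (\bigcup_k (if 0 < r k then [set x | ~ (obox (a k) (c k) x -> g x = 0)] else set0)).
  apply: negligible_bigcup => k; case: ifPn => [/aeB//|_]; exact: negligible_set0.
apply: negligibleS => x /not_implyP[/Uc[k k0 xk] gx].
exists k => //; rewrite k0 => H; apply: gx; apply: H => i.
by rewrite -ltr_distl.
Qed.

End fundamental_lemma.

(** * Mollifiers *)

Section mollifier.
Context {R : realType}.

(** Translation invariance, from the uniqueness of the measure with prescribed values on half-open
    intervals. *)
Lemma integral_shift (f : R -> R) (c : R) : measurable_fun [set: R] f ->
  (forall t, 0 <= f t) ->
  (\int[lebesgue_measure]_t (f (t - c))%:E = \int[lebesgue_measure]_t (f t)%:E)%E.
Proof.
move=> mf f0.
have ms : measurable_fun [set: measurableTypeR R] (fun t : measurableTypeR R => t - c : measurableTypeR R).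
  by apply: measurable_funB.
rewrite -(@ge0_integral_pushforward _ _ _ (measurableTypeR R) R _ ms (@lebesgue_measure R) setT (EFin \o f))//.
- apply/esym; apply: eq_measure_integral => A mA _.
  apply: (@lebesgue_measure_unique R (pushforward lebesgue_measure (fun t : measurableTypeR R => t - c : measurableTypeR R))) => //.
  move=> X [[a b] /= _ <-].
  rewrite /pushforward [X in _ = lebesgue_measure X](_ : _ = `](a + c), (b + c)]%classic); last first.
    by apply/seteqP; split=> t /=; rewrite !in_itv/= ltrBrDr lerBlDr.
  by rewrite !lebesgue_measure_itv/= !lte_fin ltrD2r -!EFinB; case: ifP => // _; congr EFin; ring.
- exact/measurable_EFinP.
- by move=> t _; rewrite lee_fin.
Qed.

Context (r : R) (r0 : 0 < r).

Let b := bump (- r) r 1.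

Lemma bump_sym (t : R) : bump (- r) r 1 (- t) = bump (- r) r 1 t.
Proof. by rewrite /bump mulrC !mul1r !opprK addrC [- t + _]addrC. Qed.

Lemma ccs_bump : ccs r b.
Proof.
split; first exact: smooth1_bump.
by move=> t /(@bump_neq0 _ _ _ 1); rewrite -ltr_norml => /ltW.
Qed.

Lemma bump_integral : exists2 I : R, 0 < I &
  (\int[lebesgue_measure]_t (b t)%:E = I%:E)%E.
Proof.
have cb : continuous b by apply: smooth1_cont; exact: smooth1_bump.
have mb := continuous_measurable_fun cb.
have b0 t : 0 <= b t by case/andP: (bump_ge0_le1 (- r) r 1 t).
have eb : (\int[lebesgue_measure]_t (b t)%:E = \int[lebesgue_measure]_(t in `[(- r)%R, r]) (b t)%:E)%E.
  rewrite [RHS]integral_mkcond; apply: eq_integral => t _.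
  rewrite patchE; case: ifPn => //; rewrite notin_setE/= in_itv/= -ler_norml => tr.
  by congr EFin; apply/eqP/negPn/negP => bt; apply: tr; case: ccs_bump => _; apply.
have ib : lebesgue_measure.-integrable `[(- r), r] (EFin \o b).
  apply: continuous_compact_integrable; first exact: segment_compact.
  exact: continuous_subspaceT.
exists (fine (\int[lebesgue_measure]_t (b t)%:E)); last first.
  by rewrite fineK// eb; exact: integrable_fin_num.
rewrite fine_gt0// eb (integrable_lty _ ib)// andbT.
(* For [|t| <= r / 2] both [r + t] and [r - t] are at least [r / 2], so [m] is a lower bound of the
   bump there and its integral is positive. *)
pose m := flat 1 (r / 2) * flat 1 (r / 2).
have m0 : 0 < m by rewrite mulr_gt0// flat1_gt0 divr_gt0.
have fmono s : r / 2 <= s -> flat 1 (r / 2) <= flat 1 s.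
  move=> rs; have r2 : 0 < r / 2 by rewrite divr_gt0.
  have s0 : 0 < s by exact: lt_le_trans rs.
  by rewrite /flat r2 s0 !hornerC !mul1r ler_expR lerN2 lef_pV2.
apply: (@lt_le_trans _ _ (\int[lebesgue_measure]_(t in `[(- (r / 2))%R, (r / 2)%R]) m%:E)%E).
  rewrite integral_cst//= lebesgue_measure_itv/= lte_fin ifT ?opprK -?EFinB -?EFinM ?lte_fin ?opprK.
    by rewrite mulr_gt0// addr_gt0// divr_gt0.
  by rewrite gt0_cp// divr_gt0.
apply: (@le_trans _ _ (\int[lebesgue_measure]_(t in `[(- (r / 2))%R, (r / 2)%R]) (b t)%:E)%E).
  apply: ge0_le_integral => //.
  - by move=> t _; rewrite lee_fin ltW.
  - by apply/measurable_EFinP; exact: measurable_funTS.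
  move=> t /=; rewrite in_itv/= => /andP[t1 t2].
  rewrite lee_fin /b /bump !mul1r ler_pM ?flat1_ge0// fmono//; lra.
apply: ge0_subset_integral => //.
- by apply/measurable_EFinP; exact: measurable_funTS.
- by move=> t _; rewrite lee_fin.
move=> t /=; rewrite !in_itv/= => /andP[t1 t2].
by have := r0; lra.
Qed.

End mollifier.

Section mollifier_rV.
Context {R : realType}.
Local Notation mu n := (@lebesgue_rV R n).

Lemma measurable_tens n (h : 'I_n -> R -> R) : (forall i, measurable_fun [set: R] (h i)) ->
  measurable_fun [set: 'rV[R]_n] (tens h).
Proof.
move=> mh; rewrite /tens; elim: (index_enum _) => [|i s IH].
  by under eq_fun do rewrite big_nil; exact: measurable_cst.
under eq_fun do rewrite big_cons.
apply: measurable_funM => //.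
exact: (measurableT_comp (mh i) (measurable_rV_coor i)).
Qed.

Lemma tens_cons n (h : 'I_n.+1 -> R -> R) a y :
  tens h (cons_rV (a, y)) = h ord0 a * tens (fun i => h (lift ord0 i)) y.
Proof.
rewrite /tens big_ord_recl cons_rV0; congr (_ * _).
by apply: eq_bigr => i _; rewrite cons_rVS.
Qed.

Lemma tens_ge0 n (h : 'I_n -> R -> R) x : (forall i t, 0 <= h i t) -> 0 <= tens h x.
Proof. by move=> h0; apply: prodr_ge0. Qed.

Lemma integral_tens n (h : 'I_n -> R -> R) : (forall i, measurable_fun [set: R] (h i)) ->
  (forall i t, 0 <= h i t) -> (forall i, \int[lebesgue_measure]_t (h i t)%:E = 1)%E ->
  (\int[mu n]_x (tens h x)%:E = 1)%E.
Proof.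
elim: n h => [|n IH] h mh h0 h1.
  have H (x : 'rV[R]_0) : (tens h x)%:E = 1%E by rewrite /tens big_ord0.
  under eq_integral do rewrite H.
  rewrite integral_cst// mul1e /=; exact: diracT.
rewrite ge0_integral_rVS; last 2 first.
- by apply/measurable_EFinP; exact: measurable_tens.
- by move=> x; rewrite lee_fin tens_ge0.
rewrite -[RHS](h1 ord0); apply: eq_integral => a _.
under eq_integral do rewrite tens_cons EFinM.
rewrite ge0_integralZl//.
- by rewrite IH ?mule1.
- by apply/measurable_EFinP; exact: measurable_tens.
- by move=> x _; rewrite lee_fin tens_ge0.
- by rewrite lee_fin.
Qed.

(** The mass is stated for [rho (x - y)], the form in which [conv] uses it; being a tensor product,
    [rho] can be translated one coordinate at a time on the line. Evenness serves to pass [rho] from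
    one factor to the other. *)
Lemma mollifier_exists n (r : R) : 0 < r -> exists rho : 'rV[R]_n -> R,
  [/\ kernel rho, (forall x, 0 <= rho x), (forall x, rho (- x) = rho x),
    (forall x, rho x != 0 -> forall i, `|x ord0 i| < r) &
    forall x, (\int[mu n]_y (rho (x - y))%:E = 1)%E].
Proof.
move=> r0; have [I I0 IE] := bump_integral r0.
pose eta t := bump (- r) r 1 t * I^-1.
have eta0 t : 0 <= eta t.
  apply: mulr_ge0; last by rewrite invr_ge0 ltW.
  by case/andP: (bump_ge0_le1 (- r) r 1 t).
have [sb bM] := ccs_bump r.
have ceta : ccs r eta.
  split; first by apply: smooth1M => // k; exact: CnC.
  by move=> t; rewrite mulf_eq0 negb_or => /andP[/bM].
have eta_sym t : eta (- t) = eta t by rewrite /eta bump_sym.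
have meta : measurable_fun [set: R] eta.
  by apply: continuous_measurable_fun; apply: smooth1_cont; case: ceta.
have eta1 : (\int[lebesgue_measure]_t (eta t)%:E = 1)%E.
  under eq_integral do rewrite EFinM.
  rewrite ge0_integralZr//.
  - by rewrite IE -EFinM mulfV// gt_eqF.
  - apply/measurable_EFinP; apply: continuous_measurable_fun; exact: smooth1_cont.
  - by move=> t _; rewrite lee_fin; case/andP: (bump_ge0_le1 (- r) r 1 t).
  - by rewrite lee_fin invr_ge0 ltW.
exists (tens (fun=> eta)); split.
- by exists r, (fun=> eta).
- by move=> x; apply: tens_ge0.
- by move=> x; apply: eq_bigr => i _; rewrite mxE eta_sym.
- move=> x /prodf_neq0 H i; have := H i isT; rewrite mulf_eq0 negb_or => /andP[+ _].
  by move=> /(@bump_neq0 _ _ _ 1); rewrite ltr_norml.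
- move=> x; rewrite -(@integral_tens n (fun i t => eta (t - x ord0 i))).
  + apply: eq_integral => y _; congr EFin; apply: eq_bigr => i _.
    by rewrite -eta_sym !mxE opprB.
  + by move=> i; apply: measurableT_comp => //; exact: measurable_funB.
  + by [].
  + by move=> i; rewrite integral_shift.
Qed.

End mollifier_rV.

(** * Weak derivatives *)

Section weak_derivatives.
Context {R : realType} {n : nat}.
Local Notation mu := (@lebesgue_rV R n).
Local Notation Rn := 'rV[R]_n.
Implicit Types (U : set Rn) (phi xi u v g : Rn -> R).

Lemma smooth_is_derive phi i (x : Rn) : smooth phi -> is_derive x 'e_i phi (partial i phi x).
Proof. by move=> /(_ [::])[_ /(_ x i) H]; apply: DeriveDef. Qed.

Lemma smooth_continuous phi : smooth phi -> continuous phi.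
Proof. by move=> /(_ [::])[]. Qed.

Lemma smooth_partial phi i : smooth phi -> smooth (partial i phi).
Proof. by move=> sp s; have := sp (rcons s i); rewrite /partials foldr_rcons. Qed.

Lemma compact_cube (C : set Rn) : compact C -> exists M, C `<=` cube M.
Proof.
move=> /compact_bounded[M [_ HM]]; exists (M + 1) => x Cx i.
by rewrite (le_trans (le_coord_norm x ord0 i))// (HM _ _ x Cx)// ltrDl.
Qed.

Lemma continuous_bms phi (C : set Rn) : continuous phi -> compact C ->
  (forall x, phi x != 0 -> C x) -> bms phi.
Proof.
move=> cp cC pC; split; first exact: continuous_measurable_rV.
have [M CM] := compact_cube cC; have [B B0 HB] := continuous_cube_bounded M cp.
exists (Num.max B M) => [x|x /pC/CM xM i]; last by rewrite le_max xM orbT.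
have [->|/pC/CM xM] := eqVneq (phi x) 0; first by rewrite normr0 le_max B0.
by rewrite le_max HB.
Qed.

Lemma partial_supp phi i (x : Rn) : smooth phi ->
  partial i phi x != 0 -> closure [set y | phi y != 0] x.
Proof.
move=> sp; apply: contra_neqP => /= xn.
have E : \forall y \near x, cst 0 y = phi y.
  have /open_nbhs_nbhs : open_nbhs x (~` closure [set y | phi y != 0]).
    by split => //; apply: closed_openC; exact: closed_closure.
  apply: filterS => y yn; apply/esym/eqP/negPn/negP => py; apply: yn.
  exact: subset_closure.
have : is_derive x 'e_i phi 0 by apply: near_eq_is_derive E _.
by case.
Qed.

Lemma test_function_bms U phi : test_function U phi -> bms phi.
Proof.
move=> [sp [cp _]]; apply: continuous_bms cp _; first exact: smooth_continuous.
by move=> x px; exact: subset_closure.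
Qed.

Lemma test_function_partial_bms U phi i : test_function U phi -> bms (partial i phi).
Proof.
move=> [sp [cp _]]; apply: continuous_bms cp _.
  exact/smooth_continuous/smooth_partial.
by move=> x; exact: partial_supp.
Qed.

Lemma test_function_sub U phi x : test_function U phi -> phi x != 0 -> U x.
Proof. by move=> [_ [_ pU]] px; apply: pU; exact: subset_closure. Qed.

Lemma test_function_partial_sub U phi i x : test_function U phi -> partial i phi x != 0 -> U x.
Proof. by move=> [sp [_ pU]] px; apply: pU; exact: partial_supp px. Qed.

Lemma Rintegral_support U g : (forall x, g x != 0 -> U x) ->
  \int[mu]_(x in U) g x = \int[mu]_x g x.
Proof.
move=> gU; rewrite Rintegral_mkcond; congr (Rintegral _ _ _); apply/funext => x.
rewrite patchE; case: ifPn => // /negP xU; apply/esym/eqP/negPn/negP => /gU.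
by rewrite -inE.
Qed.

Lemma continuous_locally_integrable U g : continuous g -> locally_integrable_on U g.
Proof.
move=> cg; split; first by apply/measurable_funTS; exact: continuous_measurable_rV.
move=> K cK KU; have [M KM] := compact_cube cK.
have [B B0 HB] := continuous_cube_bounded M cg.
have mK : measurable K.
  by apply: closed_measurable_rV; apply: compact_closed => //; exact: norm_hausdorff.
apply: measurable_bounded_integrable => //.
- apply: le_lt_trans (cube_fin n M); apply: le_measure; rewrite ?inE//; exact: measurable_cube.
- by apply/measurable_funTS; exact: continuous_measurable_rV.
- exists B; split; first exact: num_real.
  by move=> N BN x /KM xM; apply: (le_trans (HB _ xM)); exact: ltW.
Qed.

Lemma smooth_cst (c : R) : smooth ((fun=> c) : Rn -> R).
Proof.
move=> s; have [c' ->] : exists c', partials s (fun=> c) = (fun=> c') :> (Rn -> R).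
  elim: s => [|i s [c' IH]]; first by exists c.
  by exists 0; rewrite /= IH; apply/funext => x; rewrite /partial derive_cst.
by split=> [|x i]; [exact: cst_continuous|exact: derivable_cst].
Qed.

(** Although [xi] may have unbounded support, [xi * phi] has not, so the integral of its partial
    derivative vanishes. *)
Lemma smooth_weak_partial U xi i : open U -> smooth xi -> is_weak_partial U i xi (partial i xi).
Proof.
move=> oU sxi; have cdxi := smooth_continuous (smooth_partial i sxi).
split; first exact: continuous_locally_integrable.
move=> phi tphi; have sphi := tphi.1.
have b1 := test_function_bms tphi; have b2 := test_function_partial_bms i tphi.
rewrite (@Rintegral_support U (fun x => partial i xi x * phi x)); last first.
  by move=> x; rewrite mulf_eq0 negb_or => /andP[_ px]; exact: (test_function_sub tphi).
rewrite (@Rintegral_support U (fun x => xi x * partial i phi x)); last first.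
  by move=> x; rewrite mulf_eq0 negb_or => /andP[_ px]; exact: (test_function_partial_sub tphi px).
have [M suppM] : exists M, forall x, phi x != 0 \/ partial i phi x != 0 -> cube M x.
  have [M HM] := compact_cube tphi.2.1; exists M => x [px|px]; apply: HM.
    exact: subset_closure.
  exact: partial_supp px.
have bM (z w : Rn -> R) : continuous z -> bms w -> (forall x, w x != 0 -> cube M x) -> continuous w ->
    bms (fun x => z x * w x).
  move=> cz [mw _] wM cw; apply: (@continuous_bms _ (cube M)).
  - by move=> x; exact: (cvgM (cz x) (cw x)).
  - exact: cube_compact.
  - by move=> x; rewrite mulf_eq0 negb_or => /andP[_ /wM].
have cxi := smooth_continuous sxi; have cphi := smooth_continuous sphi.
have cdphi := smooth_continuous (smooth_partial i sphi).
have B1 : bms (fun x => xi x * partial i phi x).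
  by apply: bM => // x px; apply: suppM; right.
have B2 : bms (fun x => partial i xi x * phi x).
  by apply: bM => // x px; apply: suppM; left.
pose F' x := xi x * partial i phi x + partial i xi x * phi x.
have : (\int[mu]_x (F' x)%:E = 0)%E.
  apply: (@integral_partial _ _ i (fun x => xi x * phi x) F' M).
  - apply: (@continuous_bms _ (cube M)); last 1 first.
    + move=> x F'x; apply: suppM; apply/orP; rewrite -negb_and; apply: contra_neqN F'x.
      by move=> /andP[/eqP p0 /eqP p1]; rewrite /F' p0 p1 !mulr0 addr0.
    + by move=> x; exact: (cvgD (cvgM (cxi x) (cdphi x)) (cvgM (cdxi x) (cphi x))).
    + exact: cube_compact.
  - by move=> x; rewrite mulf_eq0 negb_or => /andP[_ px]; apply: suppM; left.
  - move=> x; have H := is_deriveM (smooth_is_derive i x sxi) (smooth_is_derive i x sphi).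
    by apply: is_derive_eq H _; rewrite /F' /GRing.scale/= [phi x * _]mulrC.
  - move=> x t; apply: (@continuous_comp _ _ _ (fun t : R => x + t *: 'e_i) F').
      by apply: cvgD; [exact: cvg_cst|apply: cvgZl; exact: cvg_id].
    by exact: (cvgD (cvgM (cxi _) (cdphi _)) (cvgM (cdxi _) (cphi _))).
move=> /(congr1 fine); rewrite -/(Rintegral mu setT F') RintegralD//; [|exact: bms_integrable..].
by move=> /eqP; rewrite addr_eq0 => /eqP.
Qed.

Lemma integrable_mul_bms U g phi : open U -> locally_integrable_on U g ->
  bms phi -> (exists2 C, compact C /\ C `<=` U & forall x, phi x != 0 -> C x) ->
  mu.-integrable U (EFin \o (fun x => g x * phi x)).
Proof.
move=> oU [mg ig] [mphi [B HB _]] [C [cC CU] pC].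
have mC : measurable C.
  by apply: closed_measurable_rV; apply: compact_closed => //; exact: norm_hausdorff.
have mU := open_measurable_rV oU.
have iC : mu.-integrable C (EFin \o (fun x => g x * phi x)).
  have igC := ig C cC CU.
  have : mu.-integrable C (fun x => (B%:E * (g x)%:E)%E) by exact: integrableZl.
  apply: le_integrable => //.
    apply/measurable_EFinP; apply: measurable_funM; last exact: measurable_funTS.
    by apply/measurable_EFinP; case/integrableP : igC.
  move=> x _ /=; rewrite lee_fin !normrM mulrC ler_wpM2r//.
  by rewrite (le_trans (HB x))// ler_norm.
have E : (EFin \o (fun x => g x * phi x)) \_ C = (EFin \o (fun x => g x * phi x)) \_ U.
  apply/funext => x; rewrite !patchE /=.
  have [->|/pC xC] := eqVneq (phi x) 0; last by rewrite !mem_set//; exact: CU.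
  by rewrite mulr0; do 2 case: ifP.
apply/(integrable_mkcond _ mU); rewrite -E; exact/(integrable_mkcond _ mC).
Qed.

Lemma weak_partial_unique U i u g g' : open U ->
  is_weak_partial U i u g -> is_weak_partial U i u g' ->
  {ae mu, forall x, U x -> g x = g' x}.
Proof.
move=> oU [lg Hg] [lg' Hg'].
have lgg : locally_integrable_on U (fun x => g x - g' x).
  split; first exact: measurable_funB lg.1 lg'.1.
  move=> K cK KU; rewrite /comp; under eq_fun do rewrite EFinB.
  have mK : measurable K.
    by apply: closed_measurable_rV; apply: compact_closed => //; exact: norm_hausdorff.
  by apply: integrableB => //; [exact: lg.2|exact: lg'.2].
have H phi : test_function U phi -> \int[mu]_(x in U) ((g x - g' x) * phi x) = 0.
  move=> tp; have bp := test_function_bms tp.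
  have ex : exists2 C, compact C /\ C `<=` U & forall x, phi x != 0 -> C x.
    exists (closure [set x | phi x != 0]); first by case: tp => _.
    by move=> x px; exact: subset_closure.
  under eq_Rintegral do rewrite mulrBl.
  rewrite RintegralB; [|exact: open_measurable_rV|exact: integrable_mul_bms..].
  have := Hg phi tp; rewrite (Hg' phi tp) => /eqP; rewrite eqr_opp => /eqP ->.
  by rewrite subrr.
have := ae_eq0_test oU lgg H.
by apply: filterS => x Hx /Hx/eqP; rewrite subr_eq0 => /eqP.
Qed.

Lemma is_weak_partial_weak_partial U i u g : is_weak_partial U i u g ->
  is_weak_partial U i u (weak_partial U i u).
Proof. by move=> ug; exact: (@xgetPex _ (cst 0) [set g | is_weak_partial U i u g] (ex_intro _ g ug)). Qed.

Lemma is_weak_partialD U i u v g h : open U -> measurable_fun U u -> measurable_fun U v ->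
  locally_integrable_on U u -> locally_integrable_on U v ->
  is_weak_partial U i u g -> is_weak_partial U i v h ->
  is_weak_partial U i (u \+ v) (g \+ h).
Proof.
move=> oU mu_ mv lu lv [lg Hg] [lh Hh]; split.
  split; first exact: measurable_funD lg.1 lh.1.
  move=> K cK KU; rewrite /comp; under eq_fun do rewrite EFinD.
  have mK : measurable K.
    by apply: closed_measurable_rV; apply: compact_closed => //; exact: norm_hausdorff.
  by apply: integrableD => //; [exact: lg.2|exact: lh.2].
move=> phi tp; have bp := test_function_bms tp; have bdp := test_function_partial_bms i tp.
have mU := open_measurable_rV oU.
have ex : exists2 C, compact C /\ C `<=` U & forall x, phi x != 0 -> C x.
  exists (closure [set x | phi x != 0]); first by case: tp => _.
  by move=> x px; exact: subset_closure.
have ex' : exists2 C, compact C /\ C `<=` U & forall x, partial i phi x != 0 -> C x.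
  exists (closure [set x | phi x != 0]); first by case: tp => _.
  by move=> x; apply: partial_supp; case: tp.
under eq_Rintegral do rewrite mulrDl.
rewrite RintegralD//; [|exact: integrable_mul_bms..].
under [in RHS]eq_Rintegral do rewrite mulrDl.
rewrite RintegralD//; [|exact: integrable_mul_bms..].
by rewrite (Hg _ tp) (Hh _ tp) opprD.
Qed.


Lemma square_integrable_locally U g : open U -> square_integrable U g -> locally_integrable_on U g.
Proof.
move=> oU [mg ig]; split => // K cK KU.
have mK : measurable K.
  by apply: closed_measurable_rV; apply: compact_closed => //; exact: norm_hausdorff.
have mgK : measurable_fun K g by exact: (measurable_funS (open_measurable_rV oU) KU).
have [M KM] := compact_cube cK.
have Kfin : (mu K < +oo)%E.
  by apply: le_lt_trans (cube_fin n M); apply: le_measure; rewrite ?inE//; exact: measurable_cube.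
have i1 : mu.-integrable K (EFin \o (fun x => 1 + g x ^+ 2)).
  rewrite /comp; under eq_fun do rewrite EFinD.
  apply: integrableD => //.
    apply: measurable_bounded_integrable => //.
    by exists 1; split; [exact: num_real|move=> N N1 x _; rewrite normr1 ltW].
  apply/integrableP; split.
    by apply/measurable_EFinP; exact: measurable_funX.
  rewrite (eq_integral (fun x => (g x ^+ 2)%:E)); last first.
    by move=> x _; rewrite gee0_abs// lee_fin sqr_ge0.
  apply: le_lt_trans ig; apply: ge0_subset_integral => //.
  - exact: open_measurable_rV.
  - by apply/measurable_EFinP; exact: measurable_funX.
  - by move=> x _; rewrite lee_fin sqr_ge0.
apply: le_integrable i1 => //; first exact/measurable_EFinP.
move=> x _ /=; rewrite lee_fin [leRHS]ger0_norm ?addr_ge0 ?sqr_ge0//.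
rewrite -(real_normK (num_real (g x))).
have := sqr_ge0 (`|g x| - 1); have := normr_ge0 (g x); nra.
Qed.

Lemma square_integrable_integrable U g : open U -> (mu U < +oo)%E -> square_integrable U g ->
  mu.-integrable U (EFin \o (fun x => g x ^+ 2)) /\ mu.-integrable U (EFin \o g).
Proof.
move=> oU Ufin [mg ig]; have mU := open_measurable_rV oU.
have i2 : mu.-integrable U (EFin \o (fun x => g x ^+ 2)).
  apply/integrableP; split.
    by apply/measurable_EFinP; exact: measurable_funX.
  rewrite (eq_integral (fun x => (g x ^+ 2)%:E))// => x _.
  by rewrite gee0_abs// lee_fin sqr_ge0.
split=> //.
have i1 : mu.-integrable U (EFin \o (fun x => 1 + g x ^+ 2)).
  rewrite /comp; under eq_fun do rewrite EFinD.
  apply: integrableD => //.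
  apply: measurable_bounded_integrable => //.
  by exists 1; split; [exact: num_real|move=> N N1 x _; rewrite normr1 ltW].
apply: le_integrable i1 => //; first exact/measurable_EFinP.
move=> x _ /=; rewrite lee_fin [leRHS]ger0_norm ?addr_ge0 ?sqr_ge0//.
rewrite -(real_normK (num_real (g x))).
have := sqr_ge0 (`|g x| - 1); have := normr_ge0 (g x); nra.
Qed.

Lemma bms_square_integrable U g : open U -> bms g -> square_integrable U g.
Proof.
move=> oU bg; have mU := open_measurable_rV oU.
split; first by apply/measurable_funTS; case: bg.
have b2 : bms (fun x => g x ^+ 2).
  have [mg [B HB _]] := bg.
  have -> : (fun x => g x ^+ 2) = (fun x => g x * g x) by [].
  by apply: bmsM => //; exists B.
have /integrableP[_] : mu.-integrable U (EFin \o (fun x => g x ^+ 2)).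
  by apply: integrableS (bms_integrable b2).
rewrite (eq_integral (fun x => (g x ^+ 2)%:E))// => x _.
by rewrite /= ger0_norm// sqr_ge0.
Qed.

Lemma W12_weak_partial U u i : open U -> W12 U u ->
  is_weak_partial U i u (weak_partial U i u) /\ square_integrable U (weak_partial U i u).
Proof.
move=> oU [_ /(_ i)[g wg sg]]; have wp := is_weak_partial_weak_partial wg.
split=> //; split; first exact: wp.1.1.
apply: le_lt_trans sg.2; rewrite le_eqVlt; apply/orP; left; apply/eqP.
apply: ae_eq_integral; first exact: open_measurable_rV.
- by apply/measurable_EFinP; apply: measurable_funX; exact: wp.1.1.
- by apply/measurable_EFinP; apply: measurable_funX; exact: sg.1.
have := weak_partial_unique oU wp wg.
by apply: filterS => x H Ux; rewrite H.
Qed.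

Lemma test_function_W12_0 U xi : open U -> test_function U xi -> W12_0 U xi.
Proof.
move=> oU txi; have mU := open_measurable_rV oU; split.
  split; first by apply: bms_square_integrable => //; exact: test_function_bms txi.
  move=> i; exists (partial i xi); first exact: smooth_weak_partial oU txi.1.
  by apply: bms_square_integrable => //; exact: test_function_partial_bms txi.
(* The approximating test function is [xi] itself. The norm of the difference still needs care: the
   chosen weak derivatives of the zero function vanish only almost everywhere. *)
move=> e e0; exists xi => //.
have xi0 : xi \- xi = cst 0 by apply/funext => x; rewrite /= subrr.
rewrite xi0 /W12_normsq (_ : (\int[mu]_(x in U) _)%E = 0%E) ?lte_fin//.
have w0 i : is_weak_partial U i (cst 0) (cst 0 : Rn -> R).
  split.
    split; first exact: measurable_cst.
    by move=> K cK KU; exact: integrable0.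
  move=> phi _; rewrite /Rintegral !integral0_eq//= ?oppr0//; move=> x _; by rewrite mul0r.
have H : {ae mu, forall x, U x -> forall i, weak_partial U i (cst 0 : Rn -> R) x = 0}.
  have Hi i := weak_partial_unique oU (is_weak_partial_weak_partial (w0 i)) (w0 i).
  have Hall : {ae mu, forall x, forall i, U x -> weak_partial U i (cst 0 : Rn -> R) x = 0}.
    by apply: filter_forall; exact: Hi.
  by apply: filterS Hall => x Hx Ux i; exact: Hx.
transitivity (\int[mu]_(x in U) 0)%E; last by rewrite integral0.
apply: ae_eq_integral => //.
  apply/measurable_EFinP; apply: measurable_funD.
    by apply: measurable_funX; exact: measurable_cst.
  apply: measurable_sum => i; apply: measurable_funX.
  exact: (is_weak_partial_weak_partial (w0 i)).1.1.
apply: filterS H => x H Ux; congr EFin; rewrite /normsq_grad expr0n/= add0r big1// => i _.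
by rewrite (H Ux) expr0n.
Qed.

End weak_derivatives.

(** * First-order consequence of minimality *)

Section energy_comparison.
Context {R : realType} {n : nat}.
Local Notation mu := (@lebesgue_rV R n).
Local Notation Rn := 'rV[R]_n.

Lemma bounded_measurable_integrable (U : set Rn) (f : Rn -> R) (B : R) :
  measurable U -> (mu U < +oo)%E -> measurable_fun U f ->
  (forall x, U x -> `|f x| <= B) -> mu.-integrable U (EFin \o f).
Proof.
move=> mU Ufin mf fB; apply: measurable_bounded_integrable => //.
exists B; split; first exact: num_real.
by move=> N BN x Ux; apply: (le_trans (fB _ Ux)); exact: ltW.
Qed.

Lemma integrable_mul_bounded (U : set Rn) (g f : Rn -> R) (B : R) : measurable U ->
  mu.-integrable U (EFin \o g) -> measurable_fun U f -> (forall x, `|f x| <= B) ->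
  mu.-integrable U (EFin \o (fun x => g x * f x)).
Proof.
move=> mU ig mf fB; have iBg : mu.-integrable U (fun x => (B%:E * (g x)%:E)%E) by exact: integrableZl.
apply: le_integrable iBg => //.
  apply/measurable_EFinP; apply: measurable_funM => //.
  by apply/measurable_EFinP; case/integrableP : ig.
move=> x _ /=; rewrite lee_fin !normrM mulrC ler_wpM2r//.
by rewrite (le_trans (fB x))// ler_norm.
Qed.

Lemma integrable_sum_fin (U : set Rn) (I : Type) (s : seq I) (f : I -> Rn -> R) : measurable U ->
  (forall i, mu.-integrable U (EFin \o f i)) ->
  mu.-integrable U (EFin \o (fun x => \sum_(i <- s) f i x)).
Proof.
move=> mU fi; rewrite /comp; elim: s => [|i s IH].
  by under eq_fun do rewrite big_nil; exact: integrable0.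
under eq_fun do rewrite big_cons EFinD.
by apply: integrableD => //; exact: fi.
Qed.

(** The squared gradient of [u + xi], which is almost everywhere the sum of the gradients, is
    expanded. Square integrability of the gradient and boundedness of the potential terms make both
    energies finite, so that the energy of [u] can be subtracted. *)
Lemma energy_comparison (U : set Rn) (u xi : Rn -> R) (W : R -> R) (B : R) :
  open U -> (mu U < +oo)%E -> W12 U u -> test_function U xi ->
  measurable_fun U (W \o u) -> measurable_fun U (W \o (u \+ xi)%R) ->
  (forall x, U x -> 0 <= W (u x) <= B) -> (forall x, U x -> 0 <= W (u x + xi x) <= B) ->
  (energy W U u <= energy W U (u \+ xi)%R)%E ->
  \int[mu]_(x in U) (W (u x) - W (u x + xi x)) <=
  \int[mu]_(x in U) \sum_(i < n)
     (weak_partial U i u x * partial i xi x + 2^-1 * partial i xi x ^+ 2).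
Proof.
move=> oU Ufin Wu txi mWu mWv bWu bWv.
have mU := open_measurable_rV oU.
have bxi := test_function_bms txi.
pose d i := partial i xi; pose g i := weak_partial U i u.
have bd i : bms (d i) := test_function_partial_bms i txi.
have md i : measurable_fun U (d i) by apply/measurable_funTS; case: (bd i).
have wg i := (W12_weak_partial i oU Wu).1.
have sg i := (W12_weak_partial i oU Wu).2.
have [g2 g1] : (forall i, mu.-integrable U (EFin \o (fun x => g i x ^+ 2))) /\
    forall i, mu.-integrable U (EFin \o g i).
  by split=> i; have [] := square_integrable_integrable oU Ufin (sg i).
have gd i : mu.-integrable U (EFin \o (fun x => g i x * d i x)).
  by have [_ [M dM _]] := bd i; exact: integrable_mul_bounded.
have d2 i : mu.-integrable U (EFin \o (fun x => d i x ^+ 2)).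
  by have [] := square_integrable_integrable oU Ufin (bms_square_integrable oU (bd i)).
have iWu : mu.-integrable U (EFin \o (W \o u)).
  apply: (@bounded_measurable_integrable _ _ B) => // x Ux /=.
  by have /andP[w0 wB] := bWu x Ux; rewrite ger0_norm.
have iWv : mu.-integrable U (EFin \o (fun x => W (u x + xi x))).
  apply: (@bounded_measurable_integrable _ _ B) => // x Ux /=.
  by have /andP[w0 wB] := bWv x Ux; rewrite ger0_norm.
pose P x := \sum_(i < n) (g i x * d i x + 2^-1 * d i x ^+ 2).
have iP : mu.-integrable U (EFin \o P).
  apply: integrable_sum_fin => // i; rewrite /comp; under eq_fun do rewrite EFinD.
  apply: integrableD => //; first exact: gd.
  by under eq_fun do rewrite EFinM; apply: integrableZl => //; exact: d2.
pose E1 x := 2^-1 * normsq_grad U u x + W (u x).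
have iE1 : mu.-integrable U (EFin \o E1).
  rewrite /comp; under eq_fun do rewrite EFinD EFinM.
  apply: integrableD => //; apply: integrableZl => //.
  exact: (@integrable_sum_fin U _ (index_enum 'I_n) (fun i x => g i x ^+ 2)).
pose E2 x := E1 x + (P x - (W (u x) - W (u x + xi x))).
have iWW : mu.-integrable U (EFin \o (fun x => W (u x) - W (u x + xi x))).
  by rewrite /comp; under eq_fun do rewrite EFinB; exact: integrableB.
have iPW : mu.-integrable U (EFin \o (fun x => P x - (W (u x) - W (u x + xi x)))).
  by rewrite /comp; under eq_fun do rewrite EFinB; exact: integrableB.
have iE2 : mu.-integrable U (EFin \o E2).
  by rewrite /comp; under eq_fun do rewrite EFinD; exact: integrableD.
have wuxi i : {ae mu, forall x, U x -> weak_partial U i (u \+ xi) x = g i x + d i x}.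
  have w1 : is_weak_partial U i (u \+ xi) (g i \+ d i).
    apply: is_weak_partialD => //.
    - exact: Wu.1.1.
    - by apply/measurable_funTS; case: bxi.
    - exact: square_integrable_locally oU Wu.1.
    - exact: square_integrable_locally oU (bms_square_integrable oU bxi).
    - exact: smooth_weak_partial oU txi.1.
  exact: (weak_partial_unique oU (is_weak_partial_weak_partial w1) w1).
have w1m i : measurable_fun U (weak_partial U i (u \+ xi)).
  have w1 : is_weak_partial U i (u \+ xi) (g i \+ d i).
    apply: is_weak_partialD => //.
    - exact: Wu.1.1.
    - by apply/measurable_funTS; case: bxi.
    - exact: square_integrable_locally oU Wu.1.
    - exact: square_integrable_locally oU (bms_square_integrable oU bxi).
    - exact: smooth_weak_partial oU txi.1.
  exact: (is_weak_partial_weak_partial w1).1.1.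
have energyE : energy W U (u \+ xi) = (\int[mu]_(x in U) (E2 x)%:E)%E.
  apply: ae_eq_integral => //.
  - apply/measurable_EFinP; apply: measurable_funD => //.
    apply: measurable_funM => //; apply: measurable_sum => i.
    exact: measurable_funX.
  - by case/integrableP : iE2.
  have Hall : {ae mu, forall x, forall i, U x -> weak_partial U i (u \+ xi) x = g i x + d i x}.
    by apply: filter_forall; exact: wuxi.
  apply: filterS Hall => x Hx Ux; congr EFin.
  have S : normsq_grad U (u \+ xi) x = normsq_grad U u x + 2 * P x.
    rewrite /normsq_grad /P mulr_sumr -big_split/=; apply: eq_bigr => i _.
    by rewrite (Hx i Ux) -/(g i x); field.
  by rewrite /E2 /E1 S /=; field.
rewrite energyE /energy => H.
have : 0 <= \int[mu]_(x in U) (P x - (W (u x) - W (u x + xi x))).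
  have -> : \int[mu]_(x in U) (P x - (W (u x) - W (u x + xi x))) =
     \int[mu]_(x in U) E2 x - \int[mu]_(x in U) E1 x.
    have -> : \int[mu]_(x in U) E2 x = \int[mu]_(x in U) E1 x +
        \int[mu]_(x in U) (P x - (W (u x) - W (u x + xi x))) by rewrite -RintegralD.
    by rewrite addrAC subrr add0r.
  rewrite subr_ge0; apply: fine_le => //; exact: integrable_fin_num.
by rewrite (RintegralB mU iP iWW) subr_ge0.
Qed.

End energy_comparison.

(** * The mollified competitor *)

Section convolution_estimates.
Context {R : realType} {n : nat}.
Local Notation mu := (@lebesgue_rV R n).
Local Notation Rn := 'rV[R]_n.
Context (rho : Rn -> R) (krho : kernel rho).

Lemma measurable_sub_rV : measurable_fun [set: Rn * Rn] (fun p : Rn * Rn => (p.1 - p.2 : Rn)).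
Proof.
apply: measurable_fun_rV => i; under eq_fun do rewrite !mxE.
apply: measurable_funB.
  exact: (measurableT_comp (measurable_rV_coor i) measurable_fst).
exact: (measurableT_comp (measurable_rV_coor i) measurable_snd).
Qed.

(** Fubini and the evenness of [rho]. [G] is only integrable because it will be a weak derivative
    extended by 0. *)
Lemma conv_adjoint (G z : Rn -> R) : (forall x, rho (- x) = rho x) ->
  mu.-integrable setT (EFin \o G) -> bms z ->
  \int[mu]_x (G x * conv rho z x) = \int[mu]_x (z x * conv rho G x).
Proof.
move=> rho_sym iG bz; have [B HB] := kernel_bounded krho.
have B0 : 0 <= B by exact: le_trans (HB 0).
have iz := bms_integrable bz.
have mG : measurable_fun [set: Rn] G by apply/measurable_EFinP; case/integrableP : iG.
have mz : measurable_fun [set: Rn] z by case: bz.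
pose h (p : Rn * Rn) : \bar R := (G p.1 * (rho (p.1 - p.2) * z p.2))%:E.
have mh : measurable_fun [set: Rn * Rn] h.
  apply/measurable_EFinP; apply: measurable_funM.
    exact: (measurableT_comp mG measurable_fst).
  apply: measurable_funM; last exact: (measurableT_comp mz measurable_snd).
  by apply: (measurableT_comp _ measurable_sub_rV); case: (kernel_bms krho).
have ih : (mu \x mu)%E.-integrable setT h.
  apply: (integrable12ltyP mu mu mh).2.
  have inz : (\int[mu]_y `|(z y)%:E| < +oo)%E by case/integrableP : iz.
  have inG : (\int[mu]_x `|(G x)%:E| < +oo)%E by case/integrableP : iG.
  apply: (@le_lt_trans _ _ (\int[mu]_x ((B%:E * \int[mu]_y `|(z y)%:E|) * `|(G x)%:E|))%E).
    apply: ge0_le_integral => //.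
    - by move=> x _; apply: integral_ge0.
    - apply: (measurable_fun_fubini_tonelli_F (abse \o h)) => //=.
      exact: measurableT_comp.
    - apply: measurable_funeM; apply: measurableT_comp => //; exact/measurable_EFinP.
    move=> x _; rewrite muleAC -ge0_integralZl//; last 2 first.
    - by apply: measurableT_comp => //; exact/measurable_EFinP.
    - by rewrite mule_ge0.
    apply: ge0_le_integral => //.
    - apply: measurableT_comp => //; apply: (measurableT_comp mh); exact: measurable_pair1.
    - apply: measurable_funeM; apply: measurableT_comp => //; exact/measurable_EFinP.
    move=> y _; rewrite /h/= -!EFinM lee_fin !normrM mulrCA mulrA ler_wpM2r// ler_wpM2r//.
  rewrite ge0_integralZl//; last 2 first.
  - by apply: measurableT_comp => //; exact/measurable_EFinP.
  - by rewrite mule_ge0// integral_ge0.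
  rewrite lte_mul_pinfty// ?mule_ge0 ?integral_ge0//.
  rewrite fin_numM// ge0_fin_numE ?integral_ge0//.
have mrho x : measurable_fun [set: Rn] (fun y => rho (x - y)) := kernel_sub_measurable x krho.
rewrite /Rintegral; congr fine.
transitivity (\int[mu]_x \int[mu]_y h (x, y))%E.
  apply: eq_integral => x _; rewrite /h /=.
  have ik := bms_integrable (bms_kernel_sub x krho bz).
  under eq_integral do rewrite EFinM.
  rewrite integralZl// EFinM; congr (_ * _)%E.
  by rewrite /conv /Rintegral fineK//; exact: integrable_fin_num.
rewrite (Fubini ih); apply: eq_integral => y _; rewrite /h /=.
have ik : mu.-integrable setT (EFin \o (fun x => rho (y - x) * G x)).
  have := integrable_mul_bounded measurableT iG (mrho y) (fun x => HB _).
  by under eq_fun do rewrite mulrC.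
transitivity (\int[mu]_x ((z y)%:E * (rho (y - x) * G x)%:E))%E.
  apply: eq_integral => x _; rewrite -EFinM; congr EFin.
  by rewrite -(opprB x y) rho_sym; ring.
rewrite integralZl// EFinM; congr (_ * _)%E.
by rewrite /conv /Rintegral fineK//; exact: integrable_fin_num.
Qed.

Context (rho0 : forall x, 0 <= rho x)
  (rho1 : forall x, (\int[mu]_y (rho (x - y))%:E = 1)%E).

Lemma integrable_kernel_sub x : mu.-integrable setT (EFin \o (fun y => rho (x - y))).
Proof.
apply/integrableP; split.
  by apply/measurable_EFinP; exact: kernel_sub_measurable.
rewrite (eq_integral (fun y : Rn => (rho (x - y))%:E)); last first.
  by move=> y _; rewrite /= ger0_norm.
by rewrite rho1 ltry.
Qed.

Lemma conv_ge (z : Rn -> R) (c : R) x : bms z ->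
  (forall y, rho (x - y) != 0 -> c <= z y) -> c <= conv rho z x.
Proof.
move=> bz cz.
have -> : c = \int[mu]_y (c * rho (x - y)).
  by rewrite RintegralZl//; [rewrite /Rintegral rho1 mulr1|exact: integrable_kernel_sub].
rewrite /conv; apply: le_Rintegral => //.
- rewrite /comp; under eq_fun do rewrite EFinM; apply: integrableZl => //.
  exact: integrable_kernel_sub.
- by apply: bms_integrable; exact: bms_kernel_sub.
move=> y _; have [->|/cz cy] := eqVneq (rho (x - y)) 0; first by rewrite mulr0 mul0r.
by rewrite mulrC ler_wpM2l.
Qed.

Lemma conv_le (z : Rn -> R) (c : R) x : bms z ->
  (forall y, rho (x - y) != 0 -> z y <= c) -> conv rho z x <= c.
Proof.
move=> bz cz.
have -> : c = \int[mu]_y (c * rho (x - y)).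
  by rewrite RintegralZl//; [rewrite /Rintegral rho1 mulr1|exact: integrable_kernel_sub].
rewrite /conv; apply: le_Rintegral => //.
- by apply: bms_integrable; exact: bms_kernel_sub.
- rewrite /comp; under eq_fun do rewrite EFinM; apply: integrableZl => //.
  exact: integrable_kernel_sub.
move=> y _; have [->|/cz cy] := eqVneq (rho (x - y)) 0; first by rewrite mulr0 mul0r.
by rewrite mulrC ler_wpM2r.
Qed.

Lemma bms_conv (z : Rn -> R) : bms z -> bms (conv rho z).
Proof.
move=> bz; have [_ [M1 _ H1]] := kernel_bms krho; have [_ [M2 _ H2]] := bz.
apply: (@continuous_bms _ _ _ (cube (M1 + M2))); first exact: conv_continuous.
  exact: cube_compact.
move=> x /conv_neq0[y [/H1 h1 /H2 h2]] i; rewrite -(subrK (y ord0 i) (x ord0 i)).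
by rewrite (le_trans (ler_normD _ _))// lerD//; have := h1 i; rewrite !mxE.
Qed.

Lemma bms_sqr (z : Rn -> R) : bms z -> bms (fun x => z x ^+ 2).
Proof.
move=> bz; have [mz [B HB _]] := bz.
by apply: bmsM => //; exists B.
Qed.

(** Jensen's inequality for the probability density [rho (x - y)] in [y]: the variance of [z] is
    nonnegative. *)
Lemma conv_sqr_le (z : Rn -> R) x : bms z ->
  conv rho z x ^+ 2 <= conv rho (fun y => z y ^+ 2) x.
Proof.
move=> bz; set m := conv rho z x.
have i1 := bms_integrable (bms_kernel_sub x krho bz).
have i2 := bms_integrable (bms_kernel_sub x krho (bms_sqr bz)).
have i0 := integrable_kernel_sub x.
have : 0 <= \int[mu]_y (rho (x - y) * (z y - m) ^+ 2).
  by apply: Rintegral_ge0 => y _; rewrite mulr_ge0// sqr_ge0.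
have -> : \int[mu]_y (rho (x - y) * (z y - m) ^+ 2) =
    \int[mu]_y (rho (x - y) * z y ^+ 2 + ((- 2 * m) * (rho (x - y) * z y) + m ^+ 2 * rho (x - y))).
  by apply: eq_Rintegral => y _; ring.
have j1 : mu.-integrable setT (EFin \o (fun y => (- 2 * m) * (rho (x - y) * z y))).
  by rewrite /comp; under eq_fun do rewrite EFinM; exact: integrableZl.
have j0 : mu.-integrable setT (EFin \o (fun y => m ^+ 2 * rho (x - y))).
  by rewrite /comp; under eq_fun do rewrite EFinM; exact: integrableZl.
have j10 : mu.-integrable setT (EFin \o (fun y => (- 2 * m) * (rho (x - y) * z y) + m ^+ 2 * rho (x - y))).
  by rewrite /comp; under eq_fun do rewrite EFinD; exact: integrableD.
rewrite RintegralD// RintegralD// !RintegralZl//.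
have -> : \int[mu]_y rho (x - y) = 1 by rewrite /Rintegral rho1.
rewrite -/(conv rho z x) -/m -/(conv rho (fun y => z y ^+ 2) x) mulr1.
by lra.
Qed.

End convolution_estimates.

Section mollified_energy.
Context {R : realType} {n : nat}.
Local Notation mu := (@lebesgue_rV R n).
Local Notation Rn := 'rV[R]_n.

Lemma is_derive_subl (f : Rn -> R) (c x v : Rn) (d : R) :
  is_derive (c - x) v f d -> is_derive x v (fun y => f (c - y)) (- d).
Proof.
move=> /is_derive_line0 H; apply/is_derive_line0.
have -> : (fun s : R => f (c - (x + s *: v))) = (fun t : R => f (c - x + t *: v)) \o -%R.
  by apply/funext => s /=; rewrite scaleNr opprD addrA.
by rewrite -mulrN1; apply: is_derive1_comp; rewrite oppr0.
Qed.

Lemma is_derive_subr (f : Rn -> R) (c x v : Rn) (d : R) :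
  is_derive (x - c) v f d -> is_derive x v (fun y => f (y - c)) d.
Proof.
move=> /is_derive_line0 H; apply/is_derive_line0.
have -> : (fun s : R => f (x + s *: v - c)) = (fun t : R => f (x - c + t *: v)).
  by apply/funext => s /=; rewrite addrAC.
exact: H.
Qed.

Lemma partial_odd (rho : Rn -> R) i (x : Rn) : kernel rho ->
  (forall x, rho (- x) = rho x) -> partial i rho (- x) = - partial i rho x.
Proof.
move=> kr sym; have [_ dr] := kernel_partial i kr.
have := @is_derive_subl rho 0 x 'e_i _ (dr (0 - x)).
have -> : (fun y : Rn => rho (0 - y)) = rho by apply/funext => y; rewrite sub0r sym.
rewrite sub0r => -[_ H]; have [_ H2] := dr x.
by move: H; rewrite H2 => ->; rewrite opprK.
Qed.

Lemma bms_indic (U : set Rn) (M : R) : measurable U -> U `<=` cube M -> bms (\1_U : Rn -> R).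
Proof.
move=> mU UM; split; first exact: measurable_indic.
exists (Num.max 1 M) => [x|x].
  by rewrite le_max indicE; case: (_ \in _); rewrite ?normr1 ?normr0 ?lexx ?ler01.
rewrite indicE; case: (boolP (_ \in _)); rewrite ?eqxx// inE => /UM xM _ i.
by rewrite le_max xM orbT.
Qed.

(* Moving the even kernel to the other factor turns [g] into the gradient of the
   mollified [u]; the quadratic term is handled by Jensen's inequality. The
   constant [c] is free because only gradients matter. *)
Lemma mollified_energy_le (rho : Rn -> R) (U : set Rn) (u g z : Rn -> R) (i : 'I_n) (c M : R) :
  kernel rho -> (forall x, rho (- x) = rho x) -> (forall x, 0 <= rho x) ->
  (forall x, (\int[mu]_y (rho (x - y))%:E = 1)%E) ->
  open U -> (mu U < +oo)%E -> U `<=` cube M ->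
  locally_integrable_on U u ->
  is_weak_partial U i u g -> square_integrable U g ->
  bms ((fun x => u x - c) \_ U) -> bms z ->
  (forall y, z y != 0 -> test_function U (fun x => rho (x - y))) ->
  \int[mu]_(x in U) (g x * conv rho z x + 2^-1 * conv rho z x ^+ 2) <=
  \int[mu]_y (z y * conv (partial i rho) ((fun x => u x - c) \_ U) y + 2^-1 * z y ^+ 2).
Proof.
move=> kr sym r0 r1 oU Ufin UM lu wg sg bu bz tz.
have mU := open_measurable_rV oU.
have [kr' dr] := kernel_partial i kr.
have [_ ig] := square_integrable_integrable oU Ufin sg.
have iG : mu.-integrable setT (EFin \o (g \_ U)).
  by rewrite -restrict_EFin; apply/integrable_restrict; rewrite ?setTI.
have cc := conv_continuous kr bz.
have mc : measurable_fun U (conv rho z) by apply/measurable_funTS; exact: continuous_measurable_rV.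
have [Bz HBz] : exists B, forall x, `|conv rho z x| <= B.
  have [_ [B HB _]] := bz; exists B => x; rewrite ler_norml; apply/andP; split.
    by apply: conv_ge => // y _; have := HB y; rewrite ler_norml => /andP[].
  by apply: conv_le => // y _; have := HB y; rewrite ler_norml => /andP[].
have igc := integrable_mul_bounded mU ig mc HBz.
have ic2 : mu.-integrable U (EFin \o (fun x => conv rho z x ^+ 2)).
  apply: (@bounded_measurable_integrable _ _ _ _ (Bz ^+ 2)) => //.
    exact: measurable_funX.
  by move=> x _; rewrite normrX lerXn2r ?nnegrE// (le_trans _ (HBz x)).
have ihc2 : mu.-integrable U (EFin \o (fun x => 2^-1 * conv rho z x ^+ 2)).
  by rewrite /comp; under eq_fun do rewrite EFinM; exact: integrableZl.
rewrite (RintegralD mU igc ihc2).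
have bdu : bms (conv (partial i rho) ((fun x => u x - c) \_ U)) by exact: bms_conv.
have bzd : bms (fun y => z y * conv (partial i rho) ((fun x => u x - c) \_ U) y).
  by under eq_fun do rewrite mulrC; have [md [B HB _]] := bdu; apply: bmsM => //; exists B.
have bz2 := bms_sqr bz.
have ihz2 : mu.-integrable setT (EFin \o (fun x => 2^-1 * z x ^+ 2)).
  rewrite /comp; under eq_fun do rewrite EFinM; apply: integrableZl => //.
  exact: bms_integrable.
rewrite [leRHS](RintegralD measurableT (bms_integrable bzd) ihz2).
apply: lerD.
  rewrite le_eqVlt; apply/orP; left; apply/eqP.
  have -> : \int[mu]_(x in U) (g x * conv rho z x) = \int[mu]_x ((g \_ U) x * conv rho z x).
    rewrite Rintegral_mkcond; apply: eq_Rintegral => x _; rewrite !patchE.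
    by case: ifP => // _; rewrite mul0r.
  rewrite (conv_adjoint kr sym iG bz); apply: eq_Rintegral => y _.
  have [->|zy] := eqVneq (z y) 0; first by rewrite !mul0r.
  congr (_ * _); have tp := tz y zy.
  set phi := (fun x : Rn => rho (x - y)) in tp *.
  have dphi x : partial i phi x = partial i rho (x - y).
    by have [_] := is_derive_subr (dr (x - y)).
  have bp := test_function_bms tp; have bdp := test_function_partial_bms i tp.
  have ex' : exists2 C, compact C /\ C `<=` U & forall x, partial i phi x != 0 -> C x.
    exists (closure [set x | phi x != 0]); first by case: tp => _.
    by move=> x; apply: partial_supp; case: tp.
  (* A constant has zero weak derivative, so subtracting [c] from [u] changes nothing when tested
     against [partial i phi]. *)
  have [lc Hc] := smooth_weak_partial i oU (@smooth_cst R n c).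
  have iu := integrable_mul_bms oU lu bdp ex'.
  have lcc : locally_integrable_on U (fun=> c : R).
    by apply: continuous_locally_integrable; exact: cst_continuous.
  have icp := integrable_mul_bms oU lcc bdp ex'.
  have E1 : \int[mu]_(x in U) ((u x - c) * partial i phi x) = - \int[mu]_(x in U) (g x * phi x).
    under eq_Rintegral do rewrite mulrBl.
    rewrite RintegralB// (wg.2 _ tp) (Hc _ tp).
    rewrite [X in - _ - - X](_ : _ = 0) ?oppr0 ?addr0//.
    rewrite /Rintegral integral0_eq// => x _.
    by rewrite /partial derive_cst mul0r.
  rewrite /conv.
  have -> : \int[mu]_x (rho (y - x) * (g \_ U) x) = \int[mu]_(x in U) (g x * phi x).
    rewrite [RHS]Rintegral_mkcond; apply: eq_Rintegral => x _; rewrite !patchE /phi.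
    case: ifP => _; last by rewrite mulr0.
    by rewrite -(opprB x y) sym mulrC.
  apply: oppr_inj; rewrite -E1.
  have := @RintegralZl _ _ _ mu setT _ (-1) measurableT (bms_integrable (bms_kernel_sub y kr' bu)).
  rewrite mulN1r => <-.
  rewrite Rintegral_mkcond; apply: eq_Rintegral => x _; rewrite !patchE dphi.
  case: ifP => _; last by rewrite !mulr0.
  by rewrite -(opprB x y) partial_odd//; ring.
rewrite RintegralZl//.
rewrite RintegralZl//; last exact: bms_integrable.
rewrite ler_pM2l ?invr_gt0//.
have b1U := bms_indic mU UM.
(* After Jensen, the kernel is moved onto the indicator of [U], whose mollification is at most 1. *)
apply: (@le_trans _ _ (\int[mu]_(x in U) conv rho (fun y => z y ^+ 2) x)).
  apply: le_Rintegral => //.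
    by apply: integrableS (bms_integrable (bms_conv kr bz2)).
  by move=> x _; exact: conv_sqr_le.
have -> : \int[mu]_(x in U) conv rho (fun y => z y ^+ 2) x =
    \int[mu]_x (\1_U x * conv rho (fun y => z y ^+ 2) x).
  rewrite Rintegral_mkcond; apply: eq_Rintegral => x _; rewrite patchE indicE.
  by case: ifP => _; rewrite ?mul1r ?mul0r.
rewrite (conv_adjoint kr sym (bms_integrable b1U) bz2).
apply: le_Rintegral => //.
- apply: bms_integrable; under eq_fun do rewrite mulrC.
  by have [mb [B HB _]] := bms_conv kr b1U; apply: bmsM => //; exists B.
- exact: bms_integrable.
move=> y _; rewrite ler_piMr ?sqr_ge0//; exact: conv_le.
Qed.

End mollified_energy.

Section competitor.
Context {R : realType} {n : nat}.
Local Notation mu := (@lebesgue_rV R n).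
Local Notation Rn := 'rV[R]_n.

Lemma kernel_shift (k : Rn -> R) (y : Rn) : kernel k -> kernel (fun x => k (x - y)).
Proof.
move=> [M [h [ch ->]]]; exists (M + `|y|), (fun i t => h i (t - y ord0 i)); split.
  move=> i; have [sh hM] := ch i; split.
    move=> j; have := @Cn_affine R j (h i) 1 (- y ord0 i) (sh j).
    by under eq_fun do rewrite mul1r.
  move=> t /hM tM; rewrite -(subrK (y ord0 i) t) (le_trans (ler_normD _ _))// lerD//.
  exact: le_coord_norm.
by apply/funext => x; apply: eq_bigr => i _; rewrite !mxE.
Qed.

Lemma bms_pos_part (f : Rn -> R) (M : R) : continuous f -> (forall x, 0 < f x -> cube M x) ->
  bms (fun x => Num.max (f x) 0).
Proof.
move=> cf fM; apply: (@continuous_bms _ _ _ (cube M)); [|exact: cube_compact|].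
  by move=> x; apply: (continuous_max (cf x)); exact: cst_continuous.
move=> x; rewrite maxEle; case: ifPn; rewrite ?eqxx// -ltNge => /fM //.
Qed.

Lemma bms_pos_restrict (f g : Rn -> R) (M : R) : continuous f -> continuous g ->
  (forall x, 0 < f x -> cube M x) -> bms (fun x => if 0 < f x then g x else 0).
Proof.
move=> cf cg fM; split.
  apply: measurable_fun_ifT => //; last exact: continuous_measurable_rV.
  by apply: measurable_fun_ltr => //; exact: continuous_measurable_rV.
have [B B0 HB] := continuous_cube_bounded M cg.
exists (Num.max B M) => x.
  rewrite le_max; apply/orP; left; case: ifPn => [/fM/HB//|_].
  by rewrite normr0.
case: ifPn => [/fM xM _ i|]; rewrite ?eqxx//.
by rewrite le_max xM orbT.
Qed.

(** The weak gradient of a positive part is the gradient on the positivity set: integration by parts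
    against [rho (x - y)]. *)
Lemma conv_partial_pos (rho f f' : Rn -> R) i (M : R) (x : Rn) : kernel rho ->
  (forall x, is_derive x 'e_i f (f' x)) -> continuous f -> continuous f' ->
  (forall x, 0 < f x -> cube M x) ->
  conv (partial i rho) (fun y => Num.max (f y) 0) x =
  conv rho (fun y => if 0 < f y then f' y else 0) x.
Proof.
move=> kr df cf cf' fM; have [kr' dr] := kernel_partial i kr.
have csub (k : Rn -> R) : kernel k -> continuous (fun y : Rn => k (x - y)).
  move=> kk y; apply: (@continuous_comp _ _ _ (fun y : Rn => (x - y : Rn)) k); last exact: kernel_continuous.
  exact: (cvgB (cvg_cst x) (@cvg_id _ (nbhs y))).
have := @integration_by_parts_pos R n i f f' (fun y : Rn => rho (x - y)) (fun y : Rn => - partial i rho (x - y)) M df.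
have dp y : is_derive y 'e_i (fun y : Rn => rho (x - y)) (- partial i rho (x - y)).
  exact: is_derive_subl.
move=> /(_ dp cf cf' (csub _ kr)) H.
rewrite /conv; under [in RHS]eq_Rintegral do rewrite mulrC.
rewrite H.
- rewrite -mulN1r -RintegralZl//.
    by apply: eq_Rintegral => y _; ring.
  have b := bms_kernel_sub x kr' (bms_pos_part cf fM).
  have -> : (fun y => Num.max (f y) 0 * - partial i rho (x - y)) =
      (fun y => -1 * (partial i rho (x - y) * Num.max (f y) 0)).
    by apply/funext => y; ring.
  by rewrite /comp; under eq_fun do rewrite EFinM; apply: integrableZl => //; exact: bms_integrable.
- by move=> y; apply: (cvgN (csub _ kr' y)).
- by move=> y /fM.
Qed.

Lemma Rintegral_sum_fin (U : set Rn) (I : Type) (s : seq I) (f : I -> Rn -> R) : measurable U ->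
  (forall i, mu.-integrable U (EFin \o f i)) ->
  \int[mu]_(x in U) (\sum_(i <- s) f i x) = \sum_(i <- s) \int[mu]_(x in U) f i x.
Proof.
move=> mU fi; elim: s => [|i s IH].
  by rewrite big_nil; under eq_Rintegral do rewrite big_nil; rewrite /Rintegral integral0.
rewrite big_cons; under eq_Rintegral do rewrite big_cons.
by rewrite (RintegralD mU (fi i) (integrable_sum_fin s mU fi)) IH.
Qed.

(* [v] is the mollification of [u] extended by the constant [q] outside [U], and
   [xi] is the mollification of [(phi - v)^+]. As [q] is above the barrier [phi],
   the set [v < phi] stays away from the boundary of [U]. *)
Lemma mollified_competitor (U : set Rn) (u phi : Rn -> R) (dphi : 'I_n -> Rn -> R)
    (q delta e r M : R) :
  open U -> (mu U < +oo)%E -> U `<=` cube M -> W12 U u ->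
  (forall x, U x -> `|u x| <= q) -> 0 < r -> 0 <= q -> delta <= q ->
  (forall x i, is_derive x 'e_i phi (dphi i x)) -> continuous phi ->
  (forall i, continuous (dphi i)) -> (forall x, phi x < delta) ->
  (forall x y : Rn, U x -> u x <= delta -> (forall i, `|x ord0 i - y ord0 i| < 3 * r) -> U y) ->
  (forall x y : Rn, U x -> U y -> (forall i, `|x ord0 i - y ord0 i| < r) -> `|u x - u y| <= e) ->
  (forall x y : Rn, (forall i, `|x ord0 i - y ord0 i| < r) -> `|phi x - phi y| <= e) ->
  exists (v : Rn -> R) (dv : 'I_n -> Rn -> R) (xi : Rn -> R),
  [/\ (forall x i, is_derive x 'e_i v (dv i x)) /\
        (continuous v /\ (forall i, continuous (dv i))),
      test_function U xi,
      (forall x, 0 <= xi x) /\ (forall x, U x -> xi x <= Num.max (phi x - u x + 3 * e) 0),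
      (forall x, v x < phi x -> U x) /\
        (forall x, U x -> u x <= delta -> `|v x - u x| <= e) &
      \int[mu]_(x in U) \sum_(i < n)
         (weak_partial U i u x * partial i xi x + 2^-1 * partial i xi x ^+ 2) <=
      \sum_(i < n) \int[mu]_x
         (if v x < phi x then 2^-1 * dphi i x ^+ 2 - 2^-1 * dv i x ^+ 2 else 0)].
Proof.
move=> oU Ufin UM Wu uq r0 q0 dq dphiE cphi cdphi phid KU ue phie.
have mU := open_measurable_rV oU.
have [rho [kr rho0 sym rhor rho1]] := mollifier_exists n r0.
(* Extending [u] by [q] is extending [u - q] by 0; the latter has bounded support, as convolution
   requires here. *)
pose uh := (fun x => u x - q) \_ U.
have uhE x : U x -> uh x = u x - q by move=> Ux; rewrite /uh patchE mem_set.
have uhN x : ~ U x -> uh x = 0 by move=> Ux; rewrite /uh patchE memNset.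
have uh0 x : - (2 * q) <= uh x <= 0.
  have [Ux|Ux] := pselect (U x); last by rewrite uhN// lexx andbT oppr_le0 mulr_ge0.
  by rewrite uhE//; have := uq x Ux; rewrite ler_norml => /andP[? ?]; lra.
have buh : bms uh.
  split.
    have mB : measurable_fun U (fun x : Rn => u x - q).
      by apply: measurable_funB => //; exact: Wu.1.1.
    by have [H _] := measurable_restrictT (fun x : Rn => u x - q) mU; exact: H.
  exists (Num.max (2 * q) M) => [x|x].
    by rewrite le_max ler_norml; have := uh0 x; lra.
  have [Ux|Ux] := pselect (U x); last by rewrite uhN ?eqxx.
  by move=> _ i; rewrite le_max (UM x Ux i) orbT.
pose v x := q + conv rho uh x; pose dv i := conv (partial i rho) uh.
have dvE x i : is_derive x 'e_i v (dv i x).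
  have H := is_deriveD (is_derive_cst q x 'e_i) (is_derive_conv i x kr buh).
  by apply: is_derive_eq H _; rewrite add0r.
have cv : continuous v.
  move=> x; have cc : continuous (conv rho uh) := @conv_continuous _ _ _ _ kr buh.
  exact: (@cvgD _ _ _ (nbhs x) _ (fun=> q) (conv rho uh) _ _ (cvg_cst q) (cc x)).
have cdv i : continuous (dv i) by apply: conv_continuous => //; case: (kernel_partial i kr).
have vge (x : Rn) c : (forall y : Rn, (forall i, `|x ord0 i - y ord0 i| < r) -> c <= q + uh y) -> c <= v x.
  move=> H; rewrite -lerBlDl; apply: conv_ge => // y /rhor xy.
  by rewrite lerBlDl; apply: H => i; have := xy i; rewrite !mxE.
have vle (x : Rn) c : (forall y : Rn, (forall i, `|x ord0 i - y ord0 i| < r) -> q + uh y <= c) -> v x <= c.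
  move=> H; rewrite -lerBrDl; apply: conv_le => // y /rhor xy.
  by rewrite lerBrDl; apply: H => i; have := xy i; rewrite !mxE.
(* An average below [phi y < delta] cannot be taken over values all at least [delta]; the values
   outside [U] are [q >= delta], so a small value of [u] occurs within distance [r]. *)
have nearK (y : Rn) : v y < phi y -> exists k : Rn, [/\ U k, u k <= delta & forall i, `|k ord0 i - y ord0 i| < r].
  move=> vphi; apply: contrapT => /forallNP H.
  have : delta <= v y.
    apply: vge => x xy; have [Ux|Ux] := pselect (U x); last by rewrite uhN// addr0.
    rewrite uhE// addrC subrK leNgt; apply/negP => ud; apply: (H x); split=> //.
      exact: ltW.
    by move=> i; rewrite distrC.
  by rewrite leNgt (lt_trans vphi).
(* The radius [3 * r] is spent as [r] from the low point [k] to [y] and [2 * r] from [y] to [x]. The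
   second [r] of the latter keeps the closed support of [xi] inside [U]. *)
have nearU (y x : Rn) : v y < phi y -> (forall i, `|y ord0 i - x ord0 i| < 2 * r) -> U x.
  move=> /nearK[k [Uk uk ky]] yx; apply: (KU k) => // i.
  by have := ler_distD (y ord0 i) (k ord0 i) (x ord0 i); have := ky i; have := yx i; lra.
have nearU1 (y x : Rn) : v y < phi y -> (forall i, `|y ord0 i - x ord0 i| < r) -> U x.
  by move=> vy yx; apply: (nearU y) => // i; have := yx i; lra.
have vU y : v y < phi y -> U y.
  by move=> /nearU1; apply => i; rewrite subrr normr0.
pose f x := phi x - v x; pose f' i x := dphi i x - dv i x.
have f0E x : (0 < f x) = (v x < phi x) by rewrite /f subr_gt0.
have df i x : is_derive x 'e_i f (f' i x) by exact: is_deriveB.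
have cf : continuous f by move=> x; apply: (cvgB (cphi x) (cv x)).
have cf' i : continuous (f' i) by move=> x; apply: (cvgB (cdphi i x) (cdv i x)).
have fM x : 0 < f x -> cube M x by rewrite f0E => /vU /UM.
pose zeta y := Num.max (f y) 0; pose z i y := if 0 < f y then f' i y else 0.
have bzeta : bms zeta by exact: bms_pos_part fM.
have bz i : bms (z i) by exact: bms_pos_restrict fM.
pose xi := conv rho zeta.
have pxi i : partial i xi = conv rho (z i).
  by rewrite /xi partial_conv//; apply/funext => x; exact: (@conv_partial_pos _ _ (f' i) i M).
have xi_near (x : Rn) : xi x != 0 -> exists2 y : Rn, v y < phi y & forall i, `|x ord0 i - y ord0 i| < r.
  move=> /conv_neq0[y [/rhor xy zy]]; exists y; last by move=> i; have := xy i; rewrite !mxE.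
  by rewrite -f0E; move: zy; rewrite /zeta maxEle; case: ifPn; rewrite ?eqxx// -ltNge.
have txi : test_function U xi.
  split; first exact: conv_smooth.
  have clU : closure [set x | xi x != 0] `<=` U.
    move=> x /(_ (ball x r) (nbhsx_ballx x r r0))[x' [/= /xi_near[y vy x'y] /ball_rV xx']].
    apply: (nearU y) => // i; rewrite distrC.
    have := xx' r0 i; have := x'y i.
    by have := ler_distD (x' ord0 i) (x ord0 i) (y ord0 i); lra.
  split=> //; apply: (subclosed_compact _ (@cube_compact R n M)); first exact: closed_closure.
  exact: subset_trans UM.
have vge_u x : v x < phi x -> u x - e <= v x.
  move=> vx; have Ux := vU x vx; apply: vge => y xy; have Uy := nearU1 _ _ vx xy.
  rewrite uhE//; have := ue _ _ Ux Uy xy; rewrite ler_norml; lra.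
exists v, dv, xi; split => //.
- split=> [x|x Ux].
    by apply: conv_ge => // y _; rewrite le_max lexx orbT.
  apply: conv_le => // y /rhor xy0.
  have xy i : `|x ord0 i - y ord0 i| < r by have := xy0 i; rewrite !mxE.
  rewrite /zeta [leLHS]maxEle; case: ifPn => [_|]; first by rewrite le_max lexx orbT.
  rewrite -ltNge f0E => vy; rewrite le_max; apply/orP; left; rewrite /f.
  (* The three errors: [v] is at least [u - e] at [y], and [u] and [phi] each vary by at most [e]
     between [x] and [y]. *)
  have Uy := vU y vy; have := vge_u y vy; have := ue _ _ Ux Uy xy; have := phie _ _ xy.
  by rewrite !ler_norml; lra.
- split=> // x Ux ud.
  have H (y : Rn) : (forall i, `|x ord0 i - y ord0 i| < r) -> `|q + uh y - u x| <= e.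
    move=> xy; have Uy : U y by apply: (KU x) => // i; have := xy i; lra.
    by rewrite uhE// (addrC q) subrK distrC; exact: ue.
  rewrite ler_norml; apply/andP; split.
    by rewrite lerBrDr; apply: vge => y /H; rewrite ler_norml; lra.
  by rewrite lerBlDr; apply: vle => y /H; rewrite ler_norml; lra.
have wg i := (W12_weak_partial i oU Wu).1.
have sg i := (W12_weak_partial i oU Wu).2.
have iterm i : mu.-integrable U (EFin \o (fun x => weak_partial U i u x * partial i xi x + 2^-1 * partial i xi x ^+ 2)).
  have [_ ig] := square_integrable_integrable oU Ufin (sg i).
  have bpx : bms (partial i xi) by exact: test_function_partial_bms txi.
  have [mpx [B HB _]] := bpx.
  have h1 := integrable_mul_bounded mU ig (measurable_funTS mpx) HB.
  have [h2 _] := square_integrable_integrable oU Ufin (bms_square_integrable oU bpx).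
  rewrite /comp; under eq_fun do rewrite EFinD EFinM; apply: integrableD => //.
  by under eq_fun do rewrite EFinM; exact: integrableZl.
rewrite Rintegral_sum_fin//; apply: ler_sum => i _; rewrite pxi.
have tz y : z i y != 0 -> test_function U (fun x => rho (x - y)).
  rewrite /z; case: ifPn; rewrite ?eqxx// f0E => vy _.
  apply: (@kernel_test_function _ _ _ (cbox (fun i => y ord0 i - r) (fun i => y ord0 i + r))).
  - exact: kernel_shift.
  - exact: cbox_compact.
  - move=> x H; apply: (nearU y) => // j; have := H j; rewrite -ler_distl distrC; lra.
  - by move=> x /rhor H j; rewrite -ler_distl; have := H j; rewrite !mxE; exact: ltW.
have := @mollified_energy_le _ _ rho U u (weak_partial U i u) (z i) i q M kr sym rho0 rho1 oU Ufin UM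
  (square_integrable_locally oU Wu.1) (wg i) (sg i) buh (bz i) tz.
move=> /le_trans; apply; rewrite le_eqVlt; apply/orP; left; apply/eqP.
apply: eq_Rintegral => y _; rewrite -/(dv i) /z f0E; case: ifPn => _; last by rewrite expr0n/= mul0r mulr0 addr0.
(* As [f' = dphi - dv], the sum [f' * dv + f'^2 / 2] is [(dphi^2 - dv^2) / 2]. *)
by rewrite /f'; field.
Qed.

End competitor.

(** * Calibration *)

Section calibration.
Context {R : realType} {n : nat}.
Local Notation mu := (@lebesgue_rV R n).
Local Notation Rn := 'rV[R]_n.

Lemma continuous_rVM (f g : Rn -> R) : continuous f -> continuous g -> continuous (fun x => f x * g x).
Proof. by move=> cf cg x; exact: (cvgM (cf x) (cg x)). Qed.

Lemma continuous_rVD (f g : Rn -> R) : continuous f -> continuous g -> continuous (fun x => f x + g x).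
Proof. by move=> cf cg x; exact: (cvgD (cf x) (cg x)). Qed.

Lemma continuous_rVN (f : Rn -> R) : continuous f -> continuous (fun x => - f x).
Proof. by move=> cf x; exact: (cvgN (cf x)). Qed.

Lemma continuous_rV_comp (f : Rn -> R) (g : R -> R) : continuous f -> continuous g -> continuous (fun x => g (f x)).
Proof. by move=> cf cg x; exact: (@continuous_comp _ _ _ f g x (cf x) (cg (f x))). Qed.

Lemma derive_ge_increment (S s : R -> R) (s0 a b : R) :
  (forall t : R, is_derive t 1 S (s t)) -> (forall t, s0 <= s t) -> a <= b ->
  s0 * (b - a) <= S b - S a.
Proof.
move=> dS s0s; rewrite le_eqVlt => /predU1P[->|ab]; first by rewrite !subrr mulr0.
have cS : {within `[a, b], continuous S}.
  apply: continuous_subspaceT => t; apply: differentiable_continuous.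
  by apply/derivable1_diffP; have [] := dS t.
have [c _ ->] := MVT ab (fun t _ => dS t) cS.
by rewrite ler_wpM2r// subr_ge0 ltW.
Qed.

(* Calibration: [(d v)^2 >= 2 th s(v) d v - th^2 s(v)^2], with equality for [phi];
   the first-order term [th d(S(phi) - S(v))] is then integrated by parts. *)
Lemma calibrated_energy_le (i0 : 'I_n) (phi v : Rn -> R) (dphi dv : 'I_n -> Rn -> R)
    (th th' : Rn -> R) (s S : R -> R) (s0 M : R) :
  (forall x i, is_derive x 'e_i phi (dphi i x)) -> continuous phi -> (forall i, continuous (dphi i)) ->
  (forall x i, is_derive x 'e_i v (dv i x)) -> continuous v -> (forall i, continuous (dv i)) ->
  (forall x, is_derive x 'e_i0 th (th' x)) -> continuous th -> continuous th' ->
  (forall t : R, is_derive t 1 S (s t)) -> continuous s -> {homo s : a b / a <= b} ->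
  0 < s0 -> (forall t, s0 <= s t) ->
  (forall x, dphi i0 x = s (phi x) * th x) -> (forall i x, i != i0 -> dphi i x = 0) ->
  (forall x, v x < phi x -> [/\ cube M x, 1 <= th x & 1 <= th' x]) ->
  \sum_(i < n) \int[mu]_x (if v x < phi x then 2^-1 * dphi i x ^+ 2 - 2^-1 * dv i x ^+ 2 else 0) <=
  - \int[mu]_x (if v x < phi x
       then s0 * (phi x - v x) + 2^-1 * (s (phi x) ^+ 2 - s (v x) ^+ 2) else 0).
Proof.
move=> dphiE cphi cdphi dvE cv cdv dth cth cth' dS cs sm s00 s0s Ei0 Ei H.
have vphi x : (v x < phi x) = (0 < phi x - v x) by rewrite subr_gt0.
have cf : continuous (fun x : Rn => phi x - v x) by move=> x; exact: (cvgB (cphi x) (cv x)).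
pose I (g : Rn -> R) := \int[mu]_x (if v x < phi x then g x else 0).
have b (g : Rn -> R) : continuous g -> bms (fun x : Rn => if v x < phi x then g x else 0).
  move=> cg; have -> : (fun x : Rn => if v x < phi x then g x else 0) = (fun x : Rn => if 0 < phi x - v x then g x else 0).
    by apply/funext => x; rewrite vphi.
  by apply: (@bms_pos_restrict _ _ _ _ M cf cg) => x; rewrite -vphi => /H[].
have I_le (g h : Rn -> R) : continuous g -> continuous h -> (forall x, v x < phi x -> g x <= h x) -> I g <= I h.
  move=> cg ch gh; apply: le_Rintegral => //; [exact: bms_integrable (b _ cg)|exact: bms_integrable (b _ ch)|].
  by move=> x _; case: ifPn => // /gh.
have ID (g h : Rn -> R) : continuous g -> continuous h -> I (fun x => g x + h x) = I g + I h.
  move=> cg ch; rewrite /I -RintegralD//; [|exact: bms_integrable (b _ cg)|exact: bms_integrable (b _ ch)].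
  by apply: eq_Rintegral => x _ /=; case: ifP => _ //; rewrite addr0.
have IN (g : Rn -> R) : continuous g -> I (fun x => - g x) = - I g.
  move=> cg; have cg' : continuous (fun x => - g x) by move=> x; exact: (cvgN (cg x)).
  apply/eqP; rewrite -addr_eq0 addrC -ID//; apply/eqP.
  rewrite /I; under eq_Rintegral do rewrite subrr if_same.
  by rewrite /Rintegral integral0.
have cM := continuous_rVM; have cD := continuous_rVD; have cN := continuous_rVN.
have cC (c : R) : continuous ((fun=> c) : Rn -> R) by exact: cst_continuous.
have c2 (g : Rn -> R) : continuous g -> continuous (fun x : Rn => 2^-1 * g x ^+ 2).
  by move=> cg; apply: (cM) => //; exact: (cM _ _ cg cg).
have cS : continuous S.
  by move=> t; apply: differentiable_continuous; apply/derivable1_diffP; have [] := dS t.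
have [csphi csv] := (continuous_rV_comp cphi cs, continuous_rV_comp cv cs).
have [cSphi cSv] := (continuous_rV_comp cphi cS, continuous_rV_comp cv cS).
pose f (x : Rn) := S (phi x) - S (v x).
pose f' (x : Rn) := s (phi x) * dphi i0 x - s (v x) * dv i0 x.
have cf0 : continuous f by apply: (cD) => //; exact: cN.
have cf' : continuous f' by apply: (cD); [exact: cM|apply: (cN); exact: cM].
pose D (x : Rn) := 2^-1 * (s (phi x) ^+ 2 - s (v x) ^+ 2).
have cDD : continuous D.
  by apply: (cM) => //; apply: (cD); [exact: (cM _ _ csphi csphi)|apply: (cN); exact: (cM _ _ csv csv)].
(* [S] has slope at least [s0 > 0], so passing from [phi - v] to [S (phi) - S (v)] does not change
   the positivity set on which one integrates by parts. *)
have fE x : (0 < f x) = (v x < phi x).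
  rewrite /f; apply/idP/idP => [|vx].
    apply: contraTT; rewrite -!leNgt => vx; have h := derive_ge_increment dS s0s vx.
    suff: 0 <= S (v x) - S (phi x) by lra.
    by apply: le_trans h; rewrite mulr_ge0 ?subr_ge0// ltW.
  apply: lt_le_trans (derive_ge_increment dS s0s (ltW vx)).
  by rewrite mulr_gt0// subr_gt0.
have IBP : I (fun x => f' x * th x) = - I (fun x => f x * th' x).
  have df x : is_derive x 'e_i0 f (f' x).
    apply: is_derive_eq (is_deriveB (is_derive_scalar_comp (dphiE x i0) (dS (phi x)))
      (is_derive_scalar_comp (dvE x i0) (dS (v x)))) _.
    by rewrite /f' (mulrC (s _)) (mulrC (s (v x))).
  have := @integration_by_parts_pos _ _ i0 f f' th th' M df dth cf0 cf' cth cth'.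
  have -> : \int[mu]_x ((if 0 < f x then f' x else 0) * th x) = I (fun x => f' x * th x).
    by apply: eq_Rintegral => x _; rewrite fE; case: ifP => _ //; rewrite mul0r.
  have -> : \int[mu]_x (Num.max (f x) 0 * th' x) = I (fun x => f x * th' x).
    apply: eq_Rintegral => x _; rewrite -fE; case: ifPn => [f0|]; first by rewrite max_l// ltW.
    by rewrite -leNgt => f0; rewrite max_r// mul0r.
  by apply => x; rewrite fE => /H[].
rewrite (bigD1 i0)//= -[leRHS]addr0 lerD//.
  (* The calibration in the direction [i0]: the two integrands differ by the half square of
     [dv - th * s (v)]. *)
  apply: (@le_trans _ _ (I (fun x => f' x * th x - th x * th x * D x))).
    apply: (I_le) => [||x vx].
    - by apply: (cD); [exact: c2|apply: (cN); exact: c2].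
    - apply: (cD); [exact: cM|apply: (cN); apply: (cM) => //; exact: cM].
    rewrite Ei0 /f' /D Ei0 -subr_ge0.
    have -> : (s (phi x) * (s (phi x) * th x) - s (v x) * dv i0 x) * th x -
      th x * th x * (2^-1 * (s (phi x) ^+ 2 - s (v x) ^+ 2)) -
      (2^-1 * (s (phi x) * th x) ^+ 2 - 2^-1 * dv i0 x ^+ 2) = 2^-1 * (dv i0 x - th x * s (v x)) ^+ 2.
      by field.
    by rewrite mulr_ge0 ?sqr_ge0.
  rewrite ID; [|exact: cM|by apply: (cN); apply: (cM) => //; exact: cM].
  rewrite IN; last by apply: (cM) => //; exact: cM.
  (* What remains is pointwise: [th'] and [th ^ 2] are at least 1 and multiply nonnegative terms,
     [f] by the slope of [S] and [D] by monotonicity of [s]. *)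
  rewrite IBP -opprD lerN2 -ID; [|exact: cM|by apply: (cM) => //; exact: cM].
  apply: (I_le) => [||x vx].
  - by apply: (cD) => //; exact: (cM _ _ (cC s0)).
  - by apply: (cD); [exact: cM|apply: (cM) => //; exact: cM].
  have [_ t1 t1'] := H x vx.
  apply: lerD.
    apply: (@le_trans _ _ (f x)); first exact: (derive_ge_increment dS s0s (ltW vx)).
    by rewrite ler_peMr// ltW// fE.
  rewrite ler_peMl//; last by rewrite -[1]mulr1 ler_pM.
  rewrite /D mulr_ge0// subr_ge0 ler_pXn2r ?nnegrE ?(le_trans (ltW s00))//.
  exact/sm/ltW.
apply: sumr_le0 => i ii0; apply: (@le_trans _ _ (I (fun=> 0))).
  apply: (I_le) => [|//|x _]; first by apply: (cD); [exact: c2|apply: (cN); exact: c2].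
  by rewrite Ei// expr0n/= mulr0 sub0r oppr_le0 mulr_ge0// sqr_ge0.
by rewrite /I; under eq_Rintegral do rewrite if_same; rewrite /Rintegral integral0.
Qed.

End calibration.

(** * The comparison at a fixed regularization level *)

Section key_estimate.
Context {R : realType} {n : nat}.
Local Notation mu := (@lebesgue_rV R n).
Local Notation Rn := 'rV[R]_n.

Lemma gap_bound (a A B w1 w2 w3 : R) (b1 b2 : bool) : 0 <= a <= A ->
  0 <= w1 <= B -> 0 <= w2 <= B -> 0 <= w3 <= B ->
  `|a + (if b1 then w1 - w2 else 0) - (if b2 then w3 - w2 else 0)| <= A + 2 * B.
Proof. by rewrite ler_norml; case: b1; case: b2; lra. Qed.

Lemma pos_part_le (x a : R) : 0 <= a -> x <= a -> Num.max x 0 <= a.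
Proof. by move=> a0 xa; rewrite ge_max xa. Qed.

(* The margin [3 * e] between [phi] and [p] absorbs the mollification errors on
   the potential energy side, where [Wb] may jump. *)
Lemma level_comparison (U : set Rn) (u p phi : Rn -> R) (dphi : 'I_n -> Rn -> R) (i0 : 'I_n)
    (th th' : Rn -> R) (s S W Wb : R -> R) (q delta e r M s0 c B : R) :
  open U -> (mu U < +oo)%E -> U `<=` cube M -> W12 U u ->
  (forall x, U x -> `|u x| <= q) -> 0 < r -> 0 <= q -> delta <= q -> 0 < e ->
  (forall xi, test_function U xi -> (forall x, U x -> `|u x + xi x| <= q) ->
    (energy W U u <= energy W U (u \+ xi)%R)%E) ->
  {homo Wb : a b / a <= b} -> (forall t, 0 <= Wb t <= B) ->
  (forall t, `|t| <= q -> W t = Wb `|t|) ->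
  (forall x i, is_derive x 'e_i phi (dphi i x)) -> continuous phi -> (forall i, continuous (dphi i)) ->
  (forall x, phi x < delta) ->
  (forall x y : Rn, U x -> u x <= delta -> (forall i, `|x ord0 i - y ord0 i| < 3 * r) -> U y) ->
  (forall x y : Rn, U x -> U y -> (forall i, `|x ord0 i - y ord0 i| < r) -> `|u x - u y| <= e) ->
  (forall x y : Rn, (forall i, `|x ord0 i - y ord0 i| < r) -> `|phi x - phi y| <= e) ->
  (forall x, is_derive x 'e_i0 th (th' x)) -> continuous th -> continuous th' ->
  (forall t : R, is_derive t 1 S (s t)) -> continuous s -> {homo s : a b / a <= b} ->
  0 < s0 -> (forall t, s0 <= s t) ->
  (forall t, 2 * Wb (t - 2 * e) + c <= s t ^+ 2 <= 2 * Wb (t - e) + c) ->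
  (forall x, dphi i0 x = s (phi x) * th x) -> (forall i x, i != i0 -> dphi i x = 0) ->
  (forall x, U x -> 1 <= th x /\ 1 <= th' x) ->
  continuous p -> (forall x, phi x + 3 * e <= p x <= q) ->
  let gap x := s0 * Num.max (phi x - u x - e) 0
    + (if u x + e < phi x then Wb (phi x - 2 * e) - Wb (u x) else 0)
    - (if u x < p x then Wb (p x) - Wb (u x) else 0) in
  measurable_fun U gap /\ \int[mu]_(x in U) gap x <= 0.
Proof.
move=> oU Ufin UM Wu uq r0 q0 dq e0 umin Wbm WbB WE dphiE cphi cdphi phid KU ue phie.
move=> dth cth cth' dS cs sm s00 s0s sW Ei0 Ei HU cp pphi gap.
have mU := open_measurable_rV oU.
have [v [dv [xi [[dvE [cv cdv]] txi [xi0 xile] [vU vu] H]]]] :=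
  mollified_competitor oU Ufin UM Wu uq r0 q0 dq dphiE cphi cdphi phid KU ue phie.
have [mu_ _] := Wu.1.
have mWb : measurable_fun [set: R] Wb by exact: nondecreasing_measurable.
pose ut := u \_ U.
have mut : measurable_fun [set: Rn] ut by have [h _] := measurable_restrictT u mU; exact: h.
have utE x : U x -> ut x = u x by move=> Ux; rewrite /ut patchE mem_set.
have mphi := continuous_measurable_rV cphi.
have mp := continuous_measurable_rV cp.
have bxi := test_function_bms txi; have [mxi _] := bxi.
have Bge0 : 0 <= B by have /andP[] := WbB 0; exact: le_trans.
have mgap : measurable_fun U gap.
  pose gt x := s0 * Num.max (phi x - ut x - e) 0
    + (if ut x + e < phi x then Wb (phi x - 2 * e) - Wb (ut x) else 0)
    - (if ut x < p x then Wb (p x) - Wb (ut x) else 0).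
  have : measurable_fun U gt.
    apply: measurable_funTS; apply: measurable_funB; first apply: measurable_funD.
    - apply: measurable_funM => //; apply: measurable_maxr => //.
      by apply: measurable_funB => //; exact: measurable_funB.
    - apply: measurable_fun_ifT => //.
        by apply: measurable_fun_ltr => //; exact: measurable_funD.
      apply: measurable_funB; last exact: measurableT_comp.
      by apply: measurableT_comp => //; exact: measurable_funB.
    - apply: measurable_fun_ifT => //; first exact: measurable_fun_ltr.
      by apply: measurable_funB; exact: measurableT_comp.
  apply: eq_measurable_fun => x; rewrite inE => Ux; by rewrite /gt /gap utE.
split=> //.
(* As [phi + 3 * e <= p], the bound on [xi] gives [xi <= max (p - u) 0]: the competitor lies between
   [u] and [max u p], hence within [[- q, q]]. *)
have uxiq x : U x -> `|u x + xi x| <= q.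
  move=> Ux; have := uq x Ux; have := xile x Ux; have := xi0 x; have := pphi x.
  by rewrite !ler_norml maxEle; case: ifPn => [h|]; [|rewrite -ltNge => h]; lra.
have mW (f : Rn -> R) : measurable_fun U f -> (forall x, U x -> `|f x| <= q) -> measurable_fun U (W \o f).
  move=> mf fq; apply: (@eq_measurable_fun _ _ _ _ _ (fun x => Wb `|f x|)).
    by move=> x; rewrite inE => Ux /=; rewrite WE// fq.
  by apply: measurableT_comp => //; exact: measurableT_comp.
have mWu := mW _ mu_ uq.
have mWx : measurable_fun U (W \o (u \+ xi)%R).
  by apply: mW => //; apply: measurable_funD => //; exact: measurable_funTS.
have W0B (f : Rn -> R) x : U x -> `|f x| <= q -> 0 <= W (f x) <= B by move=> Ux fq; rewrite WE.
have W0Bu x : U x -> 0 <= W (u x) <= B by move=> Ux; rewrite W0B// uq.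
have W0Bx x : U x -> 0 <= W (u x + xi x) <= B.
  by move=> Ux; apply: (W0B (u \+ xi)%R) => //=; exact: uxiq.
have E1 := energy_comparison oU Ufin Wu txi mWu mWx W0Bu W0Bx (umin xi txi uxiq).
have th1 x : v x < phi x -> [/\ cube M x, 1 <= th x & 1 <= th' x].
  by move=> /vU Ux; have [] := HU x Ux; split=> //; exact: UM.
have := calibrated_energy_le dphiE cphi cdphi dvE cv cdv dth cth cth' dS cs sm s00 s0s Ei0 Ei th1.
set A := fun x : Rn => if v x < phi x then _ else _.
move=> /(le_trans H)/(le_trans E1) {H E1}E.
have sE a b : a <= b -> s a ^+ 2 <= s b ^+ 2.
  by move=> ab; rewrite ler_pXn2r ?nnegrE ?(le_trans (ltW s00))//; exact: sm.
have bA : bms A.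
  have -> : A = fun x => if 0 < phi x - v x then s0 * (phi x - v x) + 2^-1 * (s (phi x) ^+ 2 - s (v x) ^+ 2) else 0.
    by apply/funext => x; rewrite /A subr_gt0.
  have [csphi csv] := (continuous_rV_comp cphi cs, continuous_rV_comp cv cs).
  have cf : continuous (fun x : Rn => phi x - v x) by move=> x; exact: (cvgB (cphi x) (cv x)).
  apply: (@bms_pos_restrict _ _ _ _ M cf) => [x|x]; last by rewrite subr_gt0 => /th1[].
  apply: (@cvgD _ _ _ (nbhs x) _ (fun x => s0 * (phi x - v x))).
    exact: (cvgM (cvg_cst s0) (cf x)).
  apply: (@cvgM _ _ (nbhs x) _ (fun=> 2^-1)); first exact: cvg_cst.
  exact: (cvgB (cvgM (csphi x) (csphi x)) (cvgM (csv x) (csv x))).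
have iA : mu.-integrable U (EFin \o A) by apply: integrableS (bms_integrable bA).
have AU : \int[mu]_x A x = \int[mu]_(x in U) A x.
  rewrite [RHS]Rintegral_mkcond; apply: eq_Rintegral => x _; rewrite patchE /A.
  by case: ifPn => [/vU Ux|_]; [rewrite mem_set|case: ifP].
pose D x := W (u x) - W (u x + xi x).
have iD : mu.-integrable U (EFin \o D).
  apply: (@bounded_measurable_integrable _ _ _ _ (B + B)) => //; first exact: measurable_funB.
  by move=> x Ux; have := W0Bu x Ux; have := W0Bx x Ux; rewrite /D ler_norml; lra.
have phiu x : U x -> 0 <= Num.max (phi x - u x - e) 0 <= `|delta| + q.
  move=> Ux; have := uq x Ux; have := phid x; have := ler_norm delta; have := normr_ge0 delta.
  by rewrite ler_norml maxEle; case: ifPn => [h|]; [|rewrite -ltNge => h]; lra.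
have igap : mu.-integrable U (EFin \o gap).
  apply: (@bounded_measurable_integrable _ _ _ _ (s0 * (`|delta| + q) + 2 * B)) => // x Ux.
  have /andP[l1 l2] := phiu x Ux.
  have l3 : s0 * Num.max (phi x - u x - e) 0 <= s0 * (`|delta| + q) by rewrite ler_wpM2l// ltW.
  have l4 : 0 <= s0 * Num.max (phi x - u x - e) 0 by rewrite mulr_ge0// ltW.
  by apply: gap_bound; rewrite ?l3 ?l4.
(* Minimality bounds the integral of [D] by the gradient terms and the calibration bounds these by
   minus the integral of [A]. It remains to see that [gap <= A + D] pointwise. *)
apply: (@le_trans _ _ (\int[mu]_(x in U) (A x + D x))); last first.
  by rewrite RintegralD// -AU; move: E; rewrite -/(D); lra.
apply: le_Rintegral => //.
  by rewrite /comp; under eq_fun do rewrite EFinD; exact: integrableD.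
move=> x Ux; rewrite /gap; apply: lerD.
  rewrite /A; case: (ltP (u x + e) (phi x)) => up.
    have ud : u x <= delta by have := phid x; lra.
    have := vu x Ux ud; rewrite ler_norml => vue.
    have -> : v x < phi x by lra.
    rewrite max_l; last by lra.
    (* As [v <= u + e], the delay in [s] gives [s (v) ^ 2 <= 2 * Wb (u) + c], while
       [s (phi) ^ 2 >= 2 * Wb (phi - 2 * e) + c]; the constant [c] cancels. *)
    have := sW (phi x); have := sW (v x); have : Wb (v x - e) <= Wb (u x) by apply: Wbm; lra.
    have : s0 * (phi x - u x - e) <= s0 * (phi x - v x) by apply: ler_wpM2l; [exact: ltW|lra].
    by lra.
  rewrite max_r; last by lra.
  rewrite mulr0 addr0; case: ifPn => // vx; apply: addr_ge0.
    by rewrite mulr_ge0 ?subr_ge0 ?ltW.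
  by rewrite mulr_ge0// subr_ge0; apply: sE; exact: ltW.
rewrite /D lerNl opprB.
have pq : `|u x| <= q := uq x Ux; have xq := uxiq x Ux; rewrite !WE//.
have xle := xile x Ux; have x0 := xi0 x; have /andP[pp _] := pphi x.
have uu : Wb (u x) <= Wb `|u x| by apply: Wbm; exact: ler_norm.
case: ifPn => up.
  have pu : Wb (u x) <= Wb (p x) by apply: Wbm; exact: ltW.
  (* Where [u + xi] is nonpositive, adding [xi] has decreased the absolute value, so the potential
     has not increased; otherwise [u + xi <= p] applies. *)
  have [ux|ux] := leP (u x + xi x) 0.
    have w : Wb `|u x + xi x| <= Wb `|u x|.
      by apply: Wbm; rewrite !ler0_norm// ?lerN2 ?lerDl// (le_trans _ ux)// lerDl.
    by apply: (@le_trans _ _ 0); rewrite ?subr_ge0// subr_le0.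
  have w : Wb `|u x + xi x| <= Wb (p x).
    apply: Wbm; rewrite gtr0_norm// -lerBrDl; apply: le_trans xle _.
    by rewrite pos_part_le ?subr_ge0 ?(ltW up)//; lra.
  exact: lerB.
have -> : xi x = 0.
  apply/eqP; rewrite eq_le x0 andbT; apply: le_trans xle _; rewrite pos_part_le//.
  by move: up pp; rewrite -leNgt; clear; lra.
by rewrite addr0 subrr.
Qed.

End key_estimate.

(** * Regularization of the flow of sqrt (2 W + c) *)

Section primitive.
Context {R : realType}.
Local Notation leb := (@lebesgue_measure R).
Implicit Types (f g : R -> R) (c K t e : R).

Definition tame c K f := [/\ measurable_fun [set: R] f, (forall t, t <= 0 -> f t = c) &
  forall t, `|f t| <= K].

(* [prim c f] is the primitive of [f] vanishing at 0 when [f] equals [c] on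
   the negative half-line; this gives primitives on the whole line. *)
Definition prim c f t := c * t + \int[leb]_(x in `]-oo, t]) (f x - c).

Lemma lebesgue_itv_fin (a b : R) : (leb `[a, b] < +oo)%E.
Proof. by rewrite lebesgue_measure_itv/=; case: ifP => _; rewrite ?ltry// -EFinB ltry. Qed.

Lemma lebesgue_itvoc (a b : R) : a <= b -> leb `]a, b] = (b - a)%:E.
Proof.
rewrite lebesgue_measure_itv/= lte_fin le_eqVlt => /predU1P[->|->]; last by rewrite EFinB.
by rewrite ltxx subrr.
Qed.

Lemma bounded_integrable_itvoc f K (a b : R) : a <= b -> measurable_fun [set: R] f ->
  (forall t, `|f t| <= K) -> leb.-integrable `]a, b] (EFin \o f).
Proof.
move=> ab mf fK; apply: measurable_bounded_integrable => //; first 2 last.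
- by exists K; split; [exact: num_real|move=> N KN x _ /=; apply: le_trans (ltW KN)].
- by have := lebesgue_itvoc ab; rewrite /= => ->; exact: ltry.
- exact: measurable_funTS.
Qed.

Lemma tame_integrable c K f t : tame c K f -> leb.-integrable `]-oo, t] (EFin \o (fun x => f x - c)).
Proof.
move=> [mf f0 fK].
have H : leb.-integrable `[0, t] (EFin \o (fun x => f x - c)).
  apply: measurable_bounded_integrable => //.
  - exact: lebesgue_itv_fin.
  - by apply: measurable_funTS; apply: measurable_funB.
  - exists (K + `|c|); split; first exact: num_real.
    move=> N KN x _ /=; apply: le_trans (ltW KN).
    by rewrite (le_trans (ler_normB _ _))// lerD2r.
apply/(integrable_mkcond _ _).2 => //.
apply: eq_integrable ((integrable_mkcond _ _).1 H) => // x _.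
rewrite !patchE; case: ifPn; case: ifPn => //; rewrite ?inE/= !in_itv/=.
  by rewrite notin_setE/= in_itv/= => /negP xt /andP[_]; rewrite (negbTE xt).
by move=> xt; rewrite notin_setE/= in_itv/= xt andbT => /negP; rewrite -ltNge => /ltW/f0 ->; rewrite subrr.
Qed.

Lemma prim_incr c K f (a b : R) : tame c K f -> a <= b ->
  prim c f b - prim c f a = \int[leb]_(x in `]a, b]) f x.
Proof.
move=> tf ab; have [mf f0 fK] := tf.
have := @Rintegral_itvB R (fun x => f x - c) -oo%O (BRight b) a (tame_integrable b tf) isT.
rewrite bnd_simp => /(_ ab) E.
have iff := bounded_integrable_itvoc ab mf fK.
have icc : leb.-integrable `]a, b] (EFin \o fun=> c) by apply: (@bounded_integrable_itvoc _ `|c|).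
move: E; rewrite [in RHS]RintegralB// [in RHS]Rintegral_cst//.
rewrite (_ : fine _ = b - a); last exact: (congr1 fine (lebesgue_itvoc ab)).
by rewrite /prim; lra.
Qed.

Lemma prim_incr_bounds c K f (a b l h : R) : tame c K f -> a <= b ->
  (forall t, a < t <= b -> l <= f t <= h) ->
  l * (b - a) <= prim c f b - prim c f a <= h * (b - a).
Proof.
move=> tf ab lfh; have [mf f0 fK] := tf.
rewrite (prim_incr tf ab).
have iff := bounded_integrable_itvoc ab mf fK.
have icc (d : R) : leb.-integrable `]a, b] (EFin \o fun=> d) by apply: (@bounded_integrable_itvoc _ `|d|).
have cst (d : R) : \int[leb]_(x in `]a, b]) d = d * (b - a).
  by rewrite Rintegral_cst//; congr (_ * _); exact: (congr1 fine (lebesgue_itvoc ab)).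
rewrite -!cst; apply/andP; split; apply: le_Rintegral => // x;
  by rewrite /= in_itv/= => /lfh/andP[].
Qed.

Lemma prim_le c K f g t : tame c K f -> tame c K g -> (forall x, f x <= g x) ->
  prim c f t <= prim c g t.
Proof.
move=> tf tg fg; rewrite /prim lerD2l; apply: le_Rintegral => //.
- exact: tame_integrable tf.
- exact: tame_integrable tg.
- by move=> x _; rewrite lerD2r.
Qed.

Lemma prim_le0 c K f t : tame c K f -> t <= 0 -> prim c f t = c * t.
Proof.
move=> [_ f0 _] t0; rewrite /prim (_ : Rintegral _ _ _ = 0) ?addr0//.
rewrite /Rintegral integral0_eq// => x; rewrite /= in_itv/= => xt.
by rewrite f0 ?subrr// (le_trans xt).
Qed.

Lemma tame_shift c K f e : 0 <= e -> tame c K f -> tame c K (fun x => f (x - e)).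
Proof.
move=> e0 [mf f0 fK]; split => //.
- by apply: (@measurableT_comp _ _ _ _ _ _ f _ (fun x : R => x - e)) => //; exact: measurable_funB.
- by move=> t t0; rewrite f0// subr_le0 (le_trans t0).
Qed.

Lemma prim_shift c K f t e : 0 <= e -> tame c K f -> (forall x, f x <= c) ->
  prim c (fun x => f (x - e)) t = prim c f (t - e) + c * e.
Proof.
move=> e0 tf fc; have [mf f0 fK] := tf.
(* Translation invariance is at hand for nonnegative functions, hence the sign [c - f]; the cut-off
   moves together with the shift. *)
pose h x := if x <= t - e then c - f x else 0.
have mh : measurable_fun [set: R] h.
  apply: measurable_fun_ifT => //; last exact: measurable_funB.
  exact: measurable_fun_ler.
have h0 x : 0 <= h x by rewrite /h; case: ifP => // _; rewrite subr_ge0.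
have E : \int[leb]_x h (x - e) = \int[leb]_x h x by rewrite /Rintegral integral_shift.
have H g s : tame c K g -> \int[leb]_(x in `]-oo, s]) (g x - c) = - \int[leb]_x (if x <= s then c - g x else 0).
  move=> tg; have -> : \int[leb]_x (if x <= s then c - g x else 0) = \int[leb]_(x in `]-oo, s]) (-1 * (g x - c)).
    rewrite [RHS]Rintegral_mkcond; apply: eq_Rintegral => x _; rewrite patchE mulN1r opprB.
    by case: ifPn => xs; [rewrite mem_set//= in_itv|rewrite memNset//= in_itv/=; exact/negP].
  by rewrite RintegralZl//; [rewrite mulN1r opprK|exact: tame_integrable tg].
rewrite /prim (H _ _ (tame_shift e0 tf)) (H f _ tf) -/h; have -> : (fun x => if x <= t then c - f (x - e) else 0) = (fun x => h (x - e)).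
  by apply/funext => x; rewrite /h lerD2r.
by rewrite E; ring.
Qed.

Lemma is_derive_prim c K f (t : R) : tame c K f -> continuous f -> is_derive t 1 (prim c f) (f t).
Proof.
move=> tf cf.
have t1 : t < t + 1 by rewrite ltrDl.
have cg : {for t, continuous (fun x : R => f x - c)}.
  by exact: (cvgB (cf t) (@cvg_cst _ c _ (nbhs t) _)).
have [dF EF] := continuous_FTC1 t1 (tame_integrable (t + 1) tf) (ltNyr t : (-oo%O < BRight t)%E) cg.
have D : is_derive t 1 (fun x : R => \int[leb]_(y in `]-oo, x]) (f y - c)) (f t - c).
  by apply: DeriveDef; [exact: dF|rewrite -derive1E].
have D1 : is_derive t 1 (fun x : R => c * x) c.
  by have := is_deriveM (is_derive_cst c t 1) (is_derive_id t (1 : R)); rewrite scaler0 addr0 /GRing.scale/= mulr1.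
by apply: is_derive_eq (is_deriveD D1 D) _; rewrite addrC subrK.
Qed.

End primitive.

(** * Flows as inverse functions, and Lipschitz regularization *)

Section flow.
Context {R : realType}.
Implicit Types (F f g sigma : R -> R).

(** To be applied to travel-time functions, whose inverses are flows. This needs no existence
    theorem for differential equations and tolerates discontinuous fields. *)
Lemma bilipschitz_inverse F (l h : R) : 0 < l ->
  (forall a b, a <= b -> l * (b - a) <= F b - F a <= h * (b - a)) ->
  exists G : R -> R, [/\ cancel F G, cancel G F, {homo G : a b / a <= b} &
    forall y z, y <= z -> G z - G y <= l^-1 * (z - y)].
Proof.
move=> l0 Flh.
have Fmono : {mono F : a b / a <= b}.
  apply: le_mono => a b ab; have /andP[+ _] := Flh a b (ltW ab).
  by rewrite -subr_gt0; apply: lt_le_trans; rewrite mulr_gt0// subr_gt0.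
have h0 : 0 <= h by have := Flh 0 1 ler01; rewrite subr0 !mulr1; lra.
have cF : continuous F.
  apply: (@lipschitz_continuous _ _ F h h0) => x y.
  wlog xy : x y / x <= y.
    by move=> H; have [/H//|/ltW/H] := leP x y; rewrite distrC (distrC y).
  have /andP[H1 H2] := Flh x y xy; rewrite distrC (distrC x) [`|y - x|]ger0_norm ?subr_ge0//.
  by rewrite ger0_norm// subr_ge0 Fmono.
have surj y : exists t, F t = y.
  (* With slope at least [l], a distance [b] on either side of 0 changes [F] by at least the gap
     between [F 0] and [y], so the intermediate value theorem applies on [[- b, b]]. *)
  have [b b0 lb] : exists2 b : R, 0 <= b & l * b = `|F 0 - y|.
    by exists (`|F 0 - y| / l); [rewrite divr_ge0// ltW|rewrite mulrC divfK// gt_eqF].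
  have /andP[H1 _] := Flh 0 b b0.
  have /andP[H2 _] : l * (0 - - b) <= F 0 - F (- b) <= h * (0 - - b) by apply: Flh; rewrite oppr_le0.
  have [|||t _ Ft] := @IVT _ F (- b) b y; last by exists t.
  - by lra.
  - exact: continuous_subspaceT.
  - move: H1 H2; rewrite subr0 sub0r opprK lb => H1 H2.
    have := ler_norm (F 0 - y); have := ler_norm (- (F 0 - y)); rewrite normrN => n1 n2.
    by rewrite ge_min le_max; apply/andP; split; apply/orP; [left|right]; lra.
have [G GF] := choice surj.
have FG : cancel F G.
  by move=> t; apply: (inc_inj Fmono); exact: GF.
exists G; split => // [y z yz|y z yz]; first by rewrite -(Fmono (G y)) !GF.
have Gyz : G y <= G z by rewrite -(Fmono (G y)) !GF.
have /andP[H _] := Flh _ _ Gyz.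
by rewrite -(ler_pM2l l0) mulrA divff ?gt_eqF// mul1r -{2}(GF z) -{2}(GF y).
Qed.

Lemma is_derive_bilipschitz_inverse F G f (l : R) (y : R) : cancel F G -> cancel G F ->
  (forall t : R, is_derive t 1 F (f t)) -> 0 < l -> (forall t, l <= f t) ->
  is_derive y 1 G (f (G y))^-1.
Proof.
move=> FG GF dF l0 lf; rewrite -{1}(GF y).
apply: (@is_derive_inverse R F G) => //; last by rewrite gt_eqF// (lt_le_trans l0).
- by near=> t; exact: FG.
- near=> t; apply: differentiable_continuous.
  by apply/derivable1_diffP; have [] := dF t.
Unshelve. all: by end_near. Qed.

(* The largest [L]-Lipschitz function below a nondecreasing [sigma]. *)
Definition infconv sigma (L t : R) := inf [set sigma (t - h) + L * h | h in [set h | 0 <= h]].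

Section infconv.
Context (sigma : R -> R) (L lo hi : R) (L0 : 0 <= L) (lo_sigma : forall t, lo <= sigma t)
  (sigma_hi : forall t, sigma t <= hi) (sigma_nd : {homo sigma : a b / a <= b}).

Lemma infconv_lb t : has_lbound [set sigma (t - h) + L * h | h in [set h | 0 <= h]].
Proof. by exists lo => _ [h h0 <-]; rewrite (le_trans (lo_sigma (t - h)))// lerDl mulr_ge0. Qed.

Lemma infconv_le t h : 0 <= h -> infconv sigma L t <= sigma (t - h) + L * h.
Proof. by move=> h0; apply: ge_inf; [exact: infconv_lb|exists h]. Qed.

Lemma infconv_ge t (c : R) : (forall h, 0 <= h -> c <= sigma (t - h) + L * h) -> c <= infconv sigma L t.
Proof.
move=> H; apply: lb_le_inf; last by move=> _ [h h0 <-]; exact: H.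
by exists (sigma (t - 0) + L * 0); exists 0 => //=.
Qed.

Lemma infconv_upper t : infconv sigma L t <= sigma t.
Proof. by have := infconv_le t (lexx 0); rewrite subr0 mulr0 addr0. Qed.

(** A competitor [h > e] pays at least [L * e >= hi - lo], the full oscillation of [sigma]; for
    [h <= e] monotonicity suffices. *)
Lemma infconv_lower t e : 0 <= e -> hi - lo <= L * e -> sigma (t - e) <= infconv sigma L t.
Proof.
move=> e0 Le; apply: infconv_ge => h h0; have [he|eh] := leP h e.
  apply: (@le_trans _ _ (sigma (t - h))); first by apply: sigma_nd; rewrite lerD2l lerN2.
  by rewrite lerDl mulr_ge0.
have := sigma_hi (t - e); have := lo_sigma (t - h).
have : L * e <= L * h by rewrite ler_wpM2l// ltW.
by lra.
Qed.

Lemma infconv_nd : {homo infconv sigma L : a b / a <= b}.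
Proof.
move=> a b ab; apply: infconv_ge => h h0; apply: le_trans (infconv_le a h0) _.
by rewrite lerD2r; apply: sigma_nd; rewrite lerD2r.
Qed.

Lemma infconv_continuous : continuous (infconv sigma L).
Proof.
apply: (@lipschitz_continuous _ _ _ L L0) => x y.
wlog xy : x y / x <= y.
  by move=> H; have [/H//|/ltW/H] := leP x y; rewrite distrC (distrC y).
rewrite distrC (distrC x) !ger0_norm ?subr_ge0//; last exact: infconv_nd.
rewrite lerBlDr -lerBlDl; apply: infconv_ge => h h0.
have := @infconv_le y (h + (y - x)); rewrite addr_ge0 ?subr_ge0// => /(_ isT).
have -> : y - (h + (y - x)) = x - h by ring.
by lra.
Qed.

Lemma infconv_const t : (forall x, x <= 0 -> sigma x = lo) -> t <= 0 -> infconv sigma L t = lo.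
Proof.
move=> s0 t0; apply/eqP; rewrite eq_le -{1}(s0 t t0) infconv_upper/=.
by apply: infconv_ge => h h0; rewrite (le_trans (lo_sigma (t - h)))// lerDl mulr_ge0.
Qed.

End infconv.

End flow.

Section regularized_flow.
Context {R : realType}.

Lemma tame_inv (f : R -> R) (lo : R) : 0 < lo -> {homo f : a b / a <= b} ->
  (forall t, lo <= f t) -> (forall t, t <= 0 -> f t = lo) ->
  tame lo^-1 lo^-1 (fun t => (f t)^-1).
Proof.
move=> lo0 fm lof f0; have fp t : 0 < f t by exact: lt_le_trans (lof t).
split => [|t /f0 ->//|t]; last first.
  by rewrite ger0_norm ?lef_pV2 ?posrE// invr_ge0 ltW.
by apply: nonincreasing_measurable => // a b ab; rewrite lef_pV2 ?posrE// fm.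
Qed.

(* [tau] is the flow of the (possibly discontinuous) field [sqrt (2 Wb + c)], and
   [g] the flow of a continuous regularization [s] delayed so as to stay below. *)
Lemma regularized_flow (Wb : R -> R) (c B : R) :
  {homo Wb : a b / a <= b} -> (forall t, 0 <= Wb t <= B) -> (forall t, t <= 0 -> Wb t = 0) -> 0 < c ->
  exists (tau : R -> R) (C : R), [/\ 0 < C,
    (forall y, 0 < y -> 0 < tau y),
    (forall y t, y <= prim (Num.sqrt c)^-1 (fun t => (Num.sqrt (2 * Wb t + c))^-1) t -> tau y <= t),
    (forall y z, y <= z -> 0 <= tau z - tau y <= C * (z - y)) &
    forall e, 0 < e -> exists s S g : R -> R,
      [/\ (forall t : R, is_derive t 1 S (s t)) /\ continuous s,
          {homo s : a b / a <= b} /\ (forall t, Num.sqrt c <= s t),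
          (forall t, 2 * Wb (t - 2 * e) + c <= s t ^+ 2 <= 2 * Wb (t - e) + c),
          (forall y : R, is_derive y 1 g (s (g y))) /\ (forall y z, y <= z -> 0 <= g z - g y <= C * (z - y)) &
          forall y, g y + 3 * e <= tau y <= g y + C * e]].
Proof.
move=> Wm WB W0 c0.
pose sigma t := Num.sqrt (2 * Wb t + c); pose lo := Num.sqrt c; pose hi := Num.sqrt (2 * B + c).
have lo0 : 0 < lo by rewrite sqrtr_gt0.
have W_ge0 t : 0 <= Wb t by case/andP: (WB t).
have losigma t : lo <= sigma t by rewrite ler_wsqrtr// lerDr mulr_ge0.
have sigmahi t : sigma t <= hi by rewrite ler_wsqrtr// lerD2r ler_pM2l//; case/andP: (WB t).
have sigmam : {homo sigma : a b / a <= b}.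
  by move=> a b ab; rewrite ler_wsqrtr// lerD2r ler_pM2l// Wm.
have sigma0 t : t <= 0 -> sigma t = lo by move=> t0; rewrite /sigma W0// mulr0 add0r.
have lohi : lo <= hi := le_trans (losigma 0) (sigmahi 0).
have hi0 : 0 < hi := lt_le_trans lo0 lohi.
have sigma2 t : sigma t ^+ 2 = 2 * Wb t + c by rewrite sqr_sqrtr// addr_ge0 ?mulr_ge0// ltW.
have bilip (f : R -> R) : tame lo^-1 lo^-1 (fun t => (f t)^-1) -> (forall t, lo <= f t <= hi) ->
    forall a b, a <= b ->
    hi^-1 * (b - a) <= prim lo^-1 (fun t => (f t)^-1) b - prim lo^-1 (fun t => (f t)^-1) a <= lo^-1 * (b - a).
  move=> tf lofhi a b ab; apply: (prim_incr_bounds tf ab) => t _; have /andP[l h] := lofhi t.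
  by rewrite !lef_pV2 ?posrE ?l ?h// (lt_le_trans lo0).
(* [T t] is the time at which the flow starting from 0 reaches [t]; [tau] is its inverse. *)
pose T := prim lo^-1 (fun t => (sigma t)^-1).
have tsigma : tame lo^-1 lo^-1 (fun t => (sigma t)^-1).
  by exact: tame_inv.
have TB : forall a b, a <= b -> hi^-1 * (b - a) <= T b - T a <= lo^-1 * (b - a).
  by apply: bilip => // t; rewrite losigma sigmahi.
have hiV0 : 0 < hi^-1 by rewrite invr_gt0.
have [tau [tauT Ttau taum tauL]] := bilipschitz_inverse hiV0 TB.
rewrite invrK in tauL.
(* [hi] is the Lipschitz constant of both flows. The other term is the speed [hi] times the total
   lag [5 * e / lo]: [2 * e / lo] from the delay of the field and [3 * e / lo] from the late
   start. *)
pose C := 5 * (hi / lo) + hi.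
have hl0 : 0 <= hi / lo by rewrite divr_ge0// ltW.
have hiC : hi <= C by rewrite /C lerDr mulr_ge0.
have C0 : 0 < C := lt_le_trans hi0 hiC.
exists tau, C; split => //.
- move=> y; rewrite -{1}(Ttau y); apply: contraTT; rewrite -!leNgt => ty.
  by rewrite /T (prim_le0 tsigma ty) pmulr_rle0// invr_gt0.
- by move=> y t /taum; rewrite -/(T t) tauT.
- move=> y z yz; rewrite subr_ge0 taum//=; apply: le_trans (tauL y z yz) _.
  by rewrite ler_wpM2r// subr_ge0.
(* This slope makes the infimal convolution lose at most one more delay [e]. Evaluated at [t - e],
   it therefore lies between [sigma (t - 2 * e)] and [sigma (t - e)]. *)
move=> e e0; pose L := (hi - lo) / e.
have L0 : 0 <= L by rewrite divr_ge0 ?subr_ge0// ltW.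
have Le : hi - lo <= L * e by rewrite divfK// gt_eqF.
pose s t := infconv sigma L (t - e).
have e0' := ltW e0.
have s_le t : s t <= sigma (t - e) by exact: infconv_upper L0 losigma _.
have s_ge t : sigma (t - 2 * e) <= s t.
  have -> : t - 2 * e = t - e - e by ring.
  exact: infconv_lower losigma sigmahi sigmam _ _ e0' Le.
have los t : lo <= s t := le_trans (losigma _) (s_ge t).
have shi t : s t <= hi := le_trans (s_le t) (sigmahi _).
have sp t : 0 < s t := lt_le_trans lo0 (los t).
have cs : continuous s.
  have ci : continuous (infconv sigma L) := infconv_continuous L0 losigma sigmam.
  by move=> t; apply: (@continuous_comp _ _ _ (fun t : R => t - e) _ t) (ci _); exact: (cvgB (@cvg_id _ (nbhs t)) (@cvg_cst _ e _ (nbhs t) _)).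
have sm : {homo s : a b / a <= b}.
  by move=> a b ab; apply: (infconv_nd L0 losigma sigmam); rewrite lerD2r.
have s0 t : t <= 0 -> s t = lo.
  move=> t0; apply: (infconv_const L0 losigma sigma0).
  by rewrite subr_le0 (le_trans t0).
have ms : measurable_fun [set: R] s by exact: nondecreasing_measurable.
have ts : tame lo hi s.
  by split=> // t; rewrite ger0_norm// ltW.
have tsV : tame lo^-1 lo^-1 (fun t => (s t)^-1) by exact: tame_inv.
pose P := prim lo^-1 (fun t => (s t)^-1).
(* The late start produces the margin [3 * e]: with the field [sigma], going from [g y - e] to
   [g y + 3 * e] takes at most [4 * e / lo], of which [e / lo] is already gained by the delay of the
   field. *)
pose Te t := P t + 3 * e * lo^-1.
have TeB a b : a <= b -> hi^-1 * (b - a) <= Te b - Te a <= lo^-1 * (b - a).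
  move=> ab; have -> : Te b - Te a = P b - P a by rewrite /Te; ring.
  by apply: bilip => // t; rewrite los shi.
have [g [gT Tg gm gL]] := bilipschitz_inverse hiV0 TeB.
rewrite invrK in gL.
have csV : continuous (fun t => (s t)^-1).
  by move=> t; apply: cvgV; [rewrite gt_eqF|exact: cs].
have dTe (t : R) : is_derive t 1 Te (s t)^-1.
  have H := is_deriveD (is_derive_prim t tsV csV) (is_derive_cst (3 * e * lo^-1) t 1).
  by apply: is_derive_eq H _; rewrite addr0.
exists s, (prim lo s), g; split => //.
- by split=> // t; exact: is_derive_prim ts cs.
- move=> t; rewrite -!sigma2 !ler_pXn2r ?nnegrE ?s_le ?s_ge//;
   by rewrite ?ltW// (lt_le_trans lo0).
- split=> [y|y z yz].
    rewrite -[s (g y)]invrK.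
    apply: (is_derive_bilipschitz_inverse _ gT Tg dTe hiV0) => t.
    by rewrite lef_pV2 ?posrE.
  rewrite subr_ge0 gm//=; apply: le_trans (gL y z yz) _.
  by rewrite ler_wpM2r// subr_ge0.
have siglo x : (sigma x)^-1 <= lo^-1 by rewrite lef_pV2 ?posrE// (lt_le_trans lo0).
(* Travel times decrease with the field, and [s] lies between [sigma] delayed by [2 * e] and by
   [e]. *)
have P_ge t : T (t - e) + lo^-1 * e <= P t.
  rewrite -(prim_shift t e0' tsigma siglo); apply: (prim_le _ (tame_shift e0' tsigma) tsV) => x.
  by rewrite lef_pV2 ?posrE// (lt_le_trans lo0).
have P_le t : P t <= T (t - 2 * e) + lo^-1 * (2 * e).
  have e20 : 0 <= 2 * e by rewrite mulr_ge0.
  rewrite -(prim_shift t e20 tsigma siglo); apply: (prim_le _ tsV (tame_shift e20 tsigma)) => x.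
  by rewrite lef_pV2 ?posrE// (lt_le_trans lo0).
move=> y; apply/andP; split.
  rewrite -(tauT (g y + 3 * e)); apply: taum; rewrite -[leRHS](Tg y) /Te.
  have gg : g y - e <= g y + 3 * e by lra.
  have /andP[_] := TB _ _ gg; have := P_ge (g y).
  have -> : g y + 3 * e - (g y - e) = 4 * e by ring.
  by lra.
have yT : y <= T (g y - 2 * e) + 5 * e * lo^-1.
  by rewrite -[leLHS](Tg y) /Te; have := P_le (g y); lra.
apply: (le_trans (taum _ _ yT)).
have : T (g y - 2 * e) <= T (g y - 2 * e) + 5 * e * lo^-1.
  by rewrite lerDl !mulr_ge0// invr_ge0 ltW.
move=> /tauL; rewrite tauT.
have -> : hi * (T (g y - 2 * e) + 5 * e / lo - T (g y - 2 * e)) = 5 * (hi / lo) * e by ring.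
have : 0 < hi * e by exact: mulr_gt0.
by rewrite /C; lra.
Qed.

End regularized_flow.

(** * Divergence of the travel time *)

Section flow_time.
Context {R : realType}.
Local Notation leb := (@lebesgue_measure R).

(** The inverse on the right is that of [\bar R], where the inverse of 0 is [+oo]; hence the
    separate case [a = 0]. *)
Lemma inv_sqrt_cvg (a : R) : 0 <= a ->
  ((Num.sqrt (a + k.+1%:R^-1))^-1)%:E @[k --> \oo] --> ((Num.sqrt a)%:E^-1)%E.
Proof.
move=> a0; rewrite inver sqrtr_eq0; case: ifPn => [a_le0|].
  have -> : a = 0 by apply/eqP; rewrite eq_le a_le0.
  apply/cvgeyPge => A; near=> k; rewrite lee_fin add0r sqrtrV ?invrK ?ler0n//.
  apply: (le_trans (ler_norm A)); rewrite -sqrtr_sqr ler_wsqrtr//.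
  apply: (@le_trans _ _ k%:R); last by rewrite ler_nat.
  by near: k; exact: nbhs_infty_ger.
rewrite -ltNge => a_gt0; apply: cvg_EFin; first by near=> k.
apply: cvgV; first by rewrite gt_eqF// sqrtr_gt0.
apply: (@continuous_cvg _ _ _ _ _ _ Num.sqrt); first exact: sqrt_continuous.
rewrite -[X in _ --> X]addr0; apply: cvgD; first exact: cvg_cst.
exact: cvg_harmonic.
Unshelve. all: by end_near. Qed.

(* As [c] tends to 0, the time needed to climb from 0 to [t0] tends to infinity:
   this is where the integral condition on the potential is used. *)
Lemma flow_time (Wb : R -> R) (B q t0 Lam : R) :
  {homo Wb : a b / a <= b} -> (forall t, 0 <= Wb t <= B) -> (forall t, t <= 0 -> Wb t = 0) ->
  0 < t0 -> t0 <= q ->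
  (\int[leb]_(s in `[0%R, q]) ((Num.sqrt (Wb s))%:E)^-1 = +oo)%E \/ (exists2 h, 0 < h & Wb h = 0) ->
  exists2 c, 0 < c & Lam <= prim (Num.sqrt c)^-1 (fun t => (Num.sqrt (2 * Wb t + c))^-1) t0.
Proof.
move=> Wm WB W0 t00 t0q hW.
have W_ge0 t : 0 <= Wb t by case/andP: (WB t).
have tame_sigma c : 0 < c -> tame (Num.sqrt c)^-1 (Num.sqrt c)^-1 (fun t => (Num.sqrt (2 * Wb t + c))^-1).
  move=> c0; apply: tame_inv; first by rewrite sqrtr_gt0.
  - by move=> a b ab; rewrite ler_wsqrtr// lerD2r ler_pM2l// Wm.
  - by move=> t; rewrite ler_wsqrtr// lerDr mulr_ge0.
  - by move=> t /W0 ->; rewrite mulr0 add0r.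
have incr c (a b : R) : 0 < c -> a <= b ->
    0 <= prim (Num.sqrt c)^-1 (fun t => (Num.sqrt (2 * Wb t + c))^-1) b
      - prim (Num.sqrt c)^-1 (fun t => (Num.sqrt (2 * Wb t + c))^-1) a <= (Num.sqrt (2 * Wb a + c))^-1 * (b - a).
  move=> c0 ab; rewrite -{1}(mul0r (b - a)); apply: (prim_incr_bounds (tame_sigma c c0) ab) => t /andP[at_ _].
  have s0 x : 0 < Num.sqrt (2 * Wb x + c) by rewrite sqrtr_gt0 ltr_wpDl// mulr_ge0.
  rewrite invr_ge0 ltW//= lef_pV2 ?posrE//.
  by rewrite ler_wsqrtr// lerD2r ler_pM2l// Wm// ltW.
have [[h h0 Wh]|Wt0] := pselect (exists2 h, 0 < h & Wb h = 0).
  pose m := Num.min h t0.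
  have m0 : 0 < m by rewrite lt_min h0.
  have Wm0 t : t <= m -> Wb t = 0.
    by move=> tm; apply/eqP; rewrite eq_le W_ge0 andbT -Wh Wm// (le_trans tm)// ge_min lexx.
  (* With [c = d ^ 2] and no potential up to [m], the flow has speed [d] there and needs the time
     [m / d = |Lam| + 1]. *)
  pose d := m / (`|Lam| + 1).
  have L0 : 0 < `|Lam| + 1 by rewrite ltr_wpDl.
  have d0 : 0 < d by rewrite divr_gt0.
  exists (d ^+ 2); first by rewrite exprn_gt0.
  rewrite sqrtr_sqr gtr0_norm//.
  have := incr (d ^+ 2) m t0 (exprn_gt0 _ d0); rewrite ge_min lexx orbT => /(_ isT).
  have := @prim_incr_bounds _ _ _ _ 0 m d^-1 d^-1 (tame_sigma _ (exprn_gt0 2 d0)) (ltW m0).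
  rewrite sqrtr_sqr gtr0_norm// => H.
  have {}H := H _; rewrite (_ : prim d^-1 _ 0 = 0) in H; last first.
    have := tame_sigma _ (exprn_gt0 2 d0); rewrite sqrtr_sqr gtr0_norm// => ts.
    by rewrite (prim_le0 ts)// mulr0.
  have /andP[+ _] : d^-1 * (m - 0) <= prim d^-1 (fun t => (Num.sqrt (2 * Wb t + d ^+ 2))^-1) m - 0 <= d^-1 * (m - 0).
    apply: H => t /andP[_ tm]; rewrite Wm0// mulr0 add0r sqrtr_sqr gtr0_norm// lexx//.
  have -> : d^-1 * (m - 0) = `|Lam| + 1.
    by rewrite subr0 /d invf_div mulrC mulrCA divff ?mulr1// gt_eqF.
  have := ler_norm Lam; lra.
have {hW} : (\int[leb]_(s in `[0%R, q]) ((Num.sqrt (Wb s))%:E)^-1 = +oo)%E by case: hW => // -[h h0 Wh]; case: Wt0; exists h.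
move=> hW.
have Wt00 : 0 < Wb t0.
  by rewrite lt_neqAle W_ge0 andbT eq_sym; apply/eqP => Wt; apply: Wt0; exists t0.
(* These increase with [k] to the integrand of the hypothesis, so monotone convergence sends their
   integrals to [+oo]. *)
pose h k (x : R) := (Num.sqrt (Wb x + k.+1%:R^-1))^-1.
have mWb : measurable_fun [set: R] Wb by exact: nondecreasing_measurable.
have k0 (k : nat) : (0 : R) < k.+1%:R^-1 by rewrite invr_gt0.
have sh k x : 0 < Num.sqrt (Wb x + k.+1%:R^-1) by rewrite sqrtr_gt0 ltr_wpDl.
have mh k : measurable_fun [set: R] (h k).
  apply: nonincreasing_measurable => // a b ab; rewrite /h lef_pV2 ?posrE//.
  by rewrite ler_wsqrtr// lerD2r Wm.
have mhE k : measurable_fun `[0, q] (EFin \o h k) by apply/measurable_EFinP; exact: (measurable_funTS (mh k)).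
have := @cvg_monotone_convergence _ _ _ leb `[0, q] _ (fun k x => (h k x)%:E).
have -> : (\int[leb]_(x in `[0%R, q]) limn (fun k => (h k x)%:E))%E = +oo%E.
  rewrite -hW; apply: eq_integral => x _; apply/cvg_lim => //.
  exact: inv_sqrt_cvg.
move=> /(_ (measurable_itv _)) H.
have {}H : (\int[leb]_(x in `[0%R, q]) (h k x)%:E)%E @[k --> \oo] --> +oo%E.
  apply: H.
  - exact: mhE.
  - by move=> k x _; rewrite lee_fin invr_ge0 ltW.
  - move=> x _ k l kl; rewrite lee_fin /h lef_pV2 ?posrE//.
    by rewrite ler_wsqrtr// lerD2l lef_pV2 ?posrE// ler_nat.
(* The time from [t0] to [q] is at most [q / sqrt (2 * Wb t0)] whatever [c], so a large time up to
   [q] leaves a large time up to [t0]. The factor 2 comes from bounding [sqrt 2] by 2 when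
   [2 * Wb + c] is written as [2 * (Wb + 1 / (k + 1))]. *)
move/cvgeyPge : H => /(_ (2 * (`|Lam| + (Num.sqrt (2 * Wb t0))^-1 * q))) [k _ /(_ k (leqnn k)) Hk].
pose c : R := 2 * k.+1%:R^-1.
have c0 : 0 < c by rewrite mulr_gt0.
exists c => //.
pose P := prim (Num.sqrt c)^-1 (fun t => (Num.sqrt (2 * Wb t + c))^-1).
have q0 : 0 <= q := le_trans (ltW t00) t0q.
have P0 : P 0 = 0 by rewrite /P (prim_le0 (tame_sigma c c0))// mulr0.
have hB t : `|h k t| <= (Num.sqrt k.+1%:R^-1)^-1.
  have hp : 0 < h k t by rewrite invr_gt0.
  rewrite gtr0_norm// /h lef_pV2 ?posrE ?sqrtr_gt0 ?ltr_wpDl//.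
  by rewrite ler_wsqrtr// lerDr.
have ih := bounded_integrable_itvoc q0 (mh k) hB.
have EI : (\int[leb]_(x in `[0%R, q]) (h k x)%:E)%E = (\int[leb]_(x in `]0%R, q]) h k x)%R%:E.
  rewrite -integral_itv_obnd_cbnd; last by apply/measurable_EFinP; exact: (measurable_funTS (mh k)).
  by rewrite /Rintegral fineK//; exact: integrable_fin_num ih.
move: Hk; rewrite EI lee_fin => Hk.
have Pq : 2^-1 * \int[leb]_(x in `]0, q]) h k x <= P q.
  have -> : P q = P q - P 0 by rewrite P0 subr0.
  rewrite (prim_incr (tame_sigma c c0) q0) -RintegralZl//.
  apply: le_Rintegral => //.
  - exact: (@integrableZl _ _ _ leb `]0, q] (measurable_itv _) 2^-1 _ ih).
  - case: (tame_sigma c c0) => mf _ fK; exact: bounded_integrable_itvoc q0 mf fK.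
  move=> x _; rewrite /h -invfM lef_pV2 ?posrE ?mulr_gt0// ?sqrtr_gt0; last first.
    by rewrite ltr_wpDl// mulr_ge0.
  rewrite /c -mulrDr.
  have -> : 2 * Num.sqrt (Wb x + k.+1%:R^-1) = Num.sqrt (4 * (Wb x + k.+1%:R^-1)).
    by rewrite sqrtrM// (_ : 4 = 2 ^+ 2 :> R) ?sqrtr_sqr ?ger0_norm// -natrX.
  by rewrite ler_wsqrtr// ler_wpM2r ?addr_ge0// ?ltW// ltr_nat.
have /andP[_ Pt0] := incr c t0 q c0 t0q.
have : (Num.sqrt (2 * Wb t0 + c))^-1 * (q - t0) <= (Num.sqrt (2 * Wb t0))^-1 * q.
  apply: ler_pM.
  - by rewrite invr_ge0 sqrtr_ge0.
  - by rewrite subr_ge0.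
  - rewrite lef_pV2 ?posrE ?sqrtr_gt0 ?ltr_wpDl ?mulr_ge0 ?mulr_gt0//.
    by rewrite ler_wsqrtr// lerDl ltW.
  - by rewrite lerBlDr lerDl ltW.
move: Pt0 Pq Hk (ler_norm Lam); rewrite -/P; move: (P q) (P t0) (Rintegral _ _ _) => x y z.
move: (_ * (q - t0)) (_ * q) `|Lam| => a b l; clear; lra.
Qed.

End flow_time.

(** * Positivity of the minimizer *)

Section pointwise_bounds.
Context {R : realType} {n : nat}.
Local Notation mu := (@lebesgue_rV R n).
Local Notation Rn := 'rV[R]_n.

(** A mollifier centred at [x] with small support has mass 1 and lives in [U], which is impossible
    on a null set. *)
Lemma open_measure_gt0 (U : set Rn) x : open U -> U x -> (0 < mu U)%E.
Proof.
move=> oU Ux; have mU := open_measurable_rV oU.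
have /nbhs_ballP[r /= r0 xrU] := open_nbhs_nbhs (conj oU Ux).
have [rho [kr rho0 _ rhor rho1]] := mollifier_exists n r0.
rewrite lt0e measure_ge0 andbT; apply/eqP => U0.
have := rho1 x; rewrite (_ : integral _ _ _ = 0%E); first by move=> /eqP; rewrite eq_sym onee_eq0.
have mrho : measurable_fun [set: Rn] (fun y : Rn => rho (x - y)) by exact: kernel_sub_measurable.
transitivity (\int[mu]_(y in U) (rho (x - y))%:E)%E; last first.
  apply: null_set_integral => //; apply/measurable_EFinP; exact: (measurable_funTS mrho).
rewrite [RHS]integral_mkcond; apply: eq_integral => y _; rewrite patchE.
case: ifPn => //; rewrite notin_setE => Uy.
have [->//|/rhor H] := eqVneq (rho (x - y)) 0.
by exfalso; apply/Uy/xrU/ball_rV => // i; have := H i; rewrite !mxE.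
Qed.

Lemma Rintegral_le0 (U : set Rn) (f : Rn -> R) x : open U -> mu.-integrable U (EFin \o f) ->
  (forall y, U y -> 0 <= f y) -> (forall y, U y -> {for y, continuous f}) ->
  \int[mu]_(y in U) f y <= 0 -> U x -> f x = 0.
Proof.
move=> oU fi f0 cf If Ux; have mU := open_measurable_rV oU.
apply: contrapT => /eqP fx0.
have fx : 0 < f x by rewrite lt_neqAle eq_sym fx0 f0.
pose V := [set y | U y /\ 0 < f y].
have oV : open V.
  rewrite openE => y [Uy fy]; apply: filterI; first exact: (open_nbhs_nbhs (conj oU Uy)).
  by have /cvgr_gt := cf y Uy; exact.
have := open_measure_gt0 oV (conj Ux fx).
have mf : measurable_fun U (EFin \o f) by case/integrableP : fi.
have I0 : (\int[mu]_(y in U) `|(EFin \o f) y| = 0)%E.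
  have -> : (\int[mu]_(y in U) `|(EFin \o f) y| = \int[mu]_(y in U) (EFin \o f) y)%E.
    by apply: eq_integral => y; rewrite inE => Uy /=; rewrite ger0_norm// f0.
  apply/eqP; rewrite eq_le integral_ge0 ?andbT; last by move=> y Uy; rewrite lee_fin f0.
  by rewrite -(fineK (integrable_fin_num mU fi)) lee_fin.
have /(ae_eq_integral_abs mu mU mf)[N [mN N0 NS]] := I0.
rewrite lt0e => /andP[/eqP + _]; apply; apply: (subset_measure0 _ mN _ N0).
  exact: open_measurable_rV.
move=> y [Uy fy]; apply: NS => /= /(_ Uy)[fy0].
by rewrite fy0 ltxx in fy.
Qed.

Lemma Linfty_norm_pointwise (U : set Rn) (u : Rn -> R) (q : R) x : open U ->
  (forall y, U y -> {for y, continuous u}) -> (Linfty_norm U u <= q%:E)%E -> U x -> `|u x| <= q.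
Proof.
(* The norm unfolds to an essential supremum only when the whole space has positive measure;
   otherwise it is 0 by convention. *)
move=> oU cu Uq Ux; have mT : (0 < mu [set: Rn])%E.
  by apply: lt_le_trans (open_measure_gt0 oU Ux) _; apply: le_measure; rewrite ?inE//; exact: open_measurable_rV.
move: Uq; rewrite /Linfty_norm; rewrite unlock mT => /ess_sup_inf.ess_supP[N [mN N0 NS]].
rewrite leNgt; apply/negP => qx.
pose V := [set y | U y /\ q < `|u y|].
have oV : open V.
  rewrite openE => y [Uy qy]; apply: filterI; first exact: (open_nbhs_nbhs (conj oU Uy)).
  have cn : {for y, continuous (fun y => `|u y|)} by exact: (cvg_norm (cu y Uy)).
  by have /cvgr_gt := cn; exact.
have := open_measure_gt0 oV (conj Ux qx).
rewrite lt0e => /andP[/eqP + _]; apply; apply: (subset_measure0 _ mN _ N0).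
  exact: open_measurable_rV.
move=> y [Uy qy]; apply: NS => /=; rewrite patchE mem_set//= lee_fin leNgt qy//.
Qed.

Lemma Linfty_norm_le (U : set Rn) (u : Rn -> R) (q : R) : 0 <= q ->
  (forall y, U y -> `|u y| <= q) -> (Linfty_norm U u <= q%:E)%E.
Proof.
move=> q0 uq; rewrite /Linfty_norm unlock; case: ifPn => _; last by rewrite lee_fin.
apply/ess_sup_inf.ess_supP; apply: aeW => y /=; rewrite patchE.
by case: ifPn => [/set_mem/uq|_]; [rewrite lee_fin|rewrite -[point]/(0%E) abse0 lee_fin].
Qed.

(** The Lebesgue number argument for an arbitrary local relation; it yields both uniform continuity
    and the distance from a sublevel set to the boundary. *)
Lemma compact_uniform (K : set Rn) (P : Rn -> Rn -> Prop) : compact K ->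
  (forall x, K x -> exists2 r, 0 < r & forall y z, ball x r y -> ball x r z -> P y z) ->
  exists2 r, 0 < r & forall x y : Rn, K x -> (forall i, `|x ord0 i - y ord0 i| < r) -> P x y.
Proof.
move=> /compact_near_coveringP cK KP.
have H : \forall r \near 0^'+, K `<=` (fun x => forall y, ball x r y -> P x y).
  apply: cK => x /KP[r r0 HP]; have r20 : 0 < r / 2 by rewrite divr_gt0.
  exists (ball x (r / 2), [set t | t < r / 2]).
    by split; [exact: nbhsx_ballx|exact: nbhs_right_lt].
  move=> [y t] [/= xy tr] z yz; have rr : r / 2 <= r by rewrite ler_pdivrMr// ler_peMr ?ltW// ltr1n.
  apply: HP; first exact: le_ball xy.
  by rewrite (splitr r); apply: ball_triangle xy (le_ball (ltW tr) yz).
have [r [r0 Hr]] := filter_ex (filterI (nbhs_right_gt 0) H).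
by exists r => // x y Kx xy; apply: (Hr x Kx); exact/ball_rV.
Qed.

Lemma compact_uniform_continuity (K : set Rn) (u : Rn -> R) (e : R) : compact K ->
  (forall x, K x -> {for x, continuous u}) -> 0 < e ->
  exists2 r, 0 < r & forall x y : Rn, K x -> (forall i, `|x ord0 i - y ord0 i| < r) -> `|u x - u y| <= e.
Proof.
move=> cK cu e0; apply: (@compact_uniform K (fun x y => `|u x - u y| <= e) cK) => x Kx.
have e20 : 0 < e / 2 by rewrite divr_gt0.
have /cvgrPdist_lt/(_ _ e20)/nbhs_ballP[r /= r0 xr] := cu x Kx.
exists r => // y z /xr uy /xr uz; rewrite (splitr e).
by rewrite (le_trans (ler_distD (u x) _ _))// lerD// ltW// distrC.
Qed.

End pointwise_bounds.

(** * The barrier function *)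

Section barrier.
Context {R : realType} {n : nat}.
Local Notation Rn := 'rV[R]_n.

Lemma is_derive_coord i j (x : Rn) : is_derive x 'e_i (fun y : Rn => y ord0 j) (i == j)%:R.
Proof.
apply/is_derive_line0.
have -> : (fun s : R => (x + s *: 'e_i : Rn) ord0 j) = (fun s => (i == j)%:R * s + x ord0 j).
  by apply/funext => s; rewrite !mxE eqxx/= eq_sym addrC mulrC.
have H := is_deriveD (is_deriveM (is_derive_cst ((i == j)%:R : R) (0 : R) 1) (is_derive_id (0 : R) (1 : R)))
   (is_derive_cst (x ord0 j) (0 : R) 1).
by apply: is_derive_eq H _; rewrite scaler0 !addr0 /GRing.scale/= mulr1.
Qed.

Lemma is_derive_coord_comp (g g' : R -> R) i j (x : Rn) : (forall t : R, is_derive t 1 g (g' t)) ->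
  is_derive x 'e_i (fun y : Rn => g (y ord0 j)) ((i == j)%:R * g' (x ord0 j)).
Proof. by move=> dg; have H := is_derive_scalar_comp (is_derive_coord i j x) (dg (x ord0 j)); apply: is_derive_eq H _; rewrite mulrC. Qed.

(** The profile must be positive and bounded, with bounded derivative, on the whole line, because
    the barrier also enters mollifications and global estimates outside [omega]. A Gaussian does
    this and is increasing and convex far enough to the left of its centre. *)
Lemma gaussian_barrier (M : R) : exists (G G1 G2 : R -> R) (Lam : R), [/\ 0 < Lam,
  (forall t : R, is_derive t 1 G (G1 t)) /\ (forall t : R, is_derive t 1 G1 (G2 t)),
  continuous G /\ (continuous G1 /\ continuous G2),
  (forall t, 0 < G t <= Lam) /\ (forall t, `|G1 t| <= Lam) &
  forall t, `|t| <= M -> 1 <= G1 t /\ 1 <= G2 t].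
Proof.
(* For [|t| <= M] the difference [a - t] lies in [[1, 2 * M + 1]]: hence [4 * (a - t) ^ 2 - 2 >= 2],
   and [Lam] is what brings the Gaussian up to at least 1 there. *)
pose a := M + 1; pose Lam := expR ((2 * M + 1) ^+ 2).
pose G t := Lam * expR (- (t - a) ^+ 2); pose G1 t := 2 * (a - t) * G t.
pose G2 t := (4 * (a - t) ^+ 2 - 2) * G t.
have Lam0 : 0 < Lam by exact: expR_gt0.
have dsq (t : R) : is_derive t 1 (fun t : R => - (t - a) ^+ 2) (2 * (a - t)).
  have H := is_deriveB (is_derive_id t (1 : R)) (is_derive_cst a t 1).
  have H2 := is_deriveN (is_deriveM H H).
  by apply: is_derive_eq H2 _; rewrite subr0 /GRing.scale/= !fctE; ring.
have dG (t : R) : is_derive t 1 G (G1 t).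
  have H := is_deriveM (is_derive_cst Lam t 1) (@is_derive1_comp _ expR (fun t : R => - (t - a) ^+ 2) t _ _ (is_derive_expR (- (t - a) ^+ 2)) (dsq t)).
  by apply: is_derive_eq H _; rewrite scaler0 addr0 /GRing.scale/= /G1 /G ?fctE; ring.
have dG1 (t : R) : is_derive t 1 G1 (G2 t).
  have H := is_deriveB (is_derive_cst a t 1) (is_derive_id t (1 : R)).
  have H2 := is_deriveM (is_deriveM (is_derive_cst (2 : R) t 1) H) (dG t).
  by apply: is_derive_eq H2 _; rewrite scaler0 addr0 /GRing.scale/= /G1 /G2 ?fctE; ring.
have G0 t : 0 < G t by rewrite mulr_gt0 ?expR_gt0.
have GL t : G t <= Lam by rewrite /G ler_piMr ?(ltW Lam0)// -[leRHS]expR0 ler_expR oppr_le0 sqr_ge0.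
have dcont (f f' : R -> R) : (forall t : R, is_derive t 1 f (f' t)) -> continuous f.
  by move=> df t; apply: differentiable_continuous; apply/derivable1_diffP; have [] := df t.
have cG := dcont _ _ dG; have cG1 := dcont _ _ dG1.
have cG2 : continuous G2.
  have ca : continuous (fun t : R => a - t) by move=> t; exact: (cvgB (@cvg_cst _ a _ (nbhs t) _) (@cvg_id _ (nbhs t))).
  move=> t; apply: cvgM; last exact: cG.
  apply: cvgB; last exact: cvg_cst.
  by apply: cvgM; [exact: cvg_cst|exact: (cvgM (ca t) (ca t))].
exists G, G1, G2, Lam; split => //.
- split=> t; first by rewrite G0 GL.
  rewrite /G1 normrM (gtr0_norm (G0 t)) /G mulrCA ler_piMr ?(ltW Lam0)// expRN.
  rewrite ler_pdivrMr ?expR_gt0// mul1r normrM ger0_norm//.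
  apply: le_trans (expR_ge1Dx _); rewrite -[(t - a) ^+ 2]sqrrN opprB -real_normK ?num_real//.
  by have := sqr_ge0 (`|a - t| - 1); rewrite sqrrB expr1n mulr1; lra.
- move=> t tM; have tM' : - M <= t <= M by rewrite -ler_norml.
  have at1 : 1 <= a - t <= 2 * M + 1 by rewrite /a; lra.
  have G1' : 1 <= G t.
    rewrite /G /Lam -expRD -[leLHS]expR0 ler_expR subr_ge0 -sqrrN opprB ler_pXn2r ?nnegrE//; lra.
  have sq : 1 <= (a - t) ^+ 2 by apply: exprn_ege1; lra.
  split; rewrite -[1]mulr1 ler_pM//; lra.
Qed.

End barrier.

(** * Passage to the limit *)

Section positivity.
Context {R : realType} {n : nat}.
Local Notation mu := (@lebesgue_rV R n).
Local Notation leb := (@lebesgue_measure R).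
Local Notation Rn := 'rV[R]_n.

(** Near a boundary point [u > delta] makes the claim vacuous, and near an interior point [U] is a
    neighbourhood; compactness of the closure makes the radius uniform. *)
Lemma sublevel_radius (U : set Rn) (u : Rn -> R) (delta : R) : open U -> compact (closure U) ->
  (forall x, closure U x -> {for x, continuous u}) ->
  (forall x, closure U x -> ~ U x -> delta < u x) ->
  exists2 r, 0 < r & forall x y : Rn, U x -> u x <= delta ->
    (forall i, `|x ord0 i - y ord0 i| < r) -> U y.
Proof.
move=> oU cU cu ud.
have [|r r0 Hr] := @compact_uniform _ _ (closure U) (fun x y => u x <= delta -> U y) cU; last first.
  by exists r => // x y Ux ux xy; apply: Hr ux => //; exact: subset_closure.
move=> x Ux; have [xU|xU] := pselect (U x).
  have /nbhs_ballP[r /= r0 xrU] := open_nbhs_nbhs (conj oU xU).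
  by exists r => // y z _ xz _; exact: xrU.
have /cvgr_gt/(_ _ (ud x Ux xU))/nbhs_ballP[r /= r0 xr] := cu x Ux.
by exists r => // y z /xr yd _; rewrite leNgt yd.
Qed.

Lemma pos_part_cvg (f : nat -> R) (a : R) : f k @[k --> \oo] --> a ->
  Num.max (f k) 0 @[k --> \oo] --> Num.max a 0.
Proof.
move=> fa; apply: (@continuous_cvg _ _ _ _ _ _ (fun t : R => Num.max t 0)) => //.
by apply: continuous_max; [exact: cvg_id|exact: cvg_cst].
Qed.

Lemma minimizer_pos (i0 : 'I_n) (U : set Rn) (u : Rn -> R) (W Wb : R -> R) (q delta M B : R) :
  open U -> (mu U < +oo)%E -> U `<=` cube M -> compact (closure U) -> W12 U u ->
  (forall x, U x -> `|u x| <= q) -> 0 < delta -> delta <= q ->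
  (forall x, closure U x -> {for x, continuous u}) ->
  (forall x, closure U x -> ~ U x -> delta < u x) ->
  (forall xi, test_function U xi -> (forall x, U x -> `|u x + xi x| <= q) ->
    (energy W U u <= energy W U (u \+ xi)%R)%E) ->
  {homo Wb : a b / a <= b} -> (forall t, 0 <= Wb t <= B) -> (forall t, t <= 0 -> Wb t = 0) ->
  (forall t a, a < Wb t -> exists2 h, 0 < h & forall s, t - h < s -> a < Wb s) ->
  (forall t, `|t| <= q -> W t = Wb `|t|) ->
  (\int[leb]_(s in `[0%R, q]) ((Num.sqrt (Wb s))%:E)^-1 = +oo)%E \/ (exists2 h, 0 < h & Wb h = 0) ->
  forall x, U x -> 0 < u x.
Proof.
move=> oU Ufin UM cU Wu uq d0 dq cu ud umin Wm WB W0 Wlsc WE hW.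
have mU := open_measurable_rV oU.
have [G [G1 [G2 [Lam [Lam0 [dG dG1] [cG [cG1 cG2]] [GB G1B] GM]]]]] := gaussian_barrier M.
(* Half of [delta] bounds the barrier, which gives the strict inequality [phi < delta] at every
   level. *)
have d20 : 0 < delta / 2 by rewrite divr_gt0.
have d2q : delta / 2 <= q by lra.
have [c c0 HLam] := flow_time Lam Wm WB W0 d20 d2q hW.
have [tau [C [C0 tau0 taud tauL Hflow]]] := regularized_flow Wm WB W0 c0.
pose s0 := Num.sqrt c.
have s00 : 0 < s0 by rewrite sqrtr_gt0.
have q0 : 0 <= q by lra.
have lipc (g : R -> R) : (forall y z, y <= z -> 0 <= g z - g y <= C * (z - y)) ->
    forall y z, `|g y - g z| <= C * `|y - z|.
  move=> gL y z; wlog yz : y z / y <= z.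
    by move=> H; have [/H//|/ltW/H] := leP y z; rewrite distrC (distrC z).
  by rewrite distrC (distrC y) [`|z - y|]ger0_norm ?subr_ge0//; have /andP[? ?] := gL y z yz; rewrite ger0_norm.
have ctau : continuous tau by apply: (@lipschitz_continuous _ _ tau C (ltW C0)); exact: lipc.
have cx : continuous (fun x : Rn => x ord0 i0).
  apply: (@lipschitz_continuous _ _ _ 1 ler01) => x y; rewrite mul1r.
  by have := le_coord_norm (x - y) ord0 i0; rewrite !mxE.
pose p (x : Rn) := tau (G (x ord0 i0)).
have cGx : continuous (fun x : Rn => G (x ord0 i0)) := continuous_rV_comp cx cG.
have cp : continuous p := continuous_rV_comp cGx ctau.
have p0 x : 0 < p x by apply: tau0; case/andP: (GB (x ord0 i0)).
have pd x : p x <= delta / 2.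
  by apply: taud; apply: le_trans HLam; case/andP: (GB (x ord0 i0)).
pose gap (e : R) (phi : Rn -> R) (x : Rn) := s0 * Num.max (phi x - u x - e) 0
    + (if u x + e < phi x then Wb (phi x - 2 * e) - Wb (u x) else 0)
    - (if u x < p x then Wb (p x) - Wb (u x) else 0).
have step e : 0 < e -> exists phi : Rn -> R, (forall x, phi x + 3 * e <= p x <= phi x + C * e) /\
  (measurable_fun U (gap e phi) /\ \int[mu]_(x in U) gap e phi x <= 0).
  move=> e0; have [s [S [g [[dS cs] [sm ls] sW [dg gL] gtau]]]] := Hflow e e0.
  exists (fun x => g (G (x ord0 i0))); split=> [x|]; first exact: gtau.
  have [r1 r10 Hr1] := sublevel_radius oU cU cu ud.
  have [r2 r20 Hr2] := compact_uniform_continuity cU cu e0.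
  (* The three constraints on the mollification radius: staying inside [U] at distance [3 * r],
     oscillation of [u] at most [e], and oscillation of [phi], which is Lipschitz with constant
     [C * Lam], at most [e]. *)
  pose r := Num.min (r1 / 3) (Num.min r2 (e / (C * Lam))).
  have CL0 : 0 < C * Lam by exact: mulr_gt0.
  have r0 : 0 < r by rewrite !lt_min r20 !divr_gt0.
  have cg : continuous g by apply: (@lipschitz_continuous _ _ g C (ltW C0)); exact: lipc.
  have dphi (x : Rn) i : is_derive x 'e_i (fun y : Rn => g (G (y ord0 i0)))
     ((i == i0)%:R * (s (g (G (x ord0 i0))) * G1 (x ord0 i0))).
    exact: (@is_derive_coord_comp _ _ (g \o G) (fun t => s (g (G t)) * G1 t) i i0 x
      (fun t => is_derive1_comp (dg (G t)) (dG t))).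
  have cphi : continuous (fun y : Rn => g (G (y ord0 i0))) := continuous_rV_comp cGx cg.
  have cG1x := continuous_rV_comp cx cG1.
  have cdphi i : continuous (fun x : Rn => (i == i0)%:R * (s (g (G (x ord0 i0))) * G1 (x ord0 i0))).
    apply: continuous_rVM; first exact: cst_continuous.
    by apply: continuous_rVM => //; exact: continuous_rV_comp cphi cs.
  apply: (@level_comparison _ _ U u p _ _ i0 (fun x => G1 (x ord0 i0)) (fun x => G2 (x ord0 i0))
    s S W Wb q delta e r M s0 c B oU Ufin UM Wu uq r0 q0 dq e0 umin Wm WB WE dphi cphi cdphi) => //.
  - by move=> x; have /andP[+ _] := gtau (G (x ord0 i0)); have := pd x; rewrite /p; lra.
  - move=> x y Ux ux xy; apply: (Hr1 x y Ux ux) => i; apply: lt_le_trans (xy i) _.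
    have : r <= r1 / 3 by rewrite ge_min lexx.
    by lra.
  - move=> x y Ux Uy xy; apply: Hr2; first exact: subset_closure.
    by move=> i; apply: lt_le_trans (xy i) _; rewrite !ge_min lexx orbT.
  - move=> x y xy; apply: (le_trans (lipc g gL _ _)).
    apply: (@le_trans _ _ (C * (Lam * r))).
      rewrite ler_pM2l//; apply: le_trans (derive_bounded_lipschitz dG G1B _ _) _.
      by rewrite ler_pM2l// ltW.
    rewrite mulrA -ler_pdivlMl// mulrC; by rewrite /r !ge_min lexx !orbT.
  - move=> x; have := @is_derive_coord_comp _ _ G1 G2 i0 i0 x dG1.
    by rewrite eqxx mul1r.
  - exact: continuous_rV_comp cx cG2.
  - by move=> x; rewrite eqxx mul1r.
  - by move=> i x /negbTE ->; rewrite mul0r.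
  - by move=> x /UM xM; apply: GM; exact: xM.
  - move=> x; have /andP[-> _] := gtau (G (x ord0 i0)) => /=.
    by have := pd x; lra.
have ek k : (0 : R) < k.+1%:R^-1 by rewrite invr_gt0.
pose eps (k : nat) : R := k.+1%:R^-1.
have eps0 : eps k @[k --> \oo] --> (0 : R) by exact: cvg_harmonic.
have epsC (A : R) : A * eps k @[k --> \oo] --> (0 : R).
  by rewrite -(mulr0 A); apply: cvgM => //; exact: cvg_cst.
have [phi Hphi] := choice (fun k => step (eps k) (ek k)).
have phip x : phi k x @[k --> \oo] --> p x.
  apply: (@squeeze_cvgr _ _ _ _ (fun k => p x - C * eps k) (fun=> p x)).
  - near=> k; have [/(_ x)/andP[h1 h2] _] := Hphi k; have := ek k; rewrite -/(eps k); lra.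
  - by rewrite -[X in _ --> X]subr0; apply: cvgB; [exact: cvg_cst|exact: epsC].
  - exact: cvg_cst.
pose F k := (gap (eps k) (phi k)) \_ U.
pose L := (fun x => s0 * Num.max (p x - u x) 0) \_ U.
have FL x : F k x @[k --> \oo] --> L x.
  have [Ux|Ux] := pselect (U x); last first.
    rewrite (_ : (fun k => F k x) = fun=> 0) ?/L ?patchE ?memNset//; first exact: cvg_cst.
    by apply/funext => k; rewrite /F patchE memNset.
  have -> : (fun k => F k x) = (fun k => s0 * Num.max (phi k x - u x - eps k) 0
      + ((if u x + eps k < phi k x then Wb (phi k x - 2 * eps k) - Wb (u x) else 0)
         - (if u x < p x then Wb (p x) - Wb (u x) else 0))).
    by apply/funext => k; rewrite /F patchE mem_set// /gap addrA.
  have -> : L x = s0 * Num.max (p x - u x) 0 + 0 by rewrite /L patchE mem_set// addr0.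
  apply: cvgD.
    apply: cvgM; first exact: cvg_cst.
    apply: pos_part_cvg; rewrite -[X in _ --> X]subr0; apply: cvgB => //.
    by apply: cvgB => //; exact: cvg_cst.
  (* Where [p <= u], the margin puts [phi] below [u + eps], so both potential terms are already
     0. *)
  have [up|pu] := ltP (u x) (p x); last first.
    apply: cvg_near_cst; near=> k; rewrite subr0.
    have [/(_ x)/andP[h1 h2] _] := Hphi k; have := ek k; rewrite -/(eps k) => ek0.
    by rewrite ifF//; apply/negbTE; rewrite -leNgt; lra.
  apply/cvgrPdist_le => /= e e0.
  (* The points [phi - 2 * eps] approach [p] from below: monotonicity bounds [Wb] there from above,
     lower semicontinuity from below. *)
  have [h h0 Hh] := Wlsc (p x) (Wb (p x) - e) ltac:(lra).
  have H1 : \forall k \near \oo, p x - h < phi k x - 2 * eps k.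
    apply: (@cvgr_gt _ _ _ _ _ (p x)); last by rewrite ltrBlDr ltrDl.
    by rewrite -[X in _ --> X]subr0; apply: cvgB.
  have H2 : \forall k \near \oo, u x < phi k x - eps k.
    by apply: (@cvgr_gt _ _ _ _ _ (p x)) => //; rewrite -[X in _ --> X]subr0; apply: cvgB.
  near=> k.
  have -> : u x + eps k < phi k x by rewrite -ltrBrDr; near: k.
  have l1 : Wb (p x) - e < Wb (phi k x - 2 * eps k) by apply: Hh; near: k.
  have l2 : Wb (phi k x - 2 * eps k) <= Wb (p x).
    apply: Wm; have [/(_ x)/andP[h1 h2] _] := Hphi k; have := ek k; rewrite -/(eps k); lra.
  by rewrite sub0r normrN ler_norml; lra.
have mF k : measurable_fun [set: Rn] (F k).
  by have [_ [m _]] := Hphi k; have [h _] := measurable_restrictT (gap (eps k) (phi k)) mU; exact: h.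
have FD k x : `|F k x| <= s0 * (delta + q) + 2 * B.
  have B0 : 0 <= B by case/andP: (WB 0) => /le_trans; apply.
  rewrite /F patchE; case: ifPn => [/set_mem Ux|_]; last first.
    by rewrite normr0 addr_ge0 ?mulr_ge0 ?addr_ge0// ltW.
  have [/(_ x)/andP[h1 h2] _] := Hphi k; have := ek k; rewrite -/(eps k) => ek0.
  have l0 : 0 <= Num.max (phi k x - u x - eps k) 0 by rewrite le_max lexx orbT.
  have l1 : Num.max (phi k x - u x - eps k) 0 <= delta + q.
    have := uq x Ux; have := pd x; rewrite ler_norml ge_max; lra.
  have l3 : s0 * Num.max (phi k x - u x - eps k) 0 <= s0 * (delta + q) by rewrite ler_pM2l.
  have l4 : 0 <= s0 * Num.max (phi k x - u x - eps k) 0 by rewrite mulr_ge0// ltW.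
  by apply: gap_bound; rewrite ?l3 ?l4.
have FM k x : F k x != 0 -> cube M x.
  by rewrite /F patchE; case: ifPn => [/set_mem/UM//|_]; rewrite eqxx.
have [bL cvgL] := bounded_cvg_integral mF FD FM FL.
have L0 : \int[mu]_x L x <= 0.
  apply: (ler_cvg_to cvgL (cvg_cst 0)); near=> k.
  by have [_ [_ h]] := Hphi k; move: h; rewrite Rintegral_mkcond.
(* The limit integrand is nonnegative and continuous on [U] with nonpositive integral, so it
   vanishes at every point and not only almost everywhere. *)
move=> x Ux; apply: lt_le_trans (p0 x) _; rewrite -subr_le0.
have iL : mu.-integrable U (EFin \o (fun x => s0 * Num.max (p x - u x) 0)).
  apply/(integrable_mkcond _ mU).2; have := bms_integrable bL.
  by apply: eq_integrable => // y _; rewrite /L /= !patchE; case: ifP.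
have := @Rintegral_le0 _ _ U _ x oU iL _ _ _ Ux.
move=> H; have : s0 * Num.max (p x - u x) 0 = 0.
  apply: H.
  - by move=> y _; rewrite mulr_ge0 ?(ltW s00)// le_max lexx orbT.
  - move=> y Uy; have cuy := cu y (@subset_closure _ U y Uy).
    have cmax : continuous (fun t : R => s0 * Num.max t 0).
      move=> t; apply: cvgM; first exact: cvg_cst.
      by apply: continuous_max; [exact: cvg_id|exact: cvg_cst].
    exact: (@continuous_comp _ _ _ (fun x => p x - u x) (fun t : R => s0 * Num.max t 0) y (cvgB (cp y) cuy) (cmax _)).
  - by move: L0; rewrite [in X in X -> _]/L -Rintegral_mkcond.
move/eqP; rewrite mulf_eq0 gt_eqF//= => /eqP <-.
by rewrite le_max lexx.
Unshelve. all: by end_near. Qed.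

End positivity.

Lemma clamp_lipschitz (R : realType) (q s t : R) : s <= t ->
  Num.min (Num.max t 0) q - Num.min (Num.max s 0) q <= t - s.
Proof.
by move=> st; rewrite !minEle !maxEle; do 4 case: ifPn => //; rewrite -?ltNge; lra.
Qed.

Theorem proposition2p5 (R : realType) (n : nat) (hn : (1 <= n)%N)
  (q : R) (hq : 0 < q)
  (Wrad : R -> R)
  (Wrad_ge0 : forall s : R, s \in `[0, q] -> 0 <= Wrad s)
  (Wrad_nd : {in `[0, q] &, {homo Wrad : s t / s <= t}})
  (Wrad_lsc : @lower_semicontinuous (subspace `[0, q]) R (EFin \o Wrad))
  (Wrad0 : Wrad 0 = 0)
  (W : R -> R)
  (W_def : forall s : R, s \in `[- q, q] -> W s = Wrad `|s|)
  (hW : (\int[lebesgue_measure]_(s in `[0%R, q])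
           ((Num.sqrt (W s))%:E)^-1 = +oo)%E \/
        (\forall s \near (0 : R), W s = 0))
  (Omega : set 'rV[R]_n) (Omega_open : open Omega)
  (omega : set 'rV[R]_n) (omega_open : open omega)
  (omega_bounded : bounded_set omega)
  (omega_lipschitz : lipschitz_boundary omega)
  (omega_sub : closure omega `<=` Omega)
  (u : 'rV[R]_n -> R)
  (u_W12 : W12_loc Omega u)
  (u_bound : (Linfty_norm Omega u <= q%:E)%E)
  (u_min : local_minimizer q W Omega u)
  (u_continuous : {within Omega, continuous u})
  (u_pos : forall x : 'rV[R]_n, (closure omega `\` interior omega) x -> 0 < u x) :
  forall x : 'rV[R]_n, omega x -> 0 < u x.

Proof.
(* The coordinate in which the barrier varies. *)
pose i0 : 'I_n := Ordinal hn.
have cu x : closure omega x -> {for x, continuous u}.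
  move=> /omega_sub Ox; move: u_continuous; rewrite continuous_open_subspace// => H.
  by apply: H; rewrite inE.
have uq x : omega x -> `|u x| <= q.
  move=> ox; apply: (Linfty_norm_pointwise Omega_open _ u_bound); last exact/omega_sub/subset_closure.
  move=> y Oy; move: u_continuous; rewrite continuous_open_subspace// => H.
  by apply: H; rewrite inE.
have [M oM] : exists M, omega `<=` cube M.
  have [M [_ HM]] := omega_bounded; exists (M + 1) => x ox i.
  by apply: le_trans (le_coord_norm x ord0 i) _; apply: HM => //; rewrite ltrDl.
have fin : (lebesgue_rV n omega < +oo)%E.
  by apply: le_lt_trans (cube_fin n M); apply: le_measure => //; rewrite inE; [exact: open_measurable_rV|exact: measurable_cube].
have clM : closure omega `<=` cube M.
  have cM : closed (@cube R n M) by apply: compact_closed; [exact: norm_hausdorff|exact: cube_compact].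
  by rewrite closureE => x; apply.
have co : compact (closure omega).
  by apply: (subclosed_compact _ (@cube_compact R n M)) => //; exact: closed_closure.
have iO : interior omega = omega by exact: (interior_id omega).1 omega_open.
have [delta [d0 dq ud]] : exists delta, [/\ 0 < delta, delta <= q &
    forall x, closure omega x -> ~ omega x -> delta < u x].
  have cB : compact (closure omega `\` omega).
    apply: (subclosed_compact _ co) => [|x []//].
    by apply: closedI; [exact: closed_closure|exact: open_closedC].
  have [[x Bx]|B0] := pselect (closure omega `\` omega !=set0).
    have cB' : {within closure omega `\` omega, continuous u}.
      by apply: continuous_in_subspaceT => y /set_mem[cy _]; exact: cu.
    have [y /set_mem[cy ny] ymin] := EVT_min_rV (ex_intro _ x Bx) cB cB'.
    have uy : 0 < u y by apply: u_pos; rewrite iO.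
    exists (Num.min q (u y / 2)); split; first by rewrite lt_min hq divr_gt0.
      by rewrite ge_min lexx.
    move=> z cz nz; apply: (@lt_le_trans _ _ (u y)); last by apply: ymin; rewrite inE.
    by rewrite gt_min; apply/orP; right; rewrite ltr_pdivrMr// ltr_pMr// ltr1n.
  (* Without boundary points the condition on [delta] is vacuous. *)
  by exists q; split => // x cx nx; case: B0; exists x.
(* Clamping also continues the potential by [Wrad q] above [q], so that [Wb] is nondecreasing and
   bounded on the whole line. *)
pose clamp t := Num.min (Num.max t 0) q; pose Wb t := Wrad (clamp t).
have clampP t : clamp t \in `[0, q] by rewrite in_itv/= le_min ge_min lexx le_max lexx !orbT (ltW hq).
have clampid t : 0 <= t <= q -> clamp t = t by move=> /andP[t0 tq]; rewrite /clamp max_l// min_l.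
have clamp_nd : {homo clamp : s t / s <= t}.
  by move=> s t st; rewrite /clamp le_min !ge_min lexx orbT andbT ge_max !le_max st lexx !orbT.
have Wm : {homo Wb : s t / s <= t} by move=> s t st; apply: Wrad_nd => //; exact: clamp_nd.
have qI : q \in `[0, q] by rewrite in_itv/= lexx ltW.
have WB t : 0 <= Wb t <= Wrad q.
  rewrite Wrad_ge0//=; apply: Wrad_nd => //.
  by have := clampP t; rewrite in_itv/= => /andP[].
have W0 t : t <= 0 -> Wb t = 0.
  by move=> t0; rewrite /Wb /clamp max_r// min_l// ltW.
have WE t : `|t| <= q -> W t = Wb `|t|.
  by move=> tq; rewrite /Wb clampid ?normr_ge0// W_def// in_itv/= -ler_norml.
have Wlsc t a : a < Wb t -> exists2 h, 0 < h & forall s, t - h < s -> a < Wb s.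
  (* To the right of [t] monotonicity suffices; to the left, [clamp] is 1-Lipschitz, so a
     neighbourhood of [clamp t] in [[0, q]] pulls back to an interval of the same radius. *)
  move=> aW; have [|V + HV] := Wrad_lsc (clamp t) a; first by rewrite lte_fin.
  rewrite (_ : nbhs _ = within `[0, q] (nbhs (clamp t))); last by rewrite nbhs_subspace_in//=; exact: clampP.
  move=> /nbhs_ballP[h /= h0 hV]; exists h => // s ts; have [st|st] := leP t s.
    by apply: lt_le_trans aW _; exact: Wm.
  rewrite -lte_fin; apply/HV/hV => //.
  rewrite /ball/= ger0_norm ?subr_ge0 ?clamp_nd ?(ltW st)//.
  by apply: le_lt_trans (clamp_lipschitz q (ltW st)) _; rewrite ltrBlDl -ltrBlDr.
apply: (@minimizer_pos _ _ i0 omega u W Wb q delta M (Wrad q)) => //.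
- exact: u_W12.
- move=> xi txi uxiq; apply: u_min => //; first exact: test_function_W12_0.
  by apply: Linfty_norm_le uxiq; exact: ltW.
- case: hW => [<-|/nbhs_ballP[h /= h0 Hh]]; [left|right].
    apply: eq_integral => s; rewrite inE/= in_itv/= => /andP[s0 sq].
    by rewrite WE ?ger0_norm.
  have m0 : 0 < Num.min (h / 2) q by rewrite lt_min divr_gt0.
  exists (Num.min (h / 2) q) => //.
  rewrite -[X in Wb X](gtr0_norm m0) -WE; last by rewrite gtr0_norm// ge_min lexx orbT.
  apply: Hh; rewrite /ball/= sub0r normrN gtr0_norm// gt_min ltr_pdivrMr// ltr_pMr// ltr1n//.
Qed.
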